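(* Let $G$ be a connected, locally finite, quasi-transitive unimodular graph, let $p\in[0,1]$, and consider Bernoulli($p$) bond percolation on $G$, where $p$ is such that the percolation has infinitely many infinite clusters almost surely. Then, almost surely, any two distinct infinite clusters touch each other in only finitely many vertices; that is, almost surely, for every ordered pair $(C,C')$ of distinct infinite clusters the set $\tau(C,C')$ is finite.
   Context: A graph $G$ is quasi-transitive if its automorphism group $\mathrm{Aut}(G)$ acts on $V(G)$ with finitely many orbits. For $x\in V(G)$ let $S_x$ be the stabilizer of $x$ in $\mathrm{Aut}(G)$ and $S_x y$ the orbit of $y$ under $S_x$. A quasi-transitive graph $G$ is unimodular if there is $K>0$ such that $|S_x y|/|S_y x|\le K$ for all $x,y\in V(G)$. In Bernoulli($p$) bond percolation each edge of $G$ is independently open with probability $p$ and closed otherwise. Clusters are the connected components of the subgraph formed by all vertices and the open edges. For distinct infinite clusters $C,C'$, $\tau(C,C')$ denotes the set of vertices in $C$ that are at distance $1$ in $G$ from $C'$ (the touching points). *)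

(* Defs.v *)
From mathcomp Require Import all_boot all_order all_algebra.
From mathcomp Require Import finmap.
From mathcomp Require Import all_classical all_reals all_analysis.

Set Implicit Arguments.
Unset Strict Implicit.
Unset Printing Implicit Defensive.

Import Order.TTheory GRing.Theory Num.Theory.
Local Open Scope classical_set_scope.
Local Open Scope ring_scope.

(* Simple undirected graphs on a possibly infinite vertex type. Relations are
   boolean-valued, which is no restriction in the presence of choice. *)
Record graph (V : Type) := Graph {
  adj :> rel V;
  adj_sym : symmetric adj;
  adj_irrefl : irreflexive adj }.

Section Walks.
Variable V : Type.
Implicit Types (e : rel V) (x y : V) (A : set V) (n : nat).

Definition walk e n x y : Prop :=
  exists s : seq V, [/\ size s = n, path e x s & last x s = y].

Definition linked e x y : Prop := exists n, walk e n x y.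

Definition component e x : set V := [set y | linked e x y].

(* The graph distance from x to the set A is equal to n. In particular this
   fails for every n when no point of A can be reached from x. *)
Definition set_dist_eq e x A n : Prop :=
  (exists2 y, A y & walk e n x y) /\
  (forall m y, A y -> walk e m x y -> (n <= m)%N).

End Walks.

Section Graphs.
Variable V : choiceType.
Variable G : graph V.

Definition connected_graph : Prop := forall x y, linked G x y.

Definition locally_finite : Prop := forall x, finite_set [set y | G x y].

Definition Aut : set (V -> V) :=
  [set f | bijective f /\ forall x y, G (f x) (f y) = G x y].

Definition Aut_orbit (x : V) : set V := [set f x | f in Aut].

Definition quasi_transitive : Prop := finite_set (range Aut_orbit).

Definition stab (x : V) : set (V -> V) := [set f | Aut f /\ f x = x].

Definition stab_orbit (x y : V) : set V := [set f y | f in stab x].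

(* [fset_set] sends infinite sets to the empty set, so the quotient below is
   meaningful only when the orbits of stabilizers are finite. This holds in
   connected locally finite graphs, since [stab_orbit x y] lies in a sphere
   around x. *)
Definition unimodular (R : realType) : Prop :=
  exists2 K : R, 0 < K & forall x y : V,
    #|` fset_set (stab_orbit x y)|%:R / #|` fset_set (stab_orbit y x)|%:R <= K.

Definition edges : set {fset V} :=
  [set e | exists x y, G x y /\ e = [fset x; y]%fset].

(* A configuration is the set w of open edges; elements of w which are not
   edges of G are irrelevant. *)
Definition open_rel (w : set {fset V}) : rel V :=
  fun x y => G x y && `[< w [fset x; y]%fset >].

Definition clusters (w : set {fset V}) : set (set V) :=
  range (component (open_rel w)).

Definition infinite_clusters (w : set {fset V}) : set (set V) :=
  [set C | clusters w C /\ infinite_set C].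

Definition touching (C C' : set V) : set V :=
  [set x | C x /\ set_dist_eq G x C' 1].

End Graphs.

Definition independent_events d (T : measurableType d) (R : realType)
    (P : probability T R) (I : choiceType) (D : set I) (A : I -> set T) : Prop :=
  (forall i, D i -> measurable (A i)) /\
  (forall F : {fset I}, [set` F] `<=` D ->
     P (\bigcap_(i in [set` F]) A i) = (\prod_(i <- F) P (A i))%E).

(* The random set w of open edges of G, defined on an arbitrary probability
   space, is a Bernoulli(p) bond percolation on G. *)
Definition bernoulli_bond_percolation (V : choiceType) (G : graph V)
    d (T : measurableType d) (R : realType) (P : probability T R) (p : R)
    (w : T -> set {fset V}) : Prop :=
  let is_open e := [set t | w t e] in
  independent_events P (edges G) is_open /\
  (forall e, edges G e -> P (is_open e) = p%:E).

(* Main.v *)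
(** A mark is a pair of adjacent vertices in distinct open clusters that are
    joined by infinitely many edges of G; it suffices to show that marks have
    probability 0.  Distances inside a cluster are measured by the number of
    open bridges that separate two vertices (the level).

    Opening a closed edge x y between two clusters turns it into a bridge, and a
    path contains at most one separating bridge of each level.  By the mass
    transport principle the expected number of edges u v between the clusters of
    x and y with u at level n from x is therefore at most s n, where s tends to
    0.  Almost surely such edges are thus locally finite for the level, and their
    levels have arbitrarily long gaps.

    By mass transport again, an invariant set of edges between two given
    clusters is empty or infinite.  Hence from every mark (x, y) there are, at
    arbitrarily high levels, bridges behind which the cluster of x still touches
    that of y infinitely often.

    Call y a trivertex if its removal leaves three pieces of its cluster which
    touch another given cluster infinitely often.  The gaps in the levels cut
    the trivertices into finite cells; at most half of the vertices of a cell
    branch inside the cell (Burton and Keane), while almost all of them do when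
    the cells are coarse.  So there are no trivertices, even after finitely many
    changes.  This implies that a mark has at most two of the above bridges at
    each level, and that behind a bridge at most two clusters are touched in
    this way.

    Finally let each mark send unit mass to its bridges at levels below N.  By
    the Cauchy-Schwarz inequality N P(mark) is controlled by the expected number
    of pairs of marks between the same two clusters at mutual level below 2 N,
    which is o(N) for each bridge that sees them.  Hence P(mark) = 0. *)

Require Import Defs.
From mathcomp Require Import all_boot all_order all_algebra.
From mathcomp Require Import finmap.
From mathcomp Require Import all_classical all_reals all_analysis.
From mathcomp Require Import measurable_realfun.
From mathcomp Require Import zify lra.

Set Implicit Arguments.
Unset Strict Implicit.
Unset Printing Implicit Defensive.

Local Open Scope classical_set_scope.

(** * Bridges and levels *)

Section Linked.
Variable V : choiceType.
Implicit Types (e : rel V) (x y z s t u v a b : V).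

(** Levels replace distances because finite energy can read them: a closed edge [x y], once opened,
    is the separating bridge of level n seen from [u]. Hence [u v] is charged at most once for each
    n, and only if the level between the adjacent vertices [u] and [v] exceeds n. This is the tail
    of a finite random variable, so s tends to 0. Opening an edge costs the factor (1 - p) / p,
    which is why p = 0 and p = 1 are set apart.

    The obstacle is that infinitely many vertices of a cluster may share a level. Finiteness holds
    only for edges towards one fixed other cluster, so trivertices are taken relative to a touched
    cluster and within bounded open distance of it.

    Mass transport is used as an inequality, with a constant K and a finite list of orbit
    representatives; this suffices because only finite or vanishing received masses matter.

    The Cauchy-Schwarz step has the linear form m n <= n^2 + m^2 with m free, so no second moment
    has to be finite beforehand. With N = M m the error m^2 is a small fraction of m N for large
    M. *)

Lemma walk0 e x y : walk e 0 x y <-> x = y.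
Proof.
split=> [[s [/size0nil -> _ <-]]//|->]; by exists [::].
Qed.

Lemma walkS e n x y : walk e n.+1 x y <-> exists2 z, e x z & walk e n z y.
Proof.
split=> [[[|z s] [] //= [ss] /andP[exz ps] ls]|[z exz [s [ss ps ls]]]].
  by exists z => //; exists s.
by exists (z :: s); split=> //=; rewrite ?ss ?exz.
Qed.

Lemma walk_cat e m n x y z :
  walk e m x y -> walk e n y z -> walk e (m + n) x z.
Proof.
elim: m x => [|m IH] x; first by move/walk0 ->.
move/walkS=> [t ext wt] wy; apply/walkS; exists t => //; exact: IH.
Qed.

Lemma linked_refl e x : linked e x x.
Proof. by exists 0; apply/walk0. Qed.

Lemma linked_step e x y : e x y -> linked e x y.
Proof. by move=> exy; exists 1; apply/walkS; exists y => //; apply/walk0. Qed.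

Lemma linked_trans e y x z : linked e x y -> linked e y z -> linked e x z.
Proof. by move=> [m wm] [n wn]; exists (m + n); exact: walk_cat wn. Qed.

Lemma linked_ind e (P : V -> Prop) x : P x ->
  (forall s t, P s -> e s t -> P t) -> forall y, linked e x y -> P y.
Proof.
move=> Px HP y [n]; elim: n x Px => [|n IH] x Px; first by move/walk0 <-.
by move/walkS=> [z exz]; apply: IH; exact: HP exz.
Qed.

Lemma linked_map e e' (f : V -> V) :
  (forall s t, e s t -> linked e' (f s) (f t)) ->
  forall x y, linked e x y -> linked e' (f x) (f y).
Proof.
move=> H x; apply: linked_ind; first exact: linked_refl.
by move=> s t ls /H; exact: linked_trans.
Qed.

Lemma linked_sub e e' : subrel e e' ->
  forall x y, linked e x y -> linked e' x y.
Proof. by move=> H; apply: (@linked_map e e' id) => s t /H; exact: linked_step. Qed.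

Lemma walk_sym e n x y : symmetric e -> walk e n x y -> walk e n y x.
Proof.
move=> es; elim: n x y => [|n IH] x y; first by move/walk0 ->; apply/walk0.
move/walkS=> [z exz /IH w]; rewrite -addn1; apply: walk_cat w _.
by apply/walkS; exists x; [rewrite es|apply/walk0].
Qed.

Lemma linked_sym e x y : symmetric e -> linked e x y -> linked e y x.
Proof. by move=> es [n /(walk_sym es)]; exists n. Qed.

Definition same_edge a b : rel V :=
  [rel s t | (s == a) && (t == b) || (s == b) && (t == a)].

Definition cut e a b : rel V := [rel s t | e s t && ~~ same_edge a b s t].

Definition ins e a b : rel V := [rel s t | e s t || same_edge a b s t].

(** The vertex type stays the same: [y] survives as an isolated vertex, still linked to itself. *)
Definition delv e y : rel V := [rel s t | [&& e s t, s != y & t != y]].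

Lemma same_edgeC a b s t : same_edge a b s t = same_edge b a s t.
Proof. by rewrite /same_edge /= orbC. Qed.

Lemma same_edge_sym a b : symmetric (same_edge a b).
Proof.
by move=> s t; rewrite /same_edge /= orbC; congr orb; rewrite andbC.
Qed.

Lemma cutC e a b : cut e a b = cut e b a.
Proof. by apply/funext => s; apply/funext => t; rewrite /cut /= same_edgeC. Qed.

Lemma cut_cut e a b c d : cut (cut e a b) c d = cut (cut e c d) a b.
Proof. by apply/funext => s; apply/funext => t; rewrite /cut /= -!andbA (andbC (~~ _)). Qed.

Lemma sym_cut e a b : symmetric e -> symmetric (cut e a b).
Proof. by move=> es s t; rewrite /cut /= es same_edge_sym. Qed.

Lemma sym_delv e y : symmetric e -> symmetric (delv e y).
Proof. by move=> es s t; rewrite /delv /= es (andbC (t != y)). Qed.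

Lemma sub_cut e a b : subrel (cut e a b) e.
Proof. by move=> s t /andP[]. Qed.

Lemma sub_cut2 e e' a b : subrel e e' -> subrel (cut e a b) (cut e' a b).
Proof. by move=> H s t /andP[st nst]; rewrite /cut /= H. Qed.

Lemma sub_delv e y : subrel (delv e y) e.
Proof. by move=> s t /and3P[]. Qed.

(* If a b is a bridge, far e a b is the side of b. *)
Definition far e a b s := linked (cut e a b) b s.

Definition bridge e a b := e a b /\ ~ far e a b a.

Lemma bridgeC e a b : symmetric e -> bridge e a b -> bridge e b a.
Proof.
move=> es [eab nf]; split; first by rewrite es.
by move=> f; apply: nf; apply: linked_sym; [exact: sym_cut|rewrite cutC].
Qed.

Section Bridge.
Variables (e : rel V) (a b : V).
Hypothesis es : symmetric e.
Hypothesis ab : bridge e a b.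

Let ret s := if `[< far e a b s >] then a else s.

(** Collapsing the far side onto [a] turns each edge into an edge that avoids the bridge or into a
    point, since an edge with exactly one end on the far side can only be the bridge itself. The
    form with [e'] allows other edges to be removed as well. *)
Lemma retract e' s t : subrel e' e -> linked e' s t ->
  linked (cut e' a b) (ret s) (ret t).
Proof.
move=> se; apply: linked_map => {}s {}t st; rewrite /ret.
have est : e s t by exact: se.
case: asboolP => fs; case: asboolP => ft; try exact: linked_refl.
- suff ->: t = a by exact: linked_refl.
  have [/orP[/andP[/eqP sa /eqP tb]|/andP[/eqP sb /eqP ta]]//|se'] :=
    boolP (same_edge a b s t).
    by case: (proj2 ab); rewrite -{2}sa.
  case: ft; apply: linked_trans fs _; apply: linked_step.
  by rewrite /cut /= est.
- suff ->: s = a by exact: linked_refl.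
  have [/orP[/andP[/eqP sa /eqP tb]|/andP[/eqP sb /eqP ta]]//|se'] :=
    boolP (same_edge a b s t).
    by case: (proj2 ab); rewrite -{2}ta.
  case: fs; apply: linked_trans ft _; apply: linked_step.
  by rewrite /cut /= es est same_edge_sym.
- have [/orP[/andP[/eqP sa /eqP tb]|/andP[/eqP sb /eqP ta]]//|se'] :=
    boolP (same_edge a b s t).
    by case: ft; rewrite tb; exact: linked_refl.
    by case: fs; rewrite sb; exact: linked_refl.
  by apply: linked_step; rewrite /cut /= st.
Qed.

Lemma cross_near e' s t : subrel e' e -> ~ far e a b s -> far e a b t ->
  linked e' s t -> linked (cut e' a b) s a.
Proof.
by move=> se ns ft /(retract se); rewrite /ret (asboolF ns) (asboolT ft).
Qed.

Lemma cross_stay e' s t : subrel e' e -> ~ far e a b s -> ~ far e a b t ->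
  linked e' s t -> linked (cut e' a b) s t.
Proof.
by move=> se ns nt /(retract se); rewrite /ret (asboolF ns) (asboolF nt).
Qed.

Lemma farVnear u : linked e a u -> far e a b u \/ far e b a u.
Proof.
move=> au; have [f|nf] := pselect (far e a b u); [by left|right].
rewrite /far cutC; apply: cross_stay au => //; exact: (proj2 ab).
Qed.

Lemma far_nfar u : far e a b u -> ~ far e b a u.
Proof.
move=> f f'; apply: (proj2 ab); apply: linked_trans f _.
by apply: linked_sym; [exact: sym_cut|move: f'; rewrite /far cutC].
Qed.

End Bridge.

Lemma nearP e a b u : symmetric e -> bridge e a b -> linked e a u ->
  ~ far e a b u <-> far e b a u.
Proof.
move=> es ab au; split; first by case: (farVnear es ab au).
by move=> f f'; apply: (far_nfar es ab f').
Qed.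

Lemma far_linked e a b s : far e a b s -> linked e b s.
Proof. by apply: linked_sub; exact: sub_cut. Qed.

(** Bridges are oriented from [u] towards [v], so each separating edge is listed once, and
    exchanging [u] and [v] reverses the pairs. *)
Definition Bd e u v : set (V * V) :=
  [set c | [/\ bridge e c.1 c.2, far e c.2 c.1 u & far e c.1 c.2 v]].

(* The quantity that plays the role of a distance: the number of bridges that
   separate u from v. *)
Definition lev e u v : nat := #|` fset_set (Bd e u v)|.

Section Bd.
Variable e : rel V.
Hypothesis es : symmetric e.

Lemma Bd_linked u v c : Bd e u v c -> linked e u v.
Proof.
move=> [[c1 _] fu fv]; apply: linked_trans (far_linked fv).
apply: linked_trans (linked_step c1); apply: linked_sym => //.
exact: far_linked fu.
Qed.

Lemma BdC u v a b : Bd e u v (a, b) -> Bd e v u (b, a).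
Proof. by move=> [/= ab fu fv]; split=> //=; exact: bridgeC. Qed.

Lemma Bdxx u : Bd e u u = set0.
Proof.
apply/seteqP; split=> // -[a b] [/= ab fu fu'].
exact: (far_nfar es ab fu').
Qed.

Lemma Bd_triangle u w v : linked e u w -> Bd e u v `<=` Bd e u w `|` Bd e w v.
Proof.
move=> uw [a b] [/= ab fu fv].
have : linked e a w by apply: linked_trans uw; exact: far_linked fu.
by case/(farVnear es ab) => fw; [left|right]; split.
Qed.

(** An edge different from a bridge has both ends on the same side of it. *)
Lemma Bd_step u w : e u w -> Bd e u w `<=` [set (u, w)].
Proof.
move=> uw [a b] [/= ab fu fw].
have [/orP[/andP[/eqP -> /eqP ->]//|/andP[/eqP ub /eqP wa]]|ne] :=
  boolP (same_edge a b u w).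
  by case: (proj2 ab); rewrite -{2}wa.
case: (far_nfar es ab fw); apply: linked_trans fu _; apply: linked_step.
by rewrite /cut /= uw same_edgeC.
Qed.

Lemma Bd_walk n u v : walk e n u v ->
  finite_set (Bd e u v) /\ lev e u v <= n.
Proof.
elim: n u => [|n IH] u.
  by move/walk0 ->; rewrite /lev Bdxx fset_set0 cardfs0; split.
move/walkS=> [w uw /IH [fin le]].
have sub : Bd e u v `<=` [set (u, w)] `|` Bd e w v.
  move=> c /(Bd_triangle (linked_step uw)) [/(Bd_step uw) ->|]; by [left|right].
have finU : finite_set ([set (u, w)] `|` Bd e w v).
  by rewrite finite_setU; split; [exact: finite_set1|exact: fin].
split; first exact: sub_finite_set finU.
apply: (@leq_trans #|` fset_set ([set (u, w)] `|` Bd e w v)|).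
  apply: fsubset_leq_card; rewrite -fset_set_sub //; exact: sub_finite_set finU.
  rewrite fset_setU //.
rewrite (leq_trans (leq_card_fsetU _ _)) // fset_set1 cardfs1 add1n.
by rewrite ltnS.
Qed.

Lemma Bd_finite u v : finite_set (Bd e u v).
Proof.
have [[n /Bd_walk[]//]|nl] := pselect (linked e u v).
by apply: (sub_finite_set _ (finite_set0 _)) => c /Bd_linked.
Qed.

Lemma lev_walk n u v : walk e n u v -> lev e u v <= n.
Proof. by case/Bd_walk. Qed.

Lemma levxx u : lev e u u = 0.
Proof. by rewrite /lev Bdxx fset_set0 cardfs0. Qed.

Lemma lev_triangle u w v : linked e u w ->
  lev e u v <= lev e u w + lev e w v.
Proof.
move=> uw; rewrite (leq_trans _ (leq_card_fsetU _ _)) //.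
rewrite -fset_setU; try exact: Bd_finite.
apply: fsubset_leq_card; rewrite -fset_set_sub; try exact: Bd_finite.
  exact: Bd_triangle.
by rewrite finite_setU; split; exact: Bd_finite.
Qed.

Lemma levC u v : lev e u v = lev e v u.
Proof.
suff H u' v' : lev e u' v' <= lev e v' u' by apply/eqP; rewrite eqn_leq !H.
rewrite /lev -(size_map (fun c : V * V => (c.2, c.1))); apply: uniq_leq_size.
  by rewrite map_inj_uniq ?fset_uniq // => -[a b] [c d] [-> ->].
move=> _ /mapP[[a b] /= + ->].
rewrite !in_fset_set; try exact: Bd_finite.
by rewrite !inE => /BdC.
Qed.

(** If [v] were on the side of [u] for some bridge [p q] between [u] and [a], a path from [u] to [v]
    off [p q] would cross [a b]. It would thus reach [a] off [p q], although [p q] separates [u]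
    from [a]. *)
Lemma Bd_sub u v a b : Bd e u v (a, b) -> Bd e u a `<=` Bd e u v.
Proof.
move=> [/= ab fu fv] [p q] [/= pq fpu fpa]; split=> //=.
have pa : linked e p u := far_linked fpu.
have pv : linked e p v.
  apply: linked_trans pa (Bd_linked (c := (a, b)) _); split=> //.
have [//|nfv] := pselect (far e p q v).
have fv' : far e q p v by apply/nearP.
have uv : linked (cut e p q) u v.
  rewrite cutC; apply: linked_trans fv'; apply: linked_sym => //.
  exact: sym_cut.
case: (far_nfar es pq fpa); rewrite /far; apply: (linked_trans fpu).
rewrite cutC; apply: (linked_sub (@sub_cut _ a b)).
apply: (@cross_near e a b es ab _ _ v) => //; first exact: sub_cut.
by move=> f; apply: (far_nfar es ab f).
Qed.

Lemma lev_lt u v a b : Bd e u v (a, b) -> lev e u a < lev e u v.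
Proof.
move=> c; have s := Bd_sub c.
rewrite /lev; apply: fproper_ltn_card; rewrite fproperEneq.
apply/andP; split; last by rewrite -fset_set_sub //; exact: Bd_finite.
apply/eqP => E.
have: (a, b) \in fset_set (Bd e u v).
  by rewrite in_fset_set ?inE //; exact: Bd_finite.
rewrite -E in_fset_set; last exact: Bd_finite.
by rewrite inE => -[/= [_ nf] _ /nf].
Qed.

(** If [a'] is not beyond [a b], neither is [b']; then a path from [b'] to [v] must pass through
    [a], so [a] is beyond [a' b']. *)
Lemma bridge_nested u v c d : Bd e u v c -> Bd e u v d -> c <> d ->
  Bd e u d.1 c \/ Bd e u c.1 d.
Proof.
move: c d => [a b] [a' b'] [/= ab fu fv] [/= ab' fu' fv'] ne.
have aa' : linked e a a'.
  apply: linked_trans (far_linked fu) _; apply: linked_sym => //.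
  exact: far_linked fu'.
have [f|nf] := pselect (far e a b a'); first by left; split.
right; split=> //=.
have na' : far e b a a' by apply/nearP.
have na'b' : ~ same_edge a b a' b'.
  case/orP=> /andP[/eqP E1 /eqP E2]; first by apply: ne; rewrite E1 E2.
  by apply: nf; rewrite E1; exact: linked_refl.
have nb' : ~ far e a b b'.
  move=> f; apply: nf; apply: linked_trans f _; apply: linked_step.
  rewrite /cut /= es (proj1 ab') /= same_edge_sym; exact/negP.
apply: (linked_sub (@sub_cut _ a b)).
apply: (@cross_near e a b es ab _ _ v) => //; exact: sub_cut.
Qed.

(** Of two nested bridges the farther one has the larger level, by [lev_lt]. *)
Lemma lev_inj u v c d : Bd e u v c -> Bd e u v d ->
  lev e u c.1 = lev e u d.1 -> c = d.
Proof.
move=> cu du E; apply: contrapT => ne.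
case: (bridge_nested cu du ne).
  by case: c E {cu ne} => a b E /lev_lt; rewrite E ltnn.
by case: d E {du ne} => a b E /lev_lt; rewrite -E ltnn.
Qed.

End Bd.
End Linked.

(** * Removing several edges, and levels on one side of a removed bridge *)

Section Rems.
Variable V : choiceType.
Implicit Types (e : rel V) (x y z s t u v a b : V).

Definition cuts e (l : seq (V * V)) : rel V :=
  foldr (fun c f => cut f c.1 c.2) e l.

Lemma cutsE e l s t :
  cuts e l s t = e s t && all (fun c => ~~ same_edge c.1 c.2 s t) l.
Proof.
elim: l => [|c l IH]; first by rewrite andbT.
by rewrite /= -/(cuts e l) /cut /= IH -andbA (andbC (all _ _)).
Qed.

Lemma sub_cuts e l : subrel (cuts e l) e.
Proof. by move=> s t; rewrite cutsE => /andP[]. Qed.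

Lemma sym_cuts e l : symmetric e -> symmetric (cuts e l).
Proof. by move=> es; elim: l => //= c l; exact: sym_cut. Qed.

Lemma linked_cuts e l s t : symmetric e ->
  (forall c, c \in l -> bridge e c.1 c.2 /\
     ~ far e c.1 c.2 s /\ ~ far e c.1 c.2 t) ->
  linked e s t -> linked (cuts e l) s t.
Proof.
move=> es; elim: l => //= c l IH H st.
have [bc [ns nt]] := H c (mem_head _ _).
apply: (cross_stay es bc) => //; first exact: sub_cuts.
by apply: IH => // d dl; apply: H; rewrite inE dl orbT.
Qed.

Lemma cut_ins e a b : symmetric e -> ~~ e a b -> cut (ins e a b) a b = e.
Proof.
move=> es nab; apply/funext => s; apply/funext => t; rewrite /cut /ins /=.
have [/orP[/andP[/eqP -> /eqP ->]|/andP[/eqP -> /eqP ->]]|_] :=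
  boolP (same_edge a b s t); rewrite ?andbF ?andbT ?orbF //.
  by rewrite (negbTE nab).
by rewrite es (negbTE nab).
Qed.

Lemma sym_ins e a b : symmetric e -> symmetric (ins e a b).
Proof. by move=> es s t; rewrite /ins /= es same_edge_sym. Qed.

(** Both [x] and [u] lie on the near side of [x y], so paths between them can avoid this bridge, and
    every bridge separating them has both ends on that side. It allows the level to be read before
    or after [x y] is opened. *)
Lemma Bd_cut e x y u : symmetric e -> bridge e x y -> far e y x u ->
  Bd (cut e x y) x u = Bd e x u.
Proof.
move=> es xy fu; set f := cut e x y.
have fs : symmetric f by exact: sym_cut.
have xside a : linked f x a -> ~ far e x y a.
  by move=> xa fa; apply: (far_nfar es xy fa); rewrite /far cutC.
have xside' a : linked e x a -> ~ far e x y a -> linked f x a.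
  by move=> xa na; apply: (cross_stay es xy) => //; exact: (proj2 xy).
apply/seteqP; split=> -[a b] [/= ab fx fu'].
  have fb : linked f x a by apply: linked_sym => //; exact: far_linked fx.
  have fbb : linked f x b.
    by apply: (linked_trans fb); apply: linked_step; case: ab.
  split=> /=.
  - split; first by case: ab => /andP[].
    move=> fa; apply: (proj2 ab).
    rewrite /far /f cut_cut.
    by apply: (cross_stay es xy _ _ _ fa); [exact: sub_cut|exact: xside|exact: xside].
  - by apply: linked_sub fx; apply: sub_cut2; exact: sub_cut.
  - by apply: linked_sub fu'; apply: sub_cut2; exact: sub_cut.
have nfu : ~ far e x y u by move=> f1; exact: (far_nfar es xy f1).
have nse : ~~ same_edge x y a b.
  apply/negP => /orP[/andP[/eqP E1 /eqP E2]|/andP[/eqP E1 /eqP E2]].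
    by apply: nfu; move: fu'; rewrite E1 E2.
  by apply: (proj2 xy); move: fx; rewrite E1 E2.
(* If [a] were beyond [x y], so would be [b]. A path from [b] to [u] would then return through [x],
   and [a b] would not separate [x] from [u]. *)
have na : ~ far e x y a.
  move=> fa.
  have fb : far e x y b.
    by apply: (linked_trans fa); apply: linked_step; rewrite /cut /= (proj1 ab).
  have l1 : linked (cut e a b) u x.
    apply: (linked_sub (@sub_cut _ _ x y)).
    apply: (@cross_near _ e x y es xy _ u b) => //; first exact: sub_cut.
    by apply: linked_sym => //; exact: sym_cut.
  apply: (proj2 ab); apply: (linked_trans fu'); apply: (linked_trans l1).
  by apply: linked_sym; [exact: sym_cut|rewrite cutC].
have nb : ~ far e x y b.
  move=> fb; apply: na; apply: (linked_trans fb); apply: linked_step.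
  by rewrite /cut /= es (proj1 ab) /= same_edge_sym.
split=> /=.
- split; first by rewrite /f /cut /= (proj1 ab).
  by move=> fa; apply: (proj2 ab); apply: linked_sub fa; apply: sub_cut2; exact: sub_cut.
- rewrite /far /f cut_cut; apply: (cross_stay es xy _ na _ fx); first exact: sub_cut.
  exact: (proj2 xy).
- rewrite /far /f cut_cut; apply: (cross_stay es xy _ nb nfu fu'); exact: sub_cut.
Qed.

Lemma lev_cut e x y u : symmetric e -> bridge e x y -> far e y x u ->
  lev (cut e x y) x u = lev e x u.
Proof. by move=> es xy fu; rewrite /lev Bd_cut. Qed.

End Rems.

(** * Clusters that touch infinitely often: marks, stars and trivertices *)

Section Touch.
Variables (V : choiceType) (G : graph V).
Implicit Types (e : rel V) (x y z s t u v a b : V).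

(** Edges are counted rather than touching vertices, which makes the relation symmetric in the two
    clusters. *)
Definition touch_inf e x y := infinite_set
  [set c : V * V | [/\ G c.1 c.2, linked e x c.1 & linked e y c.2]].

Lemma touch_inf_sub e e' x y x' y' :
  (forall s, linked e x s -> linked e' x' s) ->
  (forall s, linked e y s -> linked e' y' s) -> touch_inf e x y -> touch_inf e' x' y'.
Proof.
by move=> H1 H2; apply: sub_infinite_set => c [Gc /H1 ? /H2 ?].
Qed.

Lemma touch_inf_C e x y : touch_inf e x y -> touch_inf e y x.
Proof.
apply: contra_not => f; apply: (sub_finite_set _ (finite_image
  (fun c : V * V => (c.2, c.1)) f)) => -[a b] [/= ab xa yb].
by exists (b, a) => //; split=> //=; rewrite adj_sym.
Qed.

Definition mark e x y := [/\ G x y, ~ linked e x y & touch_inf e x y].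

Definition out e x y a b :=
  [/\ bridge e a b, far e b a x & touch_inf (cut e a b) b y].

Definition touch e x y := exists s t, [/\ linked e x s, linked e y t & G s t].

(* A configuration that finitely many changes turn into a trivertex: open paths
   through the cluster of d join the three clusters of the v i at a vertex. *)
Definition star e := exists d u (v : 'I_3 -> V),
  [/\ ~ linked e d u,
      forall i, [/\ ~ linked e d (v i), ~ linked e u (v i), touch e d (v i)
                  & touch_inf e (v i) u] &
      forall i j, i != j -> ~ linked e (v i) (v j)].

Definition trivertex e y u := ~ linked e y u /\ exists h : 'I_3 -> V,
  (forall i, linked e y (h i) /\ touch_inf (delv e y) (h i) u) /\
  (forall i j, i != j -> ~ linked (delv e y) (h i) (h j)).

Definition adm e := symmetric e /\ subrel e G.

Definition fmod e f := adm f /\ finite_set [set c : V * V | e c.1 c.2 <> f c.1 c.2].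

Lemma adm_cuts e l : adm e -> adm (cuts e l).
Proof.
case=> es eG; split; first exact: sym_cuts.
by move=> s t /sub_cuts /eG.
Qed.

Lemma fmod_cuts e l : adm e -> fmod e (cuts e l).
Proof.
move=> ea; split; first exact: adm_cuts.
have : finite_set ([set` l] `|` [set` [seq (c.2, c.1) | c <- l]]).
  by rewrite finite_setU; split; exact: finite_seq.
apply: sub_finite_set => -[s t] /= ne.
have : ~~ all (fun c : V * V => ~~ same_edge c.1 c.2 s t) l.
  by apply/negP => H; apply: ne; rewrite cutsE H andbT.
case/allPn => -[a b] abl; rewrite negbK => /orP[/andP[/= /eqP -> /eqP ->]|].
  by left.
by move=> /andP[/= /eqP -> /eqP ->]; right; apply/mapP; exists (a, b).
Qed.

Lemma fmod_trans e f g : fmod e f -> fmod f g -> fmod e g.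
Proof.
move=> [_ f1] [ag f2]; split=> //.
have : finite_set ([set c : V * V | e c.1 c.2 <> f c.1 c.2] `|`
                   [set c : V * V | f c.1 c.2 <> g c.1 c.2]).
  by rewrite finite_setU.
apply: sub_finite_set => c /= ne.
have [E|] := pselect (e c.1 c.2 = f c.1 c.2); last by left.
by right => /=; rewrite -E.
Qed.

(** Closing [a b] splits the cluster in two. The side of [a] still touches each [y i] through the
    edge from [x i] and is the hub [d] of the star; the side of [b] touches each of them infinitely
    often and is its [u]. *)
Lemma out_star e a b (x y : 'I_3 -> V) : symmetric e ->
  (forall i, mark e (x i) (y i) /\ out e (x i) (y i) a b) ->
  (forall i j, i != j -> ~ linked e (y i) (y j)) -> star (cut e a b).
Proof.
move=> es H ne; exists a, b, y.
have ab : bridge e a b by have [_ []] := H ord0.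
have rs : symmetric (cut e a b) by exact: sym_cut.
have sub := linked_sub (@sub_cut _ e a b).
split.
- by move=> l; apply: (proj2 ab); apply: linked_sym.
- move=> i; have [[Gi nl _] [_ f t]] := H i.
  have xa : linked e (x i) a by apply: linked_sym => //; exact: far_linked f.
  split.
  + by move=> /sub l; apply: nl; exact: linked_trans l.
  + move=> /sub l; apply: nl; apply: (linked_trans xa); apply: linked_trans l.
    by apply: linked_step; case: ab.
  + by exists (x i), (y i); split=> //; [rewrite cutC|exact: linked_refl].
  + exact: touch_inf_C.
- by move=> i j ij /sub; exact: ne.
Qed.

(** Since the levels are equal, none of the three bridges lies beyond another. Cutting all of them
    thus leaves the near ends with the hub [x] and each far side whole; the far sides are the [v i]
    of the star, and [y] is its [u]. *)
Lemma outs_star e x y (c : 'I_3 -> V * V) : adm e ->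
  mark e x y -> (forall i, out e x y (c i).1 (c i).2) -> injective c ->
  (forall i j, lev e x (c i).1 = lev e x (c j).1) ->
  star (cuts e (codom c)).
Proof.
move=> [es eG] [Gxy nxy txy] oc ci levc; set f := cuts e _.
have sub := linked_sub (@sub_cuts _ e (codom c)).
have bc i : bridge e (c i).1 (c i).2 by case: (oc i).
have fx i : far e (c i).2 (c i).1 x by case: (oc i).
have xa i : linked e x (c i).1.
  by apply: linked_sym => //; exact: far_linked (fx i).
have ab i : linked e (c i).1 (c i).2 by apply: linked_step; case: (bc i).
have nfa i j : ~ far e (c i).1 (c i).2 (c j).1.
  have [->|ij] := eqVneq i j; first by case: (bc j).
  move=> fij; have : Bd e x (c j).1 ((c i).1, (c i).2).
    by split; [exact: bc|exact: fx|exact: fij].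
  by move/(lev_lt es); rewrite (levc i j) ltnn.
have nfx i : ~ far e (c i).1 (c i).2 x.
  by move=> g; exact: (far_nfar es (bc i) g).
(* The near ends of all three bridges are outside the far side of each, so cutting the bridges
   removes no edge inside a far side. *)
have lfar i s : far e (c i).1 (c i).2 s -> linked f (c i).2 s.
  move=> ls; suff : far e (c i).1 (c i).2 s /\ linked f (c i).2 s by case.
  apply: (linked_ind (P := fun s => far e (c i).1 (c i).2 s /\
    linked f (c i).2 s) _ _ ls) => [|s' t [fsi lf] st].
    by split; exact: linked_refl.
  have ft : far e (c i).1 (c i).2 t.
    by apply: (linked_trans fsi); exact: linked_step.
  split=> //; apply: (linked_trans lf); apply: linked_step.
  rewrite /f cutsE (sub_cut st); apply/allP => _ /codomP[j ->].
  apply/negP => /orP[/andP[/eqP E _]|/andP[_ /eqP E]].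
    by apply: (nfa i j); rewrite -E.
  by apply: (nfa i j); rewrite -E.
exists x, y, (fun i => (c i).2); split.
- by move/sub.
- move=> i; split.
  + move=> l; suff : linked (cut e (c i).1 (c i).2) x (c i).2.
      move=> l'; apply: (nfx i); apply: linked_sym => //; exact: sym_cut.
    apply: linked_sub l => s t; rewrite /f cutsE => /andP[st /allP H].
    by rewrite /cut /= st /=; apply: H; exact: codom_f.
  + move=> /sub l; apply: nxy; apply: (linked_trans (xa i)).
    by apply: (linked_trans (ab i)); apply: linked_sym.
  + exists (c i).1, (c i).2; split; [|exact: linked_refl|].
      apply: linked_cuts => // _ /codomP[j ->]; split=> //; split=> //.
    by apply: eG; case: (bc i).
  + have [_ _] := oc i; apply: touch_inf_sub; first exact: lfar.
    move=> s /(linked_sub (@sub_cut _ _ _ _)) ls.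
    suff : linked e y s /\ linked f y s by case.
    apply: (linked_ind (P := fun s => linked e y s /\ linked f y s) _ _ ls).
      by split; exact: linked_refl.
    move=> s' t [ys yfs] st.
    have yt : linked e y t by apply: (linked_trans ys); exact: linked_step.
    split=> //; apply: (linked_trans yfs); apply: linked_step.
    rewrite /f cutsE st; apply/allP => _ /codomP[j ->].
    have nya : ~ linked e y (c j).1.
      by move=> l; apply: nxy; apply: (linked_trans (xa j)); apply: linked_sym.
    apply/negP => /orP[/andP[/eqP E _]|/andP[_ /eqP E]]; apply: nya.
      by rewrite -E.
    by rewrite -E.
- move=> i j ij l.
  have fij : far e (c i).1 (c i).2 (c j).2.
    apply: linked_sub l => s t; rewrite /f cutsE => /andP[st /allP H].
    by rewrite /cut /= st /=; apply: H; exact: codom_f.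
  have E : c i = c j.
    apply: (@lev_inj _ e es x (c j).2) => //; split; try exact: bc; try exact: fx.
    exact: linked_refl.
  by move/ci: E ij => ->; rewrite eqxx.
Qed.

End Touch.

(** * Branching vertices *)

(* Here q y a b stands for: a and b are connected off y. *)
Section BurtonKeane.
Variables (V : eqType) (q : V -> rel V).
Hypothesis qrefl : forall y, reflexive (q y).
Hypothesis qsym : forall y, symmetric (q y).
Hypothesis qtrans : forall y, transitive (q y).
Implicit Types (S : seq V) (x y z : V).

Let two S y := has (fun a => has (fun b =>
  [&& a != y, b != y & ~~ q y a b]) S) S.

Definition branching S y := has (fun a => has (fun b => has (fun c =>
  [&& a != y, b != y, c != y, ~~ q y a b, ~~ q y a c & ~~ q y b c]) S) S) S.

Let one S y := has (fun a => a != y) S.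

(** The number of classes of [q y] among the points of [S] other than [y], truncated at 3. *)
Let deg S y := (one S y + two S y + branching S y)%N.

Let twoP S y : reflect (exists a b, [/\ a \in S, b \in S, a != y, b != y & ~~ q y a b])
  (two S y).
Proof.
apply: (iffP hasP) => [[a aS /hasP[b bS /and3P[? ? ?]]]|[a [b [aS bS ? ? ?]]]].
  by exists a, b.
by exists a => //; apply/hasP; exists b => //; apply/and3P.
Qed.

Let brP S y : reflect (exists a b c, [/\ a \in S, b \in S & c \in S] /\
  [/\ a != y, b != y, c != y & [/\ ~~ q y a b, ~~ q y a c & ~~ q y b c]])
  (branching S y).
Proof.
apply: (iffP hasP) => [[a aS /hasP[b bS /hasP[c cS /and5P[? ? ? ? /andP[? ?]]]]]|].
  by exists a, b, c.
move=> [a [b [c [[aS bS cS] [? ? ? [? ? ?]]]]]].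
exists a => //; apply/hasP; exists b => //; apply/hasP; exists c => //.
by apply/and5P; split=> //; apply/andP.
Qed.

(** Fix a root [r] and choose [x], other than [r], whose removal leaves as many points as possible
    with the root. If [x] were not a leaf, some [z] would be cut off from [r] at [x], and removing
    [z] would leave even more: all that [x] leaves, and [x] itself. *)
Let leaf_exists S : S != [::] ->
  {in S & &, forall x y z, x != y -> ~~ q y z x -> q x z y} ->
  exists2 x, x \in S & ~~ two S x.
Proof.
case: S => // r S0 _; set S := r :: S0 => compat.
have rS : r \in S by rewrite mem_head.
pose f x := count (fun u => (u != x) && q x r u) S.
have [/hasP[x0 x0S x0r]|nh] := boolP (has (fun x => x != r) S); last first.
  exists r => //; apply/twoP => -[a [b [aS _ ar _ _]]].
  by case/negP: nh; apply/hasP; exists a.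
have [x [xS xr max]] : exists x, [/\ x \in S, x != r &
    forall z, z \in S -> z != r -> (f z <= f x)%N].
  have ex : exists n, has (fun x => (x != r) && (f x == n)) S.
    by exists (f x0); apply/hasP; exists x0; rewrite // x0r eqxx.
  have ub n : has (fun x => (x != r) && (f x == n)) S -> (n <= size S)%N.
    by case/hasP => x _ /andP[_ /eqP <-]; exact: count_size.
  case: (ex_maxnP ex ub) => n /hasP[x xS /andP[xr /eqP fx]] maxn.
  exists x; split=> // z zS zr; rewrite fx; apply: maxn.
  by apply/hasP; exists z; rewrite // zr eqxx.
exists x => //; apply/twoP => -[a [b [aS bS ax bx ab]]].
have [z [zS zx nz]] : exists z, [/\ z \in S, z != x & ~~ q x r z].
  have [ra|ra] := boolP (q x r a); last by exists a.
  exists b; split=> //; apply: contra ab => rb.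
  by apply: (qtrans _ rb); rewrite qsym.
have zr : z != r by apply: contraNneq nz => ->; rewrite qrefl.
have key u : u \in S -> q x r u -> q z u x.
  move=> uS ru; apply: compat => //.
  by apply: contra nz => uz; exact: (qtrans ru uz).
have qzrx : q z r x by apply: key => //; exact: qrefl.
suff : (f x < f z)%N by rewrite ltnNge max.
have xSz : x \in [seq u <- S | (u != z) && q z r u].
  by rewrite mem_filter xS eq_sym zx qzrx.
rewrite /f -!size_filter.
have sub : {subset [seq u <- S | (u != x) && q x r u] <=
   [seq u <- S | [&& u != z, q z r u & u != x]]}.
  move=> u; rewrite !mem_filter => /andP[/andP[ux ru] uS].
  rewrite uS ux !andbT; apply/andP; split.
    by apply: contraNneq nz => <-.
  by apply: (qtrans qzrx); rewrite qsym; exact: key.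
rewrite !size_filter.
have -> : count (fun u => (u != z) && q z r u) S =
   (count (fun u => [&& u != z, q z r u & u != x]) S + count_mem x S)%N.
  rewrite -count_predUI [X in (_ + X)%N](_ : _ = 0%N) ?addn0; last first.
    apply/eqP; rewrite -leqn0 leqNgt -has_count; apply/hasPn => u uS /=.
    by apply/negP => /andP[/and3P[_ _ /negbTE ->]].
  apply: eq_in_count => u uS /=; have [->|ux] := eqVneq u x.
    by rewrite orbT eq_sym zx qzrx.
  by rewrite andbT orbF.
apply: (@leq_ltn_trans (count (fun u => [&& u != z, q z r u & u != x]) S)).
  rewrite (eq_in_count (a2 := fun u => (u \in S) && ((u != x) && q x r u))).
    apply: sub_count => u /= /andP[uS uP].
    by have := sub u; rewrite !mem_filter uP uS => /(_ isT); rewrite andbT.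
  by move=> u ->.
by rewrite -[X in (X < _)%N]addn0 ltn_add2l -has_count has_pred1.
Qed.

(** In a tree this is the bound on the total degree; here the tree is implicit and is taken apart
    leaf by leaf. A leaf has degree at most 1, and removing it lowers by at most 1 the degree of at
    most one other point, one at which the leaf forms a class of its own. *)
Lemma sum_deg n S : size S = n -> uniq S ->
  {in S & &, forall x y z, x != y -> ~~ q y z x -> q x z y} ->
  (\sum_(y <- S) deg S y <= 2 * size S)%N.
Proof.
elim: n S => [|n IH] S sS uS compat.
  by move/size0nil: sS => ->; rewrite big_nil.
have [x xS lx] : exists2 x, x \in S & ~~ two S x.
  by apply: leaf_exists => //; rewrite -size_eq0 sS.
have brx : ~~ branching S x.
  apply: contra lx => /brP[a [b [c [[aS bS _] [? ? _ [? _ _]]]]]].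
  by apply/twoP; exists a, b.
pose S' := seq.rem x S.
have memS' u : (u \in S') = (u != x) && (u \in S) by rewrite mem_rem_uniq // inE.
have sS' : size S' = n by rewrite size_rem // sS.
have IH' : (\sum_(y <- S') deg S' y <= 2 * n)%N.
  rewrite -sS'; apply: IH => //; first exact: rem_uniq.
  by move=> u v w; rewrite !memS' => /andP[_ ?] /andP[_ ?] /andP[_ ?]; exact: compat.
pose lost y := all (fun u => (u != y) ==> ~~ q y u x) S'.
have degS y : y \in S' -> (deg S y <= deg S' y + lost y)%N.
  move=> yS'; have /andP[yx yS] : (y != x) && (y \in S) by rewrite -memS'.
  have [ly|nly] := boolP (lost y); last first.
    have [x' /andP[x'S' x'y] x'q] : exists2 x', (x' \in S') && (x' != y) & q y x' x.
      move: nly; rewrite -has_predC => /hasP[x' x'S' /=].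
      by rewrite negb_imply negbK => /andP[? ?]; exists x'; rewrite ?x'S'.
    (* The removed leaf is replaced by a companion [x'] of the same class, so no class disappears at
       [y]. *)
    pose g u := if u == x then x' else u.
    have gS u : u \in S -> g u \in S'.
      by rewrite /g => uS1; case: (eqVneq u x) => // ux; rewrite memS' ux.
    have gy u : u != y -> g u != y by rewrite /g; case: (eqVneq u x).
    have gq u : q y u (g u) by rewrite /g; case: (eqVneq u x) => [->|_]; [rewrite qsym|exact: qrefl].
    have gqq u v : ~~ q y u v -> ~~ q y (g u) (g v).
      apply: contra => h; apply: (qtrans (gq u)); apply: (qtrans h).
      by rewrite qsym.
    rewrite addn0 /deg; apply: leq_add; first apply: leq_add.
    - case h: (one S y) => //; move/hasP: h => [u uS1 uy].
      by rewrite lt0b; apply/hasP; exists (g u); [exact: gS|exact: gy].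
    - case h: (two S y) => //; move/twoP: h => [u [v [? ? ? ? ?]]].
      rewrite lt0b; apply/twoP; exists (g u), (g v).
      by split; try exact: gS; try exact: gy; exact: gqq.
    - case h: (branching S y) => //.
      move/brP: h => [u [v [w [[? ? ?] [? ? ? [? ? ?]]]]]].
      rewrite lt0b; apply/brP; exists (g u), (g v), (g w).
      by split; split; try exact: gS; try exact: gy; split; exact: gqq.
  have l1 : (two S y -> one S' y)%B.
    move/twoP => [a [b [aS bS ay byy ab]]]; apply/hasP.
    have [ax|ax] := eqVneq a x; last by exists a; rewrite ?memS' ?ax.
    by exists b; rewrite ?memS' ?bS ?andbT //; apply: contraNneq ab => ->; rewrite ax qrefl.
  have l2 : (branching S y -> two S' y)%B.
    move/brP => [a [b [c [[aS bS cS] [ay byy cy [ab ac bc]]]]]]; apply/twoP.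
    have [ax|ax] := eqVneq a x.
      exists b, c; rewrite !memS' bS cS !andbT.
      split=> //; first by apply: contraNneq ab => ->; rewrite ax qrefl.
      by apply: contraNneq ac => ->; rewrite ax qrefl.
    have [bx|bx] := eqVneq b x; last by exists a, b; rewrite !memS' aS bS ax bx.
    exists a, c; rewrite !memS' aS cS ax; split=> //.
    by rewrite andbT; apply: contraNneq bc => ->; rewrite bx qrefl.
  rewrite addn1 /deg; apply: (@leq_trans (1 + two S y + branching S y)%N).
    by rewrite !leq_add2r leq_b1.
  rewrite -addnA add1n ltnS -[X in (_ <= X)%N]addn0.
  apply: (@leq_trans (one S' y + two S' y)%N); last by rewrite addn0 leq_addr.
  apply: leq_add.
    by case h: (two S y) => //; rewrite lt0b l1.
  by case h: (branching S y) => //; rewrite lt0b l2.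
(* Two such points would each separate [x] from the other, against the hypothesis on [q]. *)
have lost1 : (\sum_(y <- S') lost y <= 1)%N.
  rewrite (eq_bigr (fun y => if lost y then 1 else 0)%N); last by move=> y _; case: (lost y).
  rewrite -big_mkcond sum1_count -size_filter.
  case E: ([seq y <- S' | lost y]) => [|y0 [|y1 l]] //=.
  have : uniq ([seq y <- S' | lost y]) by rewrite filter_uniq ?rem_uniq.
  rewrite E /= inE negb_or => /andP[/andP[y01 _] _].
  have : y0 \in [seq y <- S' | lost y] by rewrite E mem_head.
  rewrite mem_filter => /andP[/allP l0 y0S].
  have : y1 \in [seq y <- S' | lost y] by rewrite E !inE eqxx orbT.
  rewrite mem_filter => /andP[/allP l1 y1S].
  have := l1 _ y0S; rewrite y01 /= => nq.
  have := l0 _ y1S; rewrite eq_sym y01 /= => nq'.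
  case/negP: nq; rewrite qsym.
  have inS u : u \in S' -> u \in S by rewrite memS' => /andP[].
  by apply: compat => //; [exact: inS|exact: inS|rewrite eq_sym|rewrite qsym].
rewrite (perm_big _ (perm_to_rem xS)) /= big_cons sS.
have dx : (deg S x <= 1)%N.
  by rewrite /deg (negbTE lx) (negbTE brx) !addn0 leq_b1.
have h : (\sum_(y <- S') deg S y <= \sum_(y <- S') deg S' y + \sum_(y <- S') lost y)%N.
  rewrite -big_split /= big_seq [X in (_ <= X)%N]big_seq.
  by apply: leq_sum => y; exact: degS.
rewrite mulnS; apply: (leq_trans (leq_add dx h)).
rewrite -[2%N]/(1 + 1)%N -addnA leq_add2l addnC; exact: leq_add.
Qed.

(** As soon as there are two points, every degree is at least 1, and it is 3 at a branching point;
    this is compared with the total degree. *)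
Lemma branching_half S : uniq S ->
  {in S & &, forall x y z, x != y -> ~~ q y z x -> q x z y} ->
  (2 * count (branching S) S <= size S)%N.
Proof.
move=> uS compat.
have brtwo y : (branching S y -> two S y)%B.
  by move/brP => [a [b [c [[? ? _] [? ? _ [? _ _]]]]]]; apply/twoP; exists a, b.
have [lt2|ge2] := ltnP (size S) 2.
  suff /eqP -> : count (branching S) S == 0%N by [].
  rewrite -leqn0 leqNgt -has_count; apply/hasPn => y _; apply/negP => /brtwo.
  case/twoP => a [b [aS bS _ _ ab]].
  case: S {brtwo compat uS} lt2 aS bS => // r [] // _.
  by rewrite !inE => /eqP E1 /eqP E2; rewrite E1 E2 qrefl in ab.
have onel y : y \in S -> one S y.
  move=> yS; apply/hasP; apply: contrapT => H.
  have : all (pred1 y) S.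
    by apply/allP => z zS /=; apply/negP => /negP zy; apply: H; exists z.
  case: S ge2 uS {compat yS H brtwo} => // a [|b S] //= _.
  by rewrite inE negb_or => /andP[/andP[ab _] _] /and3P[/eqP E1 /eqP E2 _]; rewrite E1 E2 eqxx in ab.
have : (size S + 2 * count (branching S) S <= 2 * size S)%N.
  apply: (leq_trans _ (sum_deg erefl uS compat)).
  have -> : (size S + 2 * count (branching S) S =
             \sum_(y <- S) (1 + 2 * branching S y))%N.
    rewrite big_split /= sum1_size -big_distrr /= -sum1_count [in LHS]big_mkcond /=.
    by congr (_ + 2 * _)%N; apply: eq_bigr => y _; case: (branching S y).
  rewrite big_seq [X in (_ <= X)%N]big_seq; apply: leq_sum => y yS.
  rewrite /deg (onel _ yS) -addnA leq_add2l.
  by case h: (branching S y) => //; rewrite (brtwo _ h).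
by rewrite mul2n -addnn mulSn mul1n leq_add2l.
Qed.

End BurtonKeane.

(** * Paths that meet in a single vertex *)

Section Arms.
Variable V : choiceType.
Implicit Types (e : rel V) (x y z t u v a b : V) (s : seq V).

(** Follow a path from [z] to [x] until it first meets [x] or [y]. This is the hypothesis on [q] in
    the Burton-Keane count, and also the reason why two lonely vertices cannot claim the same
    vertex. *)
Lemma linked_delv e x y z : linked e z x -> x != y ->
  linked (delv e y) z x \/ linked (delv e x) z y.
Proof.
move=> [n w] xy; elim: n z w => [|n IH] z.
  by move/walk0 ->; left; exact: linked_refl.
move/walkS=> [t zt /IH {}IH].
have [->|zx] := eqVneq z x; first by left; exact: linked_refl.
have [->|zy] := eqVneq z y; first by right; exact: linked_refl.
have [ty|ty] := eqVneq t y.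
  by right; apply: linked_step; rewrite /delv /= -ty zt zx ty eq_sym.
have [tx|tx] := eqVneq t x.
  by left; apply: linked_step; rewrite /delv /= -tx zt zy tx.
case: IH => l; [left|right]; apply: linked_trans l; apply: linked_step.
  by rewrite /delv /= zt zy.
by rewrite /delv /= zt zx.
Qed.

Lemma linked_path e x y : linked e x y -> exists2 s, path e x s & last x s = y.
Proof. by move=> [n [s [_ ? ?]]]; exists s. Qed.

Lemma path_linked e x s : path e x s -> linked e x (last x s).
Proof. by move=> p; exists (size s), s. Qed.

Lemma rev_arm e x s : symmetric e -> path e x s ->
  path e (last x s) (rev (belast x s)) /\ last (last x s) (rev (belast x s)) = x.
Proof.
move=> es p; split.
  by rewrite rev_path (eq_path (e' := e)) // => u v; rewrite es.
by case: s {p} => //= a s; rewrite rev_cons last_rcons.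
Qed.

(** Join two of the points by a simple path and walk from the third until this path is first hit;
    the hitting point is [y]. An arm is empty when its end is [y] itself. *)
Lemma arms e (x : 'I_3 -> V) : symmetric e -> (forall i j, linked e (x i) (x j)) ->
  exists y (p : 'I_3 -> seq V),
    (forall i, [/\ path e y (p i), last y (p i) = x i & y \notin p i]) /\
    (forall i j, i != j -> forall z, z \in p i -> z \notin p j).
Proof.
move=> es lx.
pose i1 := inord 1 : 'I_3; pose i2 := inord 2 : 'I_3.
have [s0 ps0] := linked_path (lx ord0 i1).
case: (shortenP ps0) => s ps us _ ls {s0 ps0}.
have [s' ps' ls'] := linked_path (lx i2 ord0).
set pi := x ord0 :: s.
have hasy : has (mem pi) (x i2 :: s').
  apply/hasP; exists (x ord0); last exact: mem_head.
  by rewrite -{1}ls' mem_last.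
set k := find (mem pi) (x i2 :: s').
have ks : k < (size s').+1 by move: hasy; rewrite has_find.
have kle : k <= size s' by [].
set r := take k s'.
have pr : path e (x i2) r by move: ps'; rewrite -{1}(cat_take_drop k s') cat_path => /andP[].
have ypi : nth (x i2) (x i2 :: s') k \in pi by exact: (nth_find _ hasy).
have lr : last (x i2) r = nth (x i2) (x i2 :: s') k.
  rewrite (last_nth (x i2)) size_take_min (minn_idPl kle) /r.
  by case: (k) kle => //= m mle; rewrite nth_take.
set y := last (x i2) r.
have br : belast (x i2) r = take k (x i2 :: s').
  have : size r = k by rewrite size_take_min (minn_idPl kle).
  move=> sr; rewrite -[in RHS](cat_take_drop k s') -cat_cons -/r lastI cat_rcons.
  by rewrite take_size_cat // size_belast.
have nr z : z \in belast (x i2) r -> z \notin pi.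
  rewrite br => zk.
  have zi : index z (take k (x i2 :: s')) < k.
    move: zk; rewrite -index_mem => h; apply: (leq_trans h).
    by rewrite size_take_min geq_minl.
  have := before_find (x i2) zi; rewrite -(nth_take _ zi) nth_index //= => h.
  exact/negbT.
rewrite -lr -/y in ypi.
have {}nr z : z \in belast (x i2) r -> z \notin x ord0 :: s by exact: nr.
have {}ypi : y \in x ord0 :: s by [].
move: ls us ps nr; case/splitPl: ypi => s1 s2 ly ls us ps nr.
move: ps; rewrite cat_path => /andP[ps1 ps2].
have [pr1 lr1] := rev_arm es ps1; have [pr2 lr2] := rev_arm es pr.
have us' : uniq (rcons (belast (x ord0) s1) y ++ s2).
  by rewrite -ly -lastI.
have ny2 : y \notin s2.
  move: us'; rewrite cat_uniq => /and3P[_ /hasPn h _]; apply/negP => /h.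
  by rewrite mem_rcons mem_head.
have ny1 : y \notin belast (x ord0) s1.
  by move: us'; rewrite cat_uniq rcons_uniq => /andP[/andP[]].
have d12 z : z \in belast (x ord0) s1 -> z \notin s2.
  move: us'; rewrite cat_uniq => /and3P[_ /hasPn h _] z1; apply/negP => /h.
  by rewrite mem_rcons inE z1 orbT.
have d1r z : z \in belast (x ord0) s1 -> z \notin belast (x i2) r.
  move=> z1; apply/negP => /nr; rewrite -cat_cons mem_cat.
  by rewrite (mem_belast z1).
have d2r z : z \in s2 -> z \notin belast (x i2) r.
  by move=> z1; apply/negP => /nr; rewrite -cat_cons mem_cat z1 orbT.
have nyr : y \notin belast (x i2) r.
  by apply/negP => /nr; rewrite -cat_cons mem_cat -ly mem_last.
pose p (i : 'I_3) := if i == ord0 then rev (belast (x ord0) s1) else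
  if i == i1 then s2 else rev (belast (x i2) r).
have case3 (i : 'I_3) : [\/ i = ord0, i = i1 | i = i2].
  case: i => -[|[|[|//]]] Hi; [apply: Or31|apply: Or32|apply: Or33]; apply: val_inj;
  by rewrite /= ?inordK.
have p0 : p ord0 = rev (belast (x ord0) s1) by [].
have p1 : p i1 = s2 by rewrite /p eqxx; case: eqP => // /(congr1 val); rewrite /= inordK.
have p2 : p i2 = rev (belast (x i2) r).
  by rewrite /p; do 2 (case: eqP => [/(congr1 val)|_]; rewrite /= ?inordK //).
exists y, p; split.
  move=> i; case: (case3 i) => ->; rewrite ?p0 ?p1 ?p2.
  - by rewrite -{1 2}ly pr1 lr1 mem_rev.
  - by rewrite -ly ps2 ly; split=> //; rewrite -ls /= last_cat ly.
  - by rewrite pr2 lr2 mem_rev.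
move=> i j ij z; case: (case3 i) (case3 j) ij => -> [] ->; rewrite ?eqxx // => _;
  rewrite ?p0 ?p1 ?p2 ?mem_rev //.
- exact: d12.
- exact: d1r.
- by move=> z2; apply/negP => /d12; rewrite z2.
- exact: d2r.
- by move=> z2; apply/negP => /d1r; rewrite z2.
- by move=> z2; apply/negP => /d2r; rewrite z2.
Qed.

End Arms.

Section Arc.
Variable V : choiceType.
Implicit Types (e : rel V) (x y z t u v a b : V) (s : seq V).

Definition arc y s : rel V :=
  [rel a b | ((a, b) \in zip (y :: s) s) || ((b, a) \in zip (y :: s) s)].

Lemma sym_arc y s : symmetric (arc y s).
Proof. by move=> a b; rewrite /arc /= orbC. Qed.

Lemma zip_path e y s a b : path e y s -> (a, b) \in zip (y :: s) s ->
  [/\ e a b, a \in y :: s & b \in s].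
Proof.
move=> /(pathP y) p /(nthP (y, y))[i].
rewrite size2_zip //= => lt; rewrite nth_zip_cond size2_zip //= lt => -[<- <-].
by split; [exact: p|rewrite mem_nth //= ltnW|rewrite mem_nth].
Qed.

Lemma arc_mem e y s a b : path e y s -> arc y s a b ->
  (e a b || e b a) /\ (a \in y :: s) /\ (b \in y :: s).
Proof.
move=> p /orP[] /(zip_path p) [-> ha hb]; rewrite ?orbT; split=> //.
  by split=> //; rewrite inE hb orbT.
by split=> //; rewrite inE hb orbT.
Qed.

Lemma arc_path y s : path (arc y s) y s.
Proof.
apply/(pathP y) => i lt; rewrite /arc /=; apply/orP; left.
apply/(nthP (y, y)); exists i; first by rewrite size2_zip.
by rewrite nth_zip_cond size2_zip //= lt.
Qed.

End Arc.

(** * Turning a star into a trivertex *)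

Section StarTv.
Variables (V : choiceType) (G : graph V).
Implicit Types (e : rel V) (x y z t u v a b : V) (s : seq V).

Hypothesis Glf : locally_finite G.

(** Inside the hub, choose disjoint arms from a vertex [y] to the edges that lead to the three
    clusters [v i]. Closing all edges at the arms and then opening the arms with these edges makes
    [y] a trivertex whose pieces contain the [v i]. By local finiteness only finitely many edges
    change. *)
Lemma star_trivertex e : adm G e -> star G e ->
  exists2 f, fmod G e f & exists y u, trivertex G f y u.
Proof.
move=> [es eG] [d [u [v [ndu Hv nv]]]].
have [st Hst] : exists st : 'I_3 -> V * V, forall i,
    [/\ linked e d (st i).1, linked e (v i) (st i).2 & G (st i).1 (st i).2].
  have [|st Hst] := @boolp.choice 'I_3 (V * V)%type (fun i c => [/\ linked e d c.1, linked e (v i) c.2 & G c.1 c.2]); last by exists st.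
  move=> i.
  by have [_ _ [s [t ?]] _] := Hv i; exists (s, t).
have [y [p [Hp dp]]] : exists y (p : 'I_3 -> seq V),
    (forall i, [/\ path e y (p i), last y (p i) = (st i).1 & y \notin p i]) /\
    (forall i j, i != j -> forall z, z \in p i -> z \notin p j).
  apply: arms => // i j; have [l1 _ _] := Hst i; have [l2 _ _] := Hst j.
  by apply: linked_trans l2; exact: linked_sym.
pose t i := (st i).2.
pose l i := rcons (p i) (t i).
have dy : linked e d y.
  have [l1 _ _] := Hst ord0; have [pp lp _] := Hp ord0.
  by apply: (linked_trans l1); apply: linked_sym => //; rewrite -lp; exact: path_linked.
have dmem i z : z \in y :: p i -> linked e d z.
  rewrite inE => /orP[/eqP -> //|zp]; apply: (linked_trans dy).
  have [pp _ _] := Hp i.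
  case/splitPr: zp pp => s1 s2; rewrite cat_path /= => /and3P[p1 l1 _].
  by apply: linked_trans (path_linked p1) _; exact: linked_step.
have pl i : path G y (l i).
  have [pp lp _] := Hp i; have [_ _ Gi] := Hst i.
  by rewrite /l rcons_path lp Gi andbT; exact: sub_path pp.
pose inF z := (z == y) || [exists i, z \in p i].
have inFd z : inF z -> linked e d z.
  case/orP => [/eqP ->//|/existsP[i zi]]; apply: (@dmem i).
  by rewrite inE zi orbT.
(* Away from the arms [inF] nothing changes; at the arms only the three paths [l i] are open. *)
pose f : rel V := [rel a b | [&& e a b, ~~ inF a & ~~ inF b] ||
  [exists i, arc y (l i) a b]].
have fs : symmetric f.
  move=> a b; rewrite /f /= es (andbC (~~ _)); congr orb.
  by apply: eq_existsb => i; rewrite sym_arc.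
have fG : subrel f G.
  move=> a b /orP[/and3P[/eG]//|/existsP[i /(arc_mem (pl i)) []]].
  by rewrite (adj_sym G b a) orbb.
have lmem i z : z \in y :: l i -> inF z \/ z = t i.
  rewrite inE mem_rcons inE => /or3P[/eqP ->|/eqP ->|zp].
  - by left; rewrite /inF eqxx.
  - by right.
  - by left; apply/orP; right; apply/existsP; exists i.
have lvt i : linked e (v i) (t i) by case: (Hst i).
have ndv i : ~ linked e d (v i) by case: (Hv i).
have nuv i : ~ linked e u (v i) by case: (Hv i).
have nFv i z : linked e (v i) z -> ~~ inF z.
  move=> vz; apply/negP => /inFd dz; apply: (ndv i); apply: (linked_trans dz).
  exact: linked_sym.
have nFu z : linked e u z -> ~~ inF z.
  move=> uz; apply/negP => /inFd dz; apply: ndu; apply: (linked_trans dz).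
  exact: linked_sym.
have Fy : inF y by rewrite /inF eqxx.
have keep a : (forall z, linked e a z -> ~~ inF z) ->
    forall z, linked e a z -> linked (delv f y) a z.
  move=> H z az; suff : linked e a z /\ linked (delv f y) a z by case.
  apply: (linked_ind (P := fun z => linked e a z /\ linked (delv f y) a z) _ _ az).
    by split; exact: linked_refl.
  move=> b c [ab fab] bc.
  have ac : linked e a c by apply: (linked_trans ab); exact: linked_step.
  split=> //; apply: (linked_trans fab); apply: linked_step.
  have nF z' : ~~ inF z' -> z' != y by apply: contraNneq => ->.
  by rewrite /delv /f /= bc !H //= !nF ?H.
have keepv i := keep (v i) (@nFv i).
have keepu := keep u nFu.
have sub a b : linked (delv f y) a b -> linked f a b by apply: linked_sub; exact: sub_delv.
have fin : finite_set [set c : V * V | e c.1 c.2 <> f c.1 c.2].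
  pose A := [set` y :: flatten [seq l i | i <- enum 'I_3]].
  have fA : finite_set A by exact: finite_seq.
  have lA i z : z \in y :: l i -> A z.
    rewrite inE /A /= => /orP[/eqP ->|zl]; first by rewrite mem_head.
    rewrite inE; apply/orP; right; apply/flattenP; exists (l i) => //.
    by apply: map_f; rewrite mem_enum.
  have FA z : inF z -> A z.
    case/orP => [/eqP ->|/existsP[i zi]]; first by rewrite /A /= mem_head.
    by apply: (lA i); rewrite inE mem_rcons inE zi !orbT.
  pose B := \bigcup_(a in A) [set b | G a b].
  have fB : finite_set B by apply: bigcup_finite.
  have fAB : finite_set ((A `*` B) `|` (B `*` A)).
    by rewrite finite_setU; split; exact: finite_setX.
  apply: (sub_finite_set _ fAB) => -[a b] /= ne.
  have Gab : G a b.
    have [eab|neab] := boolP (e a b); first exact: eG.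
    have [fab|nfab] := boolP (f a b); first exact: fG.
    by case: ne; rewrite (negbTE neab) (negbTE nfab).
  have [Fa|nFa] := boolP (inF a).
    by left; split=> /=; [exact: FA|exists a => //; exact: FA].
  have [Fb|nFb] := boolP (inF b).
    by right; split=> /=; [exists b => //; [exact: FA|rewrite /= adj_sym]|exact: FA].
  case: ne; rewrite /f /= nFa nFb !andbT.
  case eab : (e a b) => //=; symmetry; apply/negbTE/negP => /existsP[i].
  move=> /(arc_mem (pl i)) [_ [/lmem [Fa|ea] /lmem [Fb|eb]]].
  - by rewrite Fa in nFa.
  - by rewrite Fa in nFa.
  - by rewrite Fb in nFb.
  - by rewrite ea eb adj_irrefl in Gab.
exists f; first by split.
exists y, u; split.
  move=> yu; have uy : linked f u y by exact: linked_sym.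
  suff H z : linked f u z -> linked e u z.
    by have := nFu _ (H _ uy); rewrite Fy.
  apply: linked_ind; first exact: linked_refl.
  move=> a b ua /orP[/and3P[ab _ _]|/existsP[i]].
    by apply: (linked_trans ua); exact: linked_step.
  move=> /(arc_mem (pl i)) [_ [/lmem [Fa|ea] _]].
    by have := nFu _ ua; rewrite Fa.
  case: (nuv i); apply: (linked_trans ua); rewrite ea; exact: linked_sym.
exists v; split.
  move=> i; split.
    have yt : linked f y (t i).
      have : linked f y (last y (l i)).
        apply: path_linked; apply: sub_path (arc_path _ _) => a b ab.
        by rewrite /f /=; apply/orP; right; apply/existsP; exists i.
      by rewrite /l last_rcons.
    by apply: (linked_trans yt); apply: linked_sym => //; apply: sub; exact: keepv.
  have [_ _ _] := Hv i; exact: touch_inf_sub (@keepv i) keepu.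
move=> i j ij vij.
(* Without [y], whatever is reached from [v i] lies in its old cluster or on its own arm, because
   the arms are disjoint. *)
suff H z : linked (delv f y) (v i) z -> linked e (v i) z \/ z \in p i.
  case: (H _ vij); first exact: nv.
  move=> vp; apply: (ndv j); apply: (@dmem i); by rewrite inE vp orbT.
apply: (linked_ind (P := fun z => linked e (v i) z \/ z \in p i)).
  by left; exact: linked_refl.
move=> a b Ha /and3P[/orP[/and3P[ab nFa nFb]|/existsP[k ark]] ay byy].
  case: Ha => [va|ap]; last first.
    by case/negP: nFa; apply/orP; right; apply/existsP; exists i.
  by left; apply: (linked_trans va); exact: linked_step.
have [_ [al bl]] := arc_mem (pl k) ark.
have ki : k = i.
  apply/eqP; apply: contrapT => /negP ki.
  move: al; rewrite inE (negbTE ay) mem_rcons inE /= => /orP[/eqP at_|ak].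
    case: Ha => [va|ap].
      apply: (nv _ _ ki); apply: (linked_trans (lvt k)); rewrite -at_.
      exact: linked_sym.
    apply: (ndv k); apply: (linked_trans (@dmem i a _)); first by rewrite inE ap orbT.
    by rewrite at_; apply: linked_sym.
  case: Ha => [va|ap].
    apply: (ndv i); apply: (linked_trans (@dmem k a _)); first by rewrite inE ak orbT.
    exact: linked_sym.
  by have := dp _ _ ki _ ak; rewrite ap.
move: bl; rewrite ki inE (negbTE byy) mem_rcons inE /= => /orP[/eqP ->|bp].
  by left.
by right.
Qed.

End StarTv.

(** * The bridges along a path, and the eccentricity of a mark *)

Section Levels.
Variables (V : choiceType) (G : graph V).
Implicit Types (e : rel V) (x y z s t u v a b : V).

(** The separating bridges have distinct levels, all smaller than the number of these bridges, so
    every such level occurs. *)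
Lemma lev_attained e u v n : symmetric e -> n < lev e u v ->
  exists2 c, Bd e u v c & lev e u c.1 = n.
Proof.
move=> es nl; pose l := [seq lev e u c.1 | c <- fset_set (Bd e u v)].
have mem c : (c \in (fset_set (Bd e u v) : seq _)) -> Bd e u v c.
  by rewrite in_fset_set ?inE //; exact: Bd_finite.
have ul : uniq l.
  rewrite map_inj_in_uniq ?fset_uniq // => c c' /mem cB /mem c'B.
  exact: (lev_inj es cB c'B).
have sub : {subset l <= iota 0 (lev e u v)}.
  move=> _ /mapP[[a b] /mem cB ->]; rewrite mem_iota add0n /=.
  exact: (lev_lt es cB).
have [_ E] : (size l = size (iota 0 (lev e u v))) * (l =i iota 0 (lev e u v)).
  by apply: uniq_min_size => //; rewrite size_iota size_map.
have : n \in l by rewrite E mem_iota.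
by move=> /mapP[c /mem cB ->]; exists c.
Qed.

Lemma touch_inf_cut e a b x y : symmetric e -> bridge e a b -> ~ linked e a y ->
  linked e a x -> touch_inf G e x y -> touch_inf G (cut e a b) b y \/ touch_inf G (cut e a b) a y.
Proof.
move=> es ab nay ax ti; have [t1|n1] := pselect (touch_inf G (cut e a b) b y); first by left.
have [t2|n2] := pselect (touch_inf G (cut e a b) a y); first by right.
have f1 := contrapT n1; have f2 := contrapT n2; case: ti.
have : finite_set ([set c : V * V | [/\ G c.1 c.2, linked (cut e a b) b c.1
    & linked (cut e a b) y c.2]] `|` [set c : V * V | [/\ G c.1 c.2,
    linked (cut e a b) a c.1 & linked (cut e a b) y c.2]]).
  by rewrite finite_setU.
apply: sub_finite_set => -[s t] [/= Gst xs yt].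
have nfy z : linked e y z -> ~ far e a b z.
  move=> yz /far_linked bz; apply: nay; apply: linked_trans (linked_step (proj1 ab)) _.
  by apply: linked_trans bz _; exact: linked_sym.
have yt' : linked (cut e a b) y t.
  apply: (cross_stay es ab) => //; apply: nfy => //; exact: linked_refl.
have [f|f] := farVnear es ab (linked_trans ax xs); [by left|right].
by split=> //; rewrite cutC.
Qed.

(** The far side of an earlier bridge contains that of [a b], and with it infinitely many touching
    edges. *)
Lemma Bd_out e x y a b c : symmetric e -> ~ linked e x y -> out G e x y a b ->
  Bd e x a c -> out G e x y c.1 c.2.
Proof.
move: c => [p q] es nxy [ab nx t] [/= pq fx fa]; split=> //.
have xp : linked e x p by apply: linked_sym => //; exact: far_linked fx.
have pxf : linked (cut e p q) p x by rewrite cutC.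
have fs : symmetric (cut e p q) by exact: sym_cut.
apply: touch_inf_sub t => s ls.
  apply: contrapT => nf; have nf' : far e q p s.
    apply/nearP => //; apply: linked_trans (linked_sym es xp) _.
    apply: linked_trans (linked_sym es (far_linked nx)) _.
    exact: linked_trans (linked_step (proj1 ab)) (far_linked ls).
  have xs : linked (cut e p q) x s.
    by apply: linked_trans (linked_sym fs pxf) _; rewrite cutC.
  have nfx : ~ far e a b x by move=> f; exact: (far_nfar es ab f).
  have xa := linked_sub (@sub_cut _ _ _ _) (cross_near es ab (@sub_cut _ e p q) nfx ls xs).
  apply: (proj2 pq); apply: linked_trans fa _.
  by apply: linked_sym => //; exact: linked_trans pxf xa.
have nfy z : linked e y z -> ~ far e p q z.
  move=> yz /far_linked qz; apply: nxy; apply: linked_trans xp _.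
  apply: linked_trans (linked_step (proj1 pq)) _.
  by apply: linked_trans qz _; exact: linked_sym.
apply: (linked_sub (sub_cut2 (@sub_cut _ e a b))).
apply: (cross_stay es pq) => //; first exact: sub_cut.
  by apply: nfy; exact: linked_refl.
by apply: nfy; apply: linked_sub ls; exact: sub_cut.
Qed.

(** Eccentricity of a mark: how far, in levels, its [out] bridges extend. Only bounds are expressed,
    because it may be infinite. *)
Definition ecc_lt e x y n := forall a b, out G e x y a b -> lev e x a < n.

(** Consider the bridge of level n on the way from [x] to [u]. One of its sides touches infinitely
    often: the far side is excluded by the bound at [x], so it is the near side, and the bound at
    [u] puts the bridge at level below n from [u]. The triangle inequality gives at most n + 1 + (n
    - 1). *)
Lemma lev_le_ecc e x y u v n : adm G e -> mark G e x y -> linked e x u ->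
  linked e y v -> ecc_lt e x y n -> ecc_lt e u v n -> lev e x u <= n.*2.
Proof.
move=> [es eG] [Gxy nxy ti] xu yv exy euv.
rewrite leqNgt; apply/negP => lt.
have nlt : n < lev e x u by apply: leq_ltn_trans lt; rewrite -addnn leq_addl.
have [[a b] cB la] := lev_attained es nlt; have [/= ab fx fu] := cB.
have ax : linked e a x := far_linked fx.
have nay : ~ linked e a y.
  by move=> ay; apply: nxy; apply: linked_trans ay; exact: linked_sym.
have [t|t] := touch_inf_cut es ab nay ax ti.
  by have := exy a b (And3 ab fx t); rewrite la ltnn.
have ba := bridgeC es ab.
have nf z : linked e y z -> ~ far e b a z.
  move=> yz /far_linked az; apply: nay; apply: linked_trans az _.
  exact: linked_sym.
have vy : linked (cut e b a) v y.
  apply: (cross_stay es ba) => //; last exact: linked_sym.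
    exact: nf.
  by apply: nf; exact: linked_refl.
have t' : touch_inf G (cut e b a) a v.
  apply: touch_inf_sub t => s; rewrite cutC //.
  exact: linked_trans.
have := euv b a (And3 ba fu t'); rewrite levC // => lb.
have ab1 : lev e a b <= 1.
  by apply: lev_walk => //; apply/walkS; exists b; [exact: (proj1 ab)|apply/walk0].
have := lev_triangle es u (linked_sym es ax); rewrite la => l1.
have := lev_triangle es u (linked_step (proj1 ab)) => l2.
move: lt; rewrite ltnNge => /negP; apply; apply: (leq_trans l1).
rewrite -addnn leq_add2l; apply: (leq_trans l2).
by apply: leq_trans lb; rewrite -addn1 addnC leq_add2l.
Qed.

(** On the way to one [out] bridge of high level there is a bridge of each lower level, and by
    [Bd_out] it qualifies too. *)
Lemma out_many e x y N : adm G e -> mark G e x y ->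
  (exists a b, out G e x y a b /\ N <= lev e x a) ->
  exists s : seq (V * V), [/\ uniq s, size s = N &
    forall c, c \in s -> out G e x y c.1 c.2 /\ lev e x c.1 < N].
Proof.
move=> [es eG] [Gxy nxy ti] [a [b [oab le]]].
have ex n : exists c, n < N -> Bd e x a c /\ lev e x c.1 = n.
  have [nN|nN] := ltnP n N; last by exists (a, b).
  by have [c cB lc] := lev_attained es (leq_trans nN le); exists c.
have [f Hf] := boolp.choice ex.
exists [seq f n | n <- iota 0 N]; split.
- rewrite map_inj_in_uniq ?iota_uniq // => m n; rewrite !mem_iota /= => mN nN E.
  by have [_ <-] := Hf m mN; have [_ <-] := Hf n nN; rewrite E.
- by rewrite size_map size_iota.
- move=> _ /mapP[n + ->]; rewrite mem_iota /= => nN; have [cB lc] := Hf n nN.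
  by rewrite lc; split=> //; apply: (Bd_out es nxy oab cB).
Qed.

End Levels.

Import Order.TTheory GRing.Theory Num.Theory.
Local Open Scope ring_scope.

(** * Events *)

Section Cylinders.
Variable V : choiceType.
Implicit Types (e : rel V) (x y z t u v a b : V) (l : seq (V * V)).

(** Only open edges are prescribed: this family is already stable under intersection, as the
    pi-lambda argument requires, and its probabilities are plain powers of p. *)
Definition cyl l : set (rel V) := [set e | all (fun c => e c.1 c.2) l].

Definition sig : set (set (rel V)) := <<s range cyl >>.

Lemma dynkin_sig (D : set (set (rel V))) : dynkin D -> (forall l, D (cyl l)) ->
  sig `<=` D.
Proof.
move=> dD cD; rewrite /sig -setI_closed_g_dynkin_g_sigma_algebra.
  by apply: smallest_sub => // _ [l _ <-].
move=> _ _ [l _ <-] [l' _ <-]; exists (l ++ l') => //.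
by apply/seteqP; split=> e; rewrite /cyl /= all_cat => /andP.
Qed.

Lemma sig_cyl l : sig (cyl l).
Proof. by apply: sub_sigma_algebra; exists l. Qed.

Definition edge (c : V * V) : {fset V} := [fset c.1; c.2]%fset.

Lemma edgeP c a b : edge c = edge (a, b) <-> same_edge a b c.1 c.2.
Proof.
case: c => s t; rewrite /edge /=; split=> [/fsetP E|].
  have := E s; have := E t; have := E a; have := E b; rewrite !inE !eqxx !orbT /=.
  rewrite /same_edge /= (eq_sym b) (eq_sym b) (eq_sym a) (eq_sym a).
  case: (s == a); case: (t == b) => //=; case: (s == b) => //=;
  case: (t == a) => //=.
by case/orP => /andP[/eqP -> /eqP ->] //; rewrite fsetUC.
Qed.

End Cylinders.

Section Law.
Variables (R : realType) (V : choiceType) (G : graph V).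
Variables (d : measure_display) (T : measurableType d) (P : probability T R).
Implicit Types (e : rel V) (x y z u v a b : V) (l : seq (V * V)).

Lemma meas_rel (f : T -> rel V) : (forall l, measurable (f @^-1` cyl l)) ->
  forall B, sig B -> measurable (f @^-1` B).
Proof.
move=> mf; apply: (dynkin_sig (D := [set B | measurable (f @^-1` B)])) => //.
split => /=.
- by rewrite preimage_setT.
- by move=> A mA; rewrite preimage_setC; exact: measurableC.
- by move=> F _ mF; rewrite /= preimage_bigcup; apply: bigcup_measurable => i _; exact: mF.
Qed.

Local Open Scope ereal_scope.

(** Uniqueness of measures by the pi-lambda theorem. The weights and the sets [D1], [D2] let one
    proof serve both the invariance under automorphisms and the insertion of an edge. *)
Lemma law_eq (f1 f2 : T -> rel V) (D1 D2 : set T) (a b : R) :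
  (0 <= a)%R -> (0 <= b)%R -> measurable D1 -> measurable D2 ->
  (forall l, measurable (f1 @^-1` cyl l)) ->
  (forall l, measurable (f2 @^-1` cyl l)) ->
  (forall l, a%:E * P (D1 `&` f1 @^-1` cyl l) = b%:E * P (D2 `&` f2 @^-1` cyl l)) ->
  forall B, sig B -> a%:E * P (D1 `&` f1 @^-1` B) = b%:E * P (D2 `&` f2 @^-1` B).
Proof.
move=> a0 b0 mD1 mD2 mf1 mf2 E.
pose K := [set B | sig B /\
   a%:E * P (D1 `&` f1 @^-1` B) = b%:E * P (D2 `&` f2 @^-1` B)].
suff : @sig V `<=` K by move=> sK B /sK [].
have compl (f : T -> rel V) D A : (forall l, measurable (f @^-1` cyl l)) ->
    measurable D -> sig A ->
    P (D `&` f @^-1` ~` A) = P D - P (D `&` f @^-1` A).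
  move=> mf mD sA; rewrite preimage_setC -setDE measureD //; last first.
    by rewrite (le_lt_trans (probability_le1 _ _)) // ltry.
  exact: meas_rel.
have ET : a%:E * P D1 = b%:E * P D2.
  by have := E [::]; rewrite (_ : cyl _ = setT) ?preimage_setT ?setIT //;
    apply/seteqP; split.
apply: dynkin_sig; last by move=> l; split; [exact: sig_cyl|exact: E].
split.
- split; last by rewrite !preimage_setT !setIT.
  have := @sig_cyl V [::]; rewrite (_ : cyl _ = setT) //.
  by apply/seteqP; split.
- move=> A [sA EA]; split; first exact: sigma_algebraC.
  rewrite !compl // !muleBr ?ET ?EA //.
  + by rewrite fin_num_adde_defr // fin_num_measure.
  + by rewrite fin_num_adde_defr // fin_num_measure.
- move=> F tF KF; split.
    by apply: sigma_algebra_bigcup => i; case: (KF i).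
  have tI (f : T -> rel V) D : trivIset setT (fun i => D `&` f @^-1` F i).
    apply/trivIsetP => i j _ _ ij; rewrite setIACA -preimage_setI.
    by move/trivIsetP : tF => ->//; rewrite preimage_set0 setI0.
  rewrite !preimage_bigcup !setI_bigcupr !measure_bigcup //.
  + rewrite -!nneseriesZl //; apply: eq_eseriesr => i _.
    by case: (KF i).
  + by move=> i _; apply: measurableI => //; apply: meas_rel => //; case: (KF i).
  + by move=> i _; apply: measurableI => //; apply: meas_rel => //; case: (KF i).
Qed.

End Law.

Section Bernoulli.
Variables (R : realType) (V : choiceType) (G : graph V).
Variables (d : measure_display) (T : measurableType d) (P : probability T R).
Variables (p : R) (w : T -> set {fset V}).
Hypothesis perc : bernoulli_bond_percolation G P p w.
Implicit Types (e : rel V) (x y z u v a b : V) (l : seq (V * V)).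

Definition opn t : rel V := open_rel G (w t).

Lemma adm_opn t : adm G (opn t).
Proof.
split=> [x y|x y /andP[]//].
by rewrite /opn /open_rel adj_sym fsetUC.
Qed.

(** A list may name an edge repeatedly or in both directions, whereas in the exponent of p every
    edge counts once. *)
Definition edgeset l : {fset {fset V}} := [fset edge c | c in l]%fset.

Definition inG l := all (fun c => G c.1 c.2) l.

Lemma in_edgeset l i : reflect (exists2 c, c \in l & i = edge c) (i \in edgeset l).
Proof. exact: imfsetP. Qed.

Lemma preimage_cyl l : inG l ->
  opn @^-1` cyl l = \bigcap_(i in [set` edgeset l]) [set t | w t i].
Proof.
move=> /allP Gl; apply/seteqP; split=> t.
  move=> /allP H i /= /in_edgeset[c cl ->].
  by have /andP[_ /asboolP] := H _ cl.
move=> H; apply/allP => c cl; rewrite /opn /open_rel Gl //=.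
by apply/asboolP; apply: (H (edge c)); apply/in_edgeset; exists c.
Qed.

Lemma preimage_cyl0 l : ~~ inG l -> opn @^-1` cyl l = set0.
Proof.
move=> /allPn[c cl nG]; apply/seteqP; split=> // t /allP/(_ _ cl).
by rewrite /opn /open_rel (negbTE nG).
Qed.

Lemma edgeset_sub l : inG l -> [set` edgeset l] `<=` edges G.
Proof.
move=> /allP Gl i /= /in_edgeset[c cl ->]; exists c.1, c.2; split=> //.
exact: Gl.
Qed.

Lemma measurable_cyl l : measurable (opn @^-1` cyl l).
Proof.
have [Gl|nGl] := boolP (inG l); last by rewrite preimage_cyl0.
rewrite preimage_cyl //; apply: fin_bigcap_measurable.
  exact: finite_fset.
by move=> i /(edgeset_sub Gl); have [[H _] _] := perc; exact: H.
Qed.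

Lemma prob_cyl l : inG l -> P (opn @^-1` cyl l) = (p ^+ #|` edgeset l|)%:E.
Proof.
move=> Gl; rewrite preimage_cyl //.
have [[_ ->] Hp] := perc; last exact: edgeset_sub.
rewrite (eq_big_seq (fun=> p%:E)); last first.
  by move=> i il; apply: Hp; exact: (edgeset_sub Gl).
rewrite big_const_seq count_predT iter_mule mule1.
by rewrite EFin_expe.
Qed.

Lemma measurable_opn B : sig B -> measurable (opn @^-1` B).
Proof. by apply: meas_rel; exact: measurable_cyl. Qed.

Lemma AutP f : Aut G f -> [/\ injective f, bijective f & forall x y, G (f x) (f y) = G x y].
Proof. by case=> bf H; split=> //; exact: bij_inj. Qed.

Definition pull (f : V -> V) e : rel V := [rel x y | e (f x) (f y)].

Lemma pull_cyl f l e : cyl l (pull f e) = cyl [seq (f c.1, f c.2) | c <- l] e.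
Proof. by rewrite /cyl /= all_map. Qed.

Lemma prob_aut f B : Aut G f -> sig B ->
  P (opn @^-1` [set e | B (pull f e)]) = P (opn @^-1` B).
Proof.
move=> /AutP[fi fb fG] sB.
have := @law_eq R V d T P (pull f \o opn) opn setT setT 1 1 ler01 ler01
  measurableT measurableT _ measurable_cyl _ B sB.
rewrite !setTI !mul1e; apply.
  move=> l; rewrite (_ : _ @^-1` _ = opn @^-1` cyl [seq (f c.1, f c.2) | c <- l]).
    exact: measurable_cyl.
  by apply/seteqP; split=> t; rewrite /preimage /= pull_cyl.
move=> l; rewrite !setTI !mul1e.
rewrite (_ : _ @^-1` _ = opn @^-1` cyl [seq (f c.1, f c.2) | c <- l]); last first.
  by apply/seteqP; split=> t; rewrite /preimage /= pull_cyl.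
have E : inG [seq (f c.1, f c.2) | c <- l] = inG l.
  by rewrite /inG all_map; apply: eq_all => c /=.
have [Gl|nGl] := boolP (inG l); last by rewrite !preimage_cyl0 ?E.
rewrite !prob_cyl ?E //; congr (_ ^+ _)%:E.
pose g (i : {fset V}) : {fset V} := [fset f x | x in i]%fset.
have gi : injective g.
  move=> i j /fsetP gij; apply/fsetP => z.
  have mg k : (f z \in g k) = (z \in k).
    by apply/imfsetP/idP => [[u /= uk /fi ->]//|zk]; exists z.
  by rewrite -!mg gij.
have -> : edgeset [seq (f c.1, f c.2) | c <- l] = [fset g i | i in edgeset l]%fset.
  have fe c : edge (f c.1, f c.2) = g (edge c).
    apply/fsetP => z; apply/idP/imfsetP => /=.
      by rewrite !inE => /orP[] /eqP ->; [exists c.1|exists c.2]; rewrite ?inE ?eqxx ?orbT.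
    by move=> [u + ->]; rewrite !inE => /orP[] /eqP ->; rewrite eqxx ?orbT.
  apply/fsetP => i; apply/in_edgeset/imfsetP => /=.
    by move=> [_ /mapP[c cl ->] ->]; exists (edge c); [apply/in_edgeset; exists c|rewrite fe].
  move=> [_ /in_edgeset[c cl ->] ->]; exists (f c.1, f c.2); last by rewrite fe.
  by apply/mapP; exists c.
by rewrite card_imfset.
Qed.

Lemma ins_cyl s u l e : cyl l (ins e s u) =
  cyl [seq c <- l | ~~ same_edge s u c.1 c.2] e.
Proof.
rewrite /cyl /= all_filter; congr is_true; apply: eq_all => c /=.
by rewrite /ins /= implyNb orbC.
Qed.

(** The state of [s u] is independent of all other edges, so forcing it open carries the law given
    that it is closed to the law given that it is open. On cylinders this amounts to striking [s u]
    from the list. *)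
Lemma prob_ins s u B : G s u -> 0 <= p <= 1 -> sig B ->
  (p%:E * P ([set t | ~~ opn t s u] `&` opn @^-1` [set e | B (ins e s u)]) =
  (1 - p)%:E * P ([set t | opn t s u] `&` opn @^-1` B))%E.
Proof.
move=> Gsu /andP[p0 p1] sB.
have Eopen : [set t | opn t s u] = opn @^-1` cyl [:: (s, u)].
  by apply/seteqP; split=> t; rewrite /cyl /preimage /= andbT.
have mopen : measurable [set t | opn t s u] by rewrite Eopen; exact: measurable_cyl.
have Eclosed : [set t | ~~ opn t s u] = ~` [set t | opn t s u].
  by apply/seteqP; split=> t /=; move/negP.
have mclosed : measurable [set t | ~~ opn t s u] by rewrite Eclosed; exact: measurableC.
have insE l : (fun t => ins (opn t) s u) @^-1` cyl l =
    opn @^-1` cyl [seq c <- l | ~~ same_edge s u c.1 c.2].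
  by apply/seteqP; split=> t; rewrite /preimage /= ins_cyl.
apply: (@law_eq R V d T P (fun t => ins (opn t) s u) opn) => //.
- by rewrite subr_ge0.
- by move=> l; rewrite insE; exact: measurable_cyl.
- exact: measurable_cyl.
move=> l; rewrite insE; set l' := [seq c <- l | _].
have openI k : [set t | opn t s u] `&` opn @^-1` cyl k = opn @^-1` cyl ((s, u) :: k).
  by apply/seteqP; split=> t; rewrite /cyl /preimage /= => /andP.
have Gl' : inG l = inG l'.
  rewrite /inG /l' all_filter; apply: eq_all => c /=.
  case h : (same_edge s u c.1 c.2) => //=.
  case/orP: h => /andP[/eqP -> /eqP ->] //; by rewrite adj_sym.
have [Gl|nGl] := boolP (inG l); last first.
  by rewrite !preimage_cyl0 -?Gl' // !setI0 !measure0 !mule0.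
have Gl1 : inG l' by rewrite -Gl'.
have Gl2 k : inG k -> inG ((s, u) :: k) by move=> Gk; rewrite /inG /= Gsu.
have -> : P ([set t | ~~ opn t s u] `&` opn @^-1` cyl l') =
    (P (opn @^-1` cyl l') - P (opn @^-1` cyl ((s, u) :: l')))%E.
  rewrite Eclosed setIC -setDE measureD //; last first.
  - by rewrite (le_lt_trans (probability_le1 _ _)) ?ltry //; exact: measurable_cyl.
  - exact: measurable_cyl.
  by rewrite setIC openI.
rewrite openI (prob_cyl Gl1) (prob_cyl (Gl2 _ Gl)) (prob_cyl (Gl2 _ Gl1)).
have nE0 : edge (s, u) \notin edgeset l'.
  apply/negP => /in_edgeset[c]; rewrite mem_filter => /andP[/negP nc _] E.
  by apply: nc; apply/edgeP.
have E1 k : edgeset ((s, u) :: k) = (edge (s, u) |` edgeset k)%fset.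
  apply/fsetP => i; rewrite in_fset1U; apply/in_edgeset/orP.
    move=> [c]; rewrite inE => /orP[/eqP -> ->|ck ->]; first by left.
    by right; apply/in_edgeset; exists c.
  move=> [/eqP ->|/in_edgeset[c ck ->]]; first by exists (s, u); rewrite ?mem_head.
  by exists c; rewrite // inE ck orbT.
have E2 : edgeset ((s, u) :: l) = edgeset ((s, u) :: l').
  apply/fsetP => i; apply/in_edgeset/in_edgeset => -[c]; rewrite inE.
    move=> /orP[/eqP -> ->|cl ->]; first by exists (s, u); rewrite ?mem_head.
    have [h|h] := boolP (same_edge s u c.1 c.2).
      by exists (s, u); rewrite ?mem_head //; apply/edgeP.
    by exists c; rewrite // inE mem_filter h cl orbT.
  move=> /orP[/eqP -> ->|]; first by exists (s, u); rewrite ?mem_head.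
  by rewrite mem_filter => /andP[_ cl] ->; exists c; rewrite // inE cl orbT.
rewrite E2 E1 cardfsU1 nE0 add1n -EFinB -!EFinM; congr _%:E.
by rewrite exprS mulrBr mulrBl mul1r.
Qed.

End Bernoulli.

Lemma countable_inj T : countable [set: T] -> exists f : T -> nat, injective f.
Proof.
by move=> /countable_injP[f fi]; exists f => x y; apply: fi; rewrite inE.
Qed.

Lemma inj_countable T (U : countType) (f : T -> U) : injective f -> countable [set: T].
Proof.
move=> fi; apply/countable_injP; exists (@choice.pickle U \o f) => x y _ _ /=.
by move=> /(pcan_inj (@choice.pickleK U)) /fi.
Qed.

Lemma countable_pair T U : countable [set: T] -> countable [set: U] ->
  countable [set: T * U].
Proof.
move=> /countable_inj[f fi] /countable_inj[g gi].
apply: (@inj_countable _ (nat * nat)%type (fun c => (f c.1, g c.2))).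
by move=> [a b] [c d] /= [/fi -> /gi ->].
Qed.

Lemma countable_seq T : countable [set: T] -> countable [set: seq T].
Proof.
move=> /countable_inj[f fi].
by apply: (@inj_countable _ (seq nat) (map f)); exact: inj_map.
Qed.

(** * Measurability of the events in use *)

Section Borel.
Variables (V : choiceType) (G : graph V).
Hypothesis Vc : countable [set: V].
Implicit Types (e : rel V) (x y z u v a b : V) (l : seq (V * V)).
Implicit Types A B : rel V -> Prop.

(* Only the values on subgraphs of G matter, which makes room for equivalences
   that rely on the symmetry of e. *)
Definition event A := exists2 B : set (rel V), sig B & forall e, adm G e -> (A e <-> B e).

Lemma event_ext A B : (forall e, adm G e -> (A e <-> B e)) -> event A -> event B.
Proof.
by move=> AB [C sC H]; exists C => // e ea; rewrite -AB //; exact: H.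
Qed.

Lemma event_not A : event A -> event (fun e => ~ A e).
Proof.
move=> [C sC H]; exists (~` C); first exact: sigma_algebraC.
by move=> e ea; rewrite /setC /=; have := H e ea; tauto.
Qed.

Lemma event_exn (A : nat -> rel V -> Prop) : (forall n, event (A n)) ->
  event (fun e => exists n, A n e).
Proof.
move=> MA.
have ex n : exists C, sig C /\ forall e, adm G e -> (A n e <-> C e).
  by case: (MA n) => C; exists C.
have [C HC] := @boolp.choice _ _ _ ex.
exists (\bigcup_n C n).
  by apply: sigma_algebra_bigcup => n; case: (HC n).
move=> e ea; split=> [[n /(proj2 (HC n) e ea)]|[n _ /(proj2 (HC n) e ea)]].
  by exists n.
by exists n.
Qed.

Lemma event_const (Q : Prop) : event (fun=> Q).
Proof.
have [q|nq] := pselect Q.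
  exists (cyl [::]); first exact: sig_cyl.
  by move=> e _; split.
by exists set0 => //; exact: sigma_algebra0.
Qed.

Lemma event_ex (I : Type) (A : I -> rel V -> Prop) : countable [set: I] ->
  (forall i, event (A i)) -> event (fun e => exists i, A i e).
Proof.
move=> /countable_inj[f fi] MA.
apply: (@event_ext (fun e => exists n, exists i, f i = n /\ A i e)).
  by move=> e _; split=> [[n [i [_ ?]]]|[i ?]]; [exists i|exists (f i), i].
apply: event_exn => n.
have [[i fin]|no] := pselect (exists i, f i = n).
  apply: event_ext (MA i) => e _; split=> [?|[j [fj ?]]]; first by exists i.
  by rewrite (fi i j) // fin fj.
apply: event_ext (event_const False) => e _; split=> // -[i [fin _]].
by apply: no; exists i.
Qed.

Lemma event_all (I : Type) (A : I -> rel V -> Prop) : countable [set: I] ->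
  (forall i, event (A i)) -> event (fun e => forall i, A i e).
Proof.
move=> cI MA; apply: (@event_ext (fun e => ~ exists i, ~ A i e)).
  move=> e _; split=> [H i|H [i]]; last by apply; exact: H.
  by apply: contrapT => nA; apply: H; exists i.
by apply: event_not; apply: event_ex => // i; exact: event_not.
Qed.

Lemma event_and A B : event A -> event B -> event (fun e => A e /\ B e).
Proof.
move=> MA MB; apply: (@event_ext (fun e => forall b : bool, (if b then A else B) e)).
  move=> e _; split=> [H|[a b] []//]; split; [exact: (H true)|exact: (H false)].
by apply: event_all => [|[]//]; exact: countableP.
Qed.

Lemma event_or A B : event A -> event B -> event (fun e => A e \/ B e).
Proof.
move=> MA MB; apply: (@event_ext (fun e => ~ (~ A e /\ ~ B e))).
  by move=> e _; split=> [|]; have [|] := pselect (A e); have [|] := pselect (B e); tauto.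
by apply: event_not; apply: event_and; exact: event_not.
Qed.

Lemma event_imp A B : event A -> event B -> event (fun e => A e -> B e).
Proof.
move=> MA MB; apply: (@event_ext (fun e => ~ A e \/ B e)).
  by move=> e _; have [|] := pselect (A e); tauto.
by apply: event_or => //; exact: event_not.
Qed.

Lemma event_atom x y : event (fun e => e x y).
Proof.
exists (cyl [:: (x, y)]); first exact: sig_cyl.
by move=> e _; rewrite /cyl /= andbT.
Qed.

Lemma event_pre (g : rel V -> rel V) A : (forall e, adm G e -> adm G (g e)) ->
  (forall x y, event (fun e => g e x y)) -> event A -> event (fun e => A (g e)).
Proof.
move=> ga Mg [B sB AB].
apply: (@event_ext (fun e => B (g e))).
  by move=> e ea; apply: iff_sym; apply: AB; exact: ga.
move: B sB {AB}; apply: (dynkin_sig (D := [set B | event (fun e => B (g e))])).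
  split=> [|B MB|F _ MF]; first exact: (event_const True).
    exact: event_not.
  apply: (@event_ext (fun e => exists n, F n (g e))).
    by move=> e _; split=> [[n ?]|[n _ ?]]; exists n.
  exact: event_exn.
move=> l /=; apply: (@event_ext (fun e => forall c, c \in l -> g e c.1 c.2)).
  by move=> e _; split=> [H|/allP H]; [apply/allP|].
apply: event_all; first exact: countable_pair.
by move=> c; apply: event_imp; [exact: event_const|exact: Mg].
Qed.

Lemma adm_cut e a b : adm G e -> adm G (cut e a b).
Proof. by move=> ea; exact: (@adm_cuts _ G e [:: (a, b)] ea). Qed.

Lemma event_cut a b A : event A -> event (fun e => A (cut e a b)).
Proof.
apply: event_pre => [e|x y]; first exact: adm_cut.
apply: (@event_ext (fun e => e x y /\ ~~ same_edge a b x y)).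
  by move=> e _; split=> /andP.
by apply: event_and; [exact: event_atom|exact: event_const].
Qed.

Lemma adm_ins e a b : G a b -> adm G e -> adm G (ins e a b).
Proof.
move=> Gab [es eG]; split; first exact: sym_ins.
by move=> x y /orP[/eG//|/orP[] /andP[/eqP -> /eqP ->]//]; rewrite adj_sym.
Qed.

Lemma event_ins a b A : G a b -> event A -> event (fun e => A (ins e a b)).
Proof.
move=> Gab; apply: event_pre => [e|x y]; first exact: adm_ins.
apply: (@event_ext (fun e => e x y \/ same_edge a b x y)).
  by move=> e _; split=> /orP.
by apply: event_or; [exact: event_atom|exact: event_const].
Qed.

Lemma adm_delv e y : adm G e -> adm G (delv e y).
Proof.
by move=> [es eG]; split; [exact: sym_delv|move=> a b /sub_delv /eG].
Qed.

Lemma event_delv y A : event A -> event (fun e => A (delv e y)).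
Proof.
apply: event_pre => [e|a b]; first exact: adm_delv.
apply: (@event_ext (fun e => e a b /\ (a != y /\ b != y))).
  by move=> e _; split=> [[? [? ?]]|/and3P[]//]; exact/and3P.
by apply: event_and; [exact: event_atom|exact: event_const].
Qed.

Lemma event_walk n x y : event (fun e => walk e n x y).
Proof.
elim: n x => [|n IH] x.
  apply: event_ext (event_const (x = y)) => e _; split=> /walk0 //.
apply: (@event_ext (fun e => exists z, e x z /\ walk e n z y)).
  by move=> e _; split=> [[z [? ?]]|/walkS[z ? ?]]; [apply/walkS|]; exists z.
by apply: event_ex => // z; apply: event_and; [exact: event_atom|exact: IH].
Qed.

Lemma event_linked x y : event (fun e => linked e x y).
Proof. by apply: event_exn => n; exact: event_walk. Qed.

(** After a numbering of [I], infinite means unbounded, which takes countable quantifiers only. *)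
Lemma event_inf (I : choiceType) (S : I -> rel V -> Prop) : countable [set: I] ->
  (forall i, event (S i)) -> event (fun e => infinite_set [set i | S i e]).
Proof.
move=> cI MS; have [f fi] := countable_inj cI.
apply: (@event_ext (fun e => forall n, exists i, (n <= f i)%N /\ S i e)).
  move=> e _; split=> [H fin|inf n].
    have [i [lt Si]] := H (\max_(j <- fset_set [set i | S i e]) f j).+1.
    have iF : i \in fset_set [set i | S i e] by rewrite in_fset_set ?inE.
    by have := @leq_bigmax_seq _ _ xpredT f _ iF isT; rewrite leqNgt lt.
  apply: contrapT => /forallNP H; apply: inf.
  apply: (@sub_finite_set _ _ (f @^-1` `I_n)).
    move=> i Si /=; rewrite ltnNge; apply/negP => le; exact: (H i).
  by apply: finite_preimage; [move=> a b _ _; exact: fi|exact: finite_II].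
apply: event_all; first exact: countableP.
move=> n; apply: event_ex => // i; apply: event_and; [exact: event_const|exact: MS].
Qed.

Lemma event_touch_inf x y : event (fun e => touch_inf G e x y).
Proof.
apply: (@event_inf (V * V)%type (fun c e => [/\ G c.1 c.2, linked e x c.1 & linked e y c.2])).
  exact: countable_pair.
move=> c; apply: (@event_ext (fun e => G c.1 c.2 /\ (linked e x c.1 /\ linked e y c.2))).
  by move=> e _; split=> [[? [? ?]]|[]].
by apply: event_and; [exact: event_const|apply: event_and; exact: event_linked].
Qed.

Lemma event_bridge a b : event (fun e => bridge e a b).
Proof.
apply: event_and; first exact: event_atom.
by apply: event_not; apply: (@event_cut a b (fun e => linked e b a)); exact: event_linked.
Qed.

Lemma event_far a b s : event (fun e => far e a b s).
Proof. by apply: (@event_cut a b (fun e => linked e b s)); exact: event_linked. Qed.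

Lemma event_and3 A1 A2 A3 : event A1 -> event A2 -> event A3 ->
  event (fun e => [/\ A1 e, A2 e & A3 e]).
Proof.
move=> M1 M2 M3; apply: (@event_ext (fun e => A1 e /\ (A2 e /\ A3 e))).
  by move=> e _; split=> [[? [? ?]]|[]].
by do 2 apply: event_and => //.
Qed.

Lemma event_Bd u v c : event (fun e => Bd e u v c).
Proof. by apply: event_and3; [exact: event_bridge|exact: event_far|exact: event_far]. Qed.

(** The size of a random set is expressed by a covering list, which ranges over a countable type;
    this makes levels measurable. *)
Lemma lev_ltP e u v n : symmetric e ->
  (lev e u v < n)%N <->
  exists s : seq (V * V), (size s < n)%N /\ forall c, Bd e u v c -> c \in s.
Proof.
move=> es; split=> [lt|[s [lt H]]].
  exists (fset_set (Bd e u v)); split=> // c cB.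
  by rewrite in_fset_set ?inE //; exact: Bd_finite.
apply: leq_ltn_trans lt; apply: uniq_leq_size; first exact: fset_uniq.
move=> c; rewrite in_fset_set ?inE; first exact: H.
exact: Bd_finite.
Qed.

Lemma event_lev_lt u v n : event (fun e => (lev e u v < n)%N).
Proof.
apply: (@event_ext (fun e => exists s : seq (V * V), (size s < n)%N /\
    forall c, Bd e u v c -> c \in s)).
  by move=> e [es _]; apply: iff_sym; exact: lev_ltP.
apply: event_ex; first by apply: countable_seq; exact: countable_pair.
move=> s; apply: event_and; first exact: event_const.
apply: event_all; first exact: countable_pair.
by move=> c; apply: event_imp; [exact: event_Bd|exact: event_const].
Qed.

Lemma event_lev_eq u v n : event (fun e => lev e u v = n).
Proof.
apply: (@event_ext (fun e => (lev e u v < n.+1)%N /\ ~ (lev e u v < n)%N)).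
  move=> e _; split=> [[lt /negP]|->]; last by rewrite ltnSn ltnn.
  by rewrite -leqNgt => ge; apply/eqP; rewrite eqn_leq ge -ltnS lt.
by apply: event_and; [|apply: event_not]; exact: event_lev_lt.
Qed.

End Borel.

(** * Expected numbers *)

Section Count.
Variable R : realType.
Local Open Scope ereal_scope.

(** Turns a sum over a countable type into a series, to which integration term by term applies;
    numbers that encode nothing contribute 0. *)
Lemma esum_inj_nat (I : choiceType) (g : nat -> option I) (f : I -> nat)
    (a : I -> \bar R) : injective f -> pcancel f g -> ocancel g f ->
  (forall i, 0 <= a i) ->
  \esum_(i in [set: I]) a i = \sum_(n <oo) (if g n is Some i then a i else 0).
Proof.
move=> fi fK gK a0; 
pose b n : \bar R := if g n is Some i then a i else 0.
rewrite -[RHS]/(\sum_(n <oo) b n).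
have b0 n : 0 <= b n by rewrite /b; case: (g n).
rewrite nneseries_esumT // (eq_esum (b := fun i => b (f i))); last first.
  by move=> i _; rewrite /b fK.
rewrite -(esum_image _ f); last by move=> x y _ _ /fi.
rewrite esum_mkcond; apply: eq_esum => n _; case: ifPn => //.
rewrite notin_setE /b; have := gK n; case: (g n) => //= i fin no.
by case: no; exists i.
Qed.

Lemma inj_nat (I : Type) : countable [set: I] ->
  exists (f : I -> nat) (g : nat -> option I),
    [/\ injective f, pcancel f g & ocancel g f].
Proof.
move=> /countable_inj[f fi].
have ex n : exists o : option I, match o with Some i => f i = n | None => forall i, f i <> n end.
  have [[i fin]|no] := pselect (exists i, f i = n); first by exists (Some i).
  by exists None => i fin; apply: no; exists i.
have [g Hg] := boolp.choice ex; exists f, g; split=> //.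
- move=> i; have := Hg (f i); case: (g (f i)) => [j /fi -> //|/(_ i) //].
- by move=> n /=; have := Hg n; case: (g n).
Qed.

Definition cnt (I : choiceType) (S : set I) : \bar R := \esum_(i in S) 1.

Lemma cnt_ge0 (I : choiceType) (S : set I) : 0 <= cnt S.
Proof. by apply: esum_ge0 => i _; rewrite lee_fin. Qed.

Lemma cnt_fin (I : choiceType) (S : set I) : finite_set S ->
  cnt S = (#|` fset_set S|)%:R%:E.
Proof.
move=> fS; rewrite /cnt esum_fset //.
rewrite fsbig_finite //.
rewrite big_const_seq count_predT /=.
by elim: (size _) => //= n ->; rewrite -EFinD -natr1 addrC.
Qed.

Lemma cnt_sub (I : choiceType) (S S' : set I) : S `<=` S' -> cnt S <= cnt S'.
Proof.
move=> H; rewrite /cnt esum_mkcond [leRHS]esum_mkcond; apply: le_esum => i _.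
case: ifPn => [|_]; last by case: ifP.
by rewrite inE => /H Si; rewrite mem_set.
Qed.

Lemma cnt_image (I J : choiceType) (f : I -> J) (S : set I) : set_inj S f ->
  cnt (f @` S) = cnt S.
Proof. by move=> fi; rewrite /cnt esum_image. Qed.

Lemma cnt_inj (I J : choiceType) (f : I -> J) (S : set I) (S' : set J) :
  set_inj S f -> (forall i, S i -> S' (f i)) -> cnt S <= cnt S'.
Proof.
by move=> fi H; rewrite -(cnt_image fi); apply: cnt_sub => _ [i /H Si <-].
Qed.

Lemma cnt_ge_seq (I : choiceType) (S : set I) (s : seq I) : uniq s ->
  (forall i, i \in s -> S i) -> (size s)%:R%:E <= cnt S.
Proof.
move=> us H; apply: (@le_trans _ _ (cnt [set` s])); last by apply: cnt_sub => i /H.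
rewrite cnt_fin; last exact: finite_seq.
rewrite lee_fin ler_nat; apply: uniq_leq_size => // i si.
by rewrite in_fset_set ?inE.
Qed.

Lemma cnt_inf (I : choiceType) (S : set I) : infinite_set S -> cnt S = +oo.
Proof.
move=> iS; apply/eqP; rewrite -leye_eq leNgt; apply/negP => lt.
have [r Er] : exists r, cnt S = r%:E.
  by exists (fine (cnt S)); rewrite fineK // ge0_fin_numE // cnt_ge0.
pose n := (Num.truncn r).+1.
have [X XS Xn] := infinite_set_fset n iS.
have := cnt_ge_seq (fset_uniq X) XS; rewrite Er lee_fin => le.
have : (r < n%:R)%R by exact: truncnS_gt.
rewrite ltNge => /negP; apply; apply: le_trans le.
by rewrite ler_nat.
Qed.

Lemma cnt_le_seq (I : choiceType) (S : set I) (s : seq I) :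
  (forall i, S i -> i \in s) -> cnt S <= (size s)%:R%:E.
Proof.
move=> H; have fS : finite_set S by apply: sub_finite_set (finite_seq s) => i /H.
rewrite cnt_fin // lee_fin ler_nat; apply: uniq_leq_size; first exact: fset_uniq.
by move=> i; rewrite in_fset_set // inE => /H.
Qed.

End Count.

Section Expect.
Variables (R : realType) (V : choiceType) (G : graph V).
Variables (d : measure_display) (T : measurableType d) (P : probability T R).
Variables (p : R) (w : T -> set {fset V}).
Hypothesis perc : bernoulli_bond_percolation G P p w.
Hypothesis Vc : countable [set: V].
Implicit Types (e : rel V) (A B : rel V -> Prop).
Local Open Scope ereal_scope.

Definition Prb A := P [set t | A (opn G w t)].

Definition almost_surely A := {ae P, forall t, A (opn G w t)}.

Lemma measurable_event A : event G A -> measurable [set t | A (opn G w t)].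
Proof.
move=> [B sB AB]; rewrite (_ : [set t | _] = opn G w @^-1` B).
  exact: (measurable_opn perc).
by apply/seteqP; split=> t /=; have := AB _ (adm_opn G w t); rewrite /preimage /= => ->.
Qed.

Lemma Prb_ge0 A : 0 <= Prb A. Proof. exact: measure_ge0. Qed.

Lemma Prb_le1 A : event G A -> Prb A <= 1.
Proof. by move=> MA; apply: probability_le1; exact: measurable_event. Qed.

Lemma Prb_ext A B : (forall e, adm G e -> (A e <-> B e)) -> Prb A = Prb B.
Proof.
move=> AB; rewrite /Prb; congr (P _).
by apply/seteqP; split=> t /=; rewrite (AB _ (adm_opn G w t)).
Qed.

Lemma as_adm A : (forall e, adm G e -> A e) -> almost_surely A.
Proof. by move=> H; apply: aeW => t; exact: (H _ (adm_opn G w t)). Qed.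

Lemma as_imp A B : (forall e, adm G e -> A e -> B e) -> almost_surely A -> almost_surely B.
Proof.
move=> AB; rewrite /almost_surely; apply: filterS => t.
exact: AB (adm_opn G w t).
Qed.

Lemma as_and A B : almost_surely A -> almost_surely B -> almost_surely (fun e => A e /\ B e).
Proof. by move=> H1 H2; apply: filterS2 H1 H2 => t; split. Qed.

Lemma as_all (I : Type) (A : I -> rel V -> Prop) : countable [set: I] ->
  (forall i, almost_surely (A i)) -> almost_surely (fun e => forall i, A i e).
Proof.
move=> /inj_nat[f [g [fi fK gK]]] H.
have H' n : {ae P, forall t, if g n is Some i then A i (opn G w t) else True}.
  by case: (g n) => [i|]; [exact: H|exact: aeW].
by apply: filterS (ae_foralln H') => t Ht i; have := Ht (f i); rewrite fK.
Qed.

Lemma as_null A : event G A -> Prb A = 0 -> almost_surely (fun e => ~ A e).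
Proof.
move=> MA PA; exists [set t | A (opn G w t)]; split=> //; first exact: measurable_event.
by move=> t /= /contrapT.
Qed.

Lemma Prb_as0 A : event G A -> almost_surely (fun e => ~ A e) -> Prb A = 0.
Proof.
move=> MA [N [mN PN sub]]; apply/eqP; rewrite eq_le Prb_ge0 andbT -PN.
apply: le_measure; rewrite ?inE //; first exact: measurable_event.
by move=> t At; apply: sub => /= /(_ At).
Qed.

Lemma Prb_aut f A : Aut G f -> event G A -> Prb (fun e => A (pull f e)) = Prb A.
Proof.
move=> Af [B sB AB]; rewrite (Prb_ext AB) -[RHS](prob_aut perc Af sB).
apply: Prb_ext => e [es eG]; apply: AB; split; first by move=> x y; exact: es.
by move=> x y /eG; have [_ _ ->] := AutP Af.
Qed.

Lemma Prb_ins s u A : G s u -> (0 <= p <= 1)%R -> event G A ->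
  p%:E * Prb (fun e => ~~ e s u /\ A (ins e s u)) =
  (1 - p)%:E * Prb (fun e => e s u /\ A e).
Proof.
move=> Gsu p01 [B sB AB]; have := prob_ins perc Gsu p01 sB.
have -> : Prb (fun e => ~~ e s u /\ A (ins e s u)) =
          Prb (fun e => ~~ e s u /\ B (ins e s u)).
  by apply: Prb_ext => e ea; rewrite (AB _ (adm_ins Gsu ea)).
have -> : Prb (fun e => e s u /\ A e) = Prb (fun e => e s u /\ B e).
  by apply: Prb_ext => e ea; rewrite (AB _ ea).
by [].
Qed.

Lemma le_Prb A B : event G A -> event G B -> almost_surely (fun e => A e -> B e) -> Prb A <= Prb B.
Proof.
move=> MA MB [N [mN PN sub]].
have mA := measurable_event MA; have mB := measurable_event MB.
rewrite /Prb (@le_trans _ _ (P ([set t | B (opn G w t)] `|` N))) //.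
  apply: le_measure; rewrite ?inE //; first exact: measurableU.
  move=> t At; have [Bt|nBt] := pselect (B (opn G w t)); [by left|right].
  by apply: sub => /= /(_ At).
apply: le_trans (measureU2 _ mB mN) _.
by move: PN; rewrite /= => ->; rewrite adde0.
Qed.

Lemma cnt_indic (I : choiceType) (A : I -> rel V -> Prop) e :
  cnt R [set i | A i e] = \esum_(i in [set: I]) (\1_(A i) e : R)%:E.
Proof.
rewrite /cnt esum_mkcond; apply: eq_esum => i _; rewrite indicE.
rewrite (_ : (i \in _) = (e \in (A i : set (rel V)))); first by case: (e \in _).
by apply/idP/idP; rewrite !inE.
Qed.

Section CountInt.
Variables (I : choiceType) (A : I -> rel V -> Prop).
Hypothesis cI : countable [set: I].
Hypothesis MA : forall i, event G (A i).

Let ind i (t : T) : \bar R := (\1_(A i) (opn G w t))%:E.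

Let ind0 i t : 0 <= ind i t.
Proof. by rewrite lee_fin indicE; case: (_ \in _). Qed.

Let indE i : ind i = fun t => (\1_[set t | A i (opn G w t)] t)%:E.
Proof.
apply/funext => t; rewrite /ind !indicE; congr (_%:R%:E).
Qed.

Let mind i : measurable_fun setT (ind i).
Proof.
rewrite indE; apply/measurable_EFinP; apply: measurable_indic; exact: measurable_event.
Qed.

Let Iindic i : \int[P]_t ind i t = Prb (A i).
Proof. by rewrite indE integral_indic ?setIT //; exact: measurable_event. Qed.

Let X t : \bar R := cnt R [set i | A i (opn G w t)].

Lemma measurable_cnt : measurable_fun setT X.
Proof.
have [f [g [fi fK gK]]] := inj_nat cI.
rewrite (_ : X = fun t => \sum_(n <oo | n \in predT)
   (if g n is Some i then ind i t else 0)).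
  apply: ge0_emeasurable_sum => [n t _ _|n _]; first by case: (g n).
  by case: (g n) => [i|]; [exact: mind|exact: measurable_cst].
apply/funext => t; by rewrite /X cnt_indic (esum_inj_nat fi fK gK (fun i => ind0 i t)).
Qed.

Lemma integral_cnt : \int[P]_t cnt R [set i | A i (opn G w t)] =
  \esum_(i in [set: I]) Prb (A i).
Proof.
have [f [g [fi fK gK]]] := inj_nat cI.
rewrite (esum_inj_nat fi fK gK (fun i => Prb_ge0 (A i))).
rewrite (eq_integral (fun t => \sum_(n <oo)
   (if g n is Some i then ind i t else 0))); last first.
  by move=> t _; rewrite cnt_indic (esum_inj_nat fi fK gK (fun i => ind0 i t)).
rewrite integral_nneseries //.
- apply: eq_eseriesr => n _; case: (g n) => [i|]; first exact: Iindic.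
  exact: integral0.
- by move=> n; case: (g n) => [i|]; [exact: mind|exact: measurable_cst].
- by move=> n t _; case: (g n).
Qed.

End CountInt.

(** An almost sure inequality between two random counts is integrated. Counting arguments in a fixed
    configuration enter in this way, with [c] for bounded errors. *)
Lemma esum_Prb_le (I J : choiceType) (A : I -> rel V -> Prop)
    (B : J -> rel V -> Prop) (a b c : R) :
  countable [set: I] -> countable [set: J] ->
  (forall i, event G (A i)) -> (forall j, event G (B j)) ->
  (0 <= a)%R -> (0 <= b)%R -> (0 <= c)%R ->
  almost_surely (fun e => (a%:E * cnt R [set i | A i e] <= b%:E * cnt R [set j | B j e] + c%:E)%E) ->
  (a%:E * (\esum_(i in [set: I]) Prb (A i)) <=
  b%:E * (\esum_(j in [set: J]) Prb (B j)) + c%:E)%E.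
Proof.
move=> cI cJ MA MB a0 b0 c0 H.
have mA := measurable_cnt cI MA; have mB := measurable_cnt cJ MB.
rewrite -!integral_cnt // -!ge0_integralZl_EFin //; try by move=> t _; exact: cnt_ge0.
rewrite -[c%:E]mule1 -(probability_setT P) -integral_cst // -ge0_integralD //.
- apply: ae_ge0_le_integral => //.
  + by move=> t _; apply: mule_ge0; rewrite ?lee_fin //; exact: cnt_ge0.
  + exact: measurable_funeM.
  + by move=> t _; rewrite adde_ge0 ?lee_fin // mule_ge0 ?lee_fin // cnt_ge0.
  + by apply: emeasurable_funD => //; exact: measurable_funeM.
  + by move: H; rewrite /almost_surely; apply: filterS.
- by move=> t _; rewrite mule_ge0 ?lee_fin // cnt_ge0.
- exact: measurable_funeM.
Qed.

End Expect.

(** * Compatibility of all notions with automorphisms *)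

Section Pull.
Variables (V : choiceType) (G : graph V) (f : V -> V).
Hypothesis Af : Aut G f.
Implicit Types (e : rel V) (x y z u v a b s t : V).

Let fi : injective f. Proof. by case: (AutP Af). Qed.
Let fb : bijective f. Proof. by case: (AutP Af). Qed.

Definition pair_map (c : V * V) := (f c.1, f c.2).

Lemma pair_map_bij : bijective pair_map.
Proof.
have [g fK gK] := fb; exists (fun c => (g c.1, g c.2)) => -[a b].
  by rewrite /pair_map /= !fK.
by rewrite /pair_map /= !gK.
Qed.

Lemma ex_bij (T : Type) (h : T -> T) (P Q : T -> Prop) : bijective h ->
  (forall i, P i = Q (h i)) -> (exists i, P i) = (exists i, Q i).
Proof.
move=> [g hK gK] H; rewrite propeqE; split=> -[x]; first by rewrite H; exists (h x).
by exists (g x); rewrite H gK.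
Qed.

Lemma all_bij (T : Type) (h : T -> T) (P Q : T -> Prop) : bijective h ->
  (forall i, P i = Q (h i)) -> (forall i, P i) = (forall i, Q i).
Proof.
move=> [g hK gK] H; rewrite propeqE; split=> HP x; last by rewrite H.
by rewrite -(gK x) -H.
Qed.

Lemma inf_bij (T : choiceType) (h : T -> T) (P Q : T -> Prop) : bijective h ->
  (forall i, P i = Q (h i)) ->
  infinite_set [set i | P i] = infinite_set [set i | Q i].
Proof.
move=> [g hK gK] H; congr not; rewrite propeqE; split => fin.
  apply: (sub_finite_set _ (finite_image h fin)) => x Qx.
  by exists (g x); rewrite /= ?gK // H gK.
apply: (sub_finite_set _ (finite_image g fin)) => x Px.
by exists (h x); rewrite /= ?hK // -H.
Qed.

Lemma ex_pull (P Q : V -> Prop) : (forall x, P x = Q (f x)) ->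
  (exists i, P i) = (exists i, Q i).
Proof. exact: ex_bij. Qed.

Lemma all_pull (P Q : V -> Prop) : (forall x, P x = Q (f x)) ->
  (forall i, P i) = (forall i, Q i).
Proof. exact: all_bij. Qed.

Lemma adj_pull x y : (G x y : Prop) = G (f x) (f y).
Proof. by have [_ _ ->] := AutP Af. Qed.

Lemma eq_pull (x y : V) : (x = y) = (f x = f y).
Proof. by rewrite propeqE; split=> [->//|/fi]. Qed.

Lemma cut_pull e a b : cut (pull f e) a b = pull f (cut e (f a) (f b)).
Proof.
apply/funext => x; apply/funext => y; rewrite /cut /pull /same_edge /=.
by rewrite !(inj_eq fi).
Qed.

Lemma delv_pull e y : delv (pull f e) y = pull f (delv e (f y)).
Proof.
by apply/funext => a; apply/funext => b; rewrite /delv /pull /= !(inj_eq fi).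
Qed.

Lemma walk_pull e n x y : walk (pull f e) n x y = walk e n (f x) (f y).
Proof.
rewrite propeqE; elim: n x => [|n IH] x.
  by split=> /walk0; [move=> ->|move/fi ->]; apply/walk0.
split=> /walkS[z xz]; first by move/IH; move=> wz; apply/walkS; exists (f z).
have [g fK gK] := fb; move=> wz; apply/walkS; exists (g z).
  by rewrite /pull /= gK.
by apply/IH; rewrite gK.
Qed.

Lemma linked_pull e x y : linked (pull f e) x y = linked e (f x) (f y).
Proof.
by rewrite propeqE; split=> -[n]; [rewrite walk_pull|rewrite -walk_pull]; exists n.
Qed.

Lemma far_pull e a b s : far (pull f e) a b s = far e (f a) (f b) (f s).
Proof. by rewrite /far cut_pull linked_pull. Qed.

Lemma bridge_pull e a b : bridge (pull f e) a b = bridge e (f a) (f b).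
Proof. by rewrite /bridge far_pull. Qed.

Lemma Bd_pull e u v c : Bd (pull f e) u v c = Bd e (f u) (f v) (pair_map c).
Proof. by case: c => a b; rewrite /Bd /= bridge_pull !far_pull. Qed.

Lemma lev_pull e u v : symmetric e -> lev (pull f e) u v = lev e (f u) (f v).
Proof.
move=> es; have ps : symmetric (pull f e) by move=> x y; exact: es.
rewrite /lev (_ : Bd e (f u) (f v) = pair_map @` Bd (pull f e) u v).
  rewrite fset_set_image ?card_imfset //; first exact: bij_inj pair_map_bij.
  exact: Bd_finite.
have [h hK gK] := pair_map_bij.
apply/seteqP; split=> [c Bc|_ [c + <-]]; last by rewrite Bd_pull.
by exists (h c); rewrite ?gK // Bd_pull gK.
Qed.

Lemma touch_inf_pull e x y : touch_inf G (pull f e) x y = touch_inf G e (f x) (f y).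
Proof.
apply: (inf_bij pair_map_bij) => -[a b] /=.
by rewrite !linked_pull -adj_pull.
Qed.

Lemma mark_pull e x y : mark G (pull f e) x y = mark G e (f x) (f y).
Proof. by rewrite /mark linked_pull touch_inf_pull -adj_pull. Qed.

Lemma out_pull e x y a b :
  out G (pull f e) x y a b = out G e (f x) (f y) (f a) (f b).
Proof. by rewrite /out bridge_pull far_pull cut_pull touch_inf_pull. Qed.

End Pull.

(** * Mass transport *)

Section Sums.
Variable R : realType.
Local Open Scope ereal_scope.

Lemma esum_pair (I J : choiceType) (a : I -> J -> \bar R) :
  (forall i j, 0 <= a i j) ->
  \esum_(i in [set: I]) \esum_(j in [set: J]) a i j =
  \esum_(k in [set: I * J]) a k.1 k.2.
Proof.
move=> a0; rewrite esum_esum //; congr (esum _ _).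
by apply/seteqP; split=> -[i j].
Qed.

Lemma esum_reindex (I J : choiceType) (h : I -> J) (a : J -> \bar R) :
  bijective h ->
  \esum_(j in [set: J]) a j = \esum_(i in [set: I]) a (h i).
Proof.
move=> [g hK gK]; apply: reindex_esum; split=> //.
- by move=> x y _ _ /(can_inj hK).
- by move=> y _; exists (g y).
Qed.

Lemma esum_swap (I J : choiceType) (a : I -> J -> \bar R) :
  (forall i j, 0 <= a i j) ->
  \esum_(i in [set: I]) \esum_(j in [set: J]) a i j =
  \esum_(j in [set: J]) \esum_(i in [set: I]) a i j.
Proof.
move=> a0; rewrite !esum_pair //.
by rewrite (esum_reindex (h := fun c : J * I => (c.2, c.1))) //;
  exists (fun c => (c.2, c.1)) => -[].
Qed.

Lemma esumZl_le (I : choiceType) (k : R) (a : I -> \bar R) : (0 <= k)%R ->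
  (forall i, 0 <= a i) ->
  \esum_(i in [set: I]) (k%:E * a i) <= k%:E * \esum_(i in [set: I]) a i.
Proof.
move=> k0 a0; apply: ge_ereal_sup => _ [X [fX _] <-].
rewrite -ge0_mule_fsumr //; apply: lee_wpmul2l; first by rewrite lee_fin.
by apply: ereal_sup_ubound; exists X.
Qed.

Let sum_const (I : choiceType) (s : seq I) (c : \bar R) : uniq s ->
  \sum_(i \in [set` s]) c = (size s)%:R%:E * c.
Proof.
move=> us; rewrite -fsbig_seq // big_const_seq count_predT mule_natl.
by elim: (size s) => [|n IH] //; rewrite muleS -IH.
Qed.

Lemma esum_const_ge (I : choiceType) (S : set I) (s : seq I) (c : \bar R) :
  uniq s -> (forall i, i \in s -> S i) ->
  (size s)%:R%:E * c <= \esum_(i in S) c.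
Proof.
move=> us sS; rewrite -sum_const //; apply: ereal_sup_ubound.
by exists [set` s] => //; split => //; exact: finite_seq.
Qed.

Lemma esum_const_le (I : choiceType) (S : set I) (s : seq I) (c : \bar R) :
  0 <= c -> (forall i, S i -> i \in s) ->
  \esum_(i in S) c <= (size s)%:R%:E * c.
Proof.
move=> c0 Ss; apply: ge_ereal_sup => _ [X [fX XS] <-].
have E : X = [set` fset_set X] by rewrite fset_setK.
rewrite E sum_const ?fset_uniq //; apply: lee_wpmul2r => //.
rewrite lee_fin ler_nat; apply: uniq_leq_size; first exact: fset_uniq.
by move=> i; rewrite in_fset_set // inE => /XS /Ss.
Qed.

End Sums.

(** * Stabilizers, their orbits, and representatives of the vertex orbits *)

Section Automorphisms.
Variables (V : choiceType) (G : graph V).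
Hypothesis Gc : connected_graph G.
Hypothesis Gl : locally_finite G.
Implicit Types (x y z : V) (f g : V -> V).

Lemma Aut_id : Aut G id.
Proof. by split=> //; exists id. Qed.

Lemma Aut_comp f g : Aut G f -> Aut G g -> Aut G (f \o g).
Proof.
move=> [fb fG] [gb gG]; split; first exact: bij_comp.
by move=> x y /=; rewrite fG.
Qed.

Lemma Aut_inv f : Aut G f -> exists g, [/\ Aut G g, cancel f g & cancel g f].
Proof.
move=> [[g fK gK] fG]; exists g; split=> //; split; first by exists f.
by move=> x y; rewrite -fG !gK.
Qed.

Lemma ball_finite n x : finite_set [set z | walk G n x z].
Proof.
elim: n x => [|n IH] x.
  by apply: (sub_finite_set _ (finite_set1 x)) => z /= /walk0.
apply: (@sub_finite_set _ _ (\bigcup_(y in [set y | G x y]) [set z | walk G n y z])).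
  by move=> z /= /walkS[y xy yz]; exists y.
by apply: bigcup_finite => // y _; exact: IH.
Qed.

Lemma countable_vertices : countable [set: V].
Proof.
have [[x _]|no] := pselect (exists x : V, True); last first.
  rewrite (_ : [set: V] = set0); first exact: countable0.
  by apply/seteqP; split=> // x _; apply: no; exists x.
rewrite (_ : [set: V] = \bigcup_n [set z | walk G n x z]).
  by apply: bigcup_countable => // n _; apply: finite_set_countable; exact: ball_finite.
by apply/seteqP; split=> // z _; have [n xz] := Gc x z; exists n.
Qed.

Lemma pullG f : Aut G f -> pull f G = G :> rel V.
Proof.
move=> [_ fG]; apply/funext => x; apply/funext => y.
by rewrite /pull /= fG.
Qed.

Lemma stab_orbit_finite x y : finite_set (stab_orbit G x y).
Proof.
have [n xy] := Gc x y; apply: sub_finite_set (ball_finite n x) => _ [f [Af fx] <-] /=.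
by rewrite -{1}fx -(walk_pull Af) pullG.
Qed.

Lemma stab_orbit_refl x y : stab_orbit G x y y.
Proof. by exists id => //; split=> //; exact: Aut_id. Qed.

Lemma stab_orbit_trans x y z z' :
  stab_orbit G x y z -> stab_orbit G x y z' -> stab_orbit G x z z'.
Proof.
move=> [f [Af fx] <-] [g [Ag gx] <-].
have [h [Ah fK hK]] := Aut_inv Af.
exists (g \o h); last by rewrite /= fK.
by split; [exact: Aut_comp|rewrite /= -{1}fx fK].
Qed.

Lemma stab_orbit_eq x y z : stab_orbit G x y z -> stab_orbit G x z = stab_orbit G x y.
Proof.
move=> yz; apply/seteqP; split=> z'; last exact: stab_orbit_trans yz.
have zy := stab_orbit_trans yz (stab_orbit_refl x y).
exact: stab_orbit_trans zy.
Qed.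

Lemma orbit_reps : quasi_transitive G -> exists (rep : V -> V) (reps : seq V),
  uniq reps /\ forall y, rep y \in reps /\ exists2 f, Aut G f & f (rep y) = y.
Proof.
move=> Gq.
have [[x0 _]|no] := pselect (exists x : V, True); last first.
  by exists id, [::]; split=> // y; case: no; exists y.
have ex (O : set V) : exists x : V, forall y, O = Aut_orbit G y -> Aut_orbit G x = O.
  have [[x Ox]|no] := pselect (exists x, O = Aut_orbit G x); first by exists x.
  by exists x0 => y Oy; case: no; exists y.
have [k Hk] := boolp.choice ex.
exists (k \o Aut_orbit G), (fset_set (k @` range (Aut_orbit G))).
split; first exact: fset_uniq.
move=> y; split.
  rewrite in_fset_set; last exact: finite_image.
  by rewrite inE; exists (Aut_orbit G y) => //; exists y.
have := Hk _ y erefl => E.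
have : Aut_orbit G y y by exists id => //; exact: Aut_id.
by rewrite -{1}E => -[f Af fy]; exists f.
Qed.

End Automorphisms.

Section MassTransport.
Variables (R : realType) (V : choiceType) (G : graph V).
Hypothesis Gc : connected_graph G.
Hypothesis Gl : locally_finite G.
Variables (K : R) (rep : V -> V) (reps : seq V).
Hypothesis K0 : 0 < K.
Hypothesis Gu : forall x y : V,
    #|` fset_set (stab_orbit G x y)|%:R / #|` fset_set (stab_orbit G y x)|%:R <= K.
Hypothesis ureps : uniq reps.
Hypothesis repP : forall y, rep y \in reps /\ exists2 f, Aut G f & f (rep y) = y.

Let so x y := #|` fset_set (stab_orbit G x y)|.

Let so_gt0 x y : (0 < (so x y)%:R :> R).
Proof.
rewrite ltr0n cardfs_gt0; apply/fset0Pn; exists y.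
by rewrite in_fset_set ?inE; [exact: stab_orbit_refl|exact: stab_orbit_finite].
Qed.

Let wt x y : R := K / (so x y)%:R.

Let wt_ge0 x y : 0 <= wt x y.
Proof. by rewrite divr_ge0 // ltW. Qed.

Let wt_ge x y : 1 <= (so y x)%:R * wt x y.
Proof. by rewrite /wt mulrA ler_pdivlMr // mul1r mulrC -ler_pdivrMr //; exact: Gu. Qed.

Let moves x y z := exists f, [/\ Aut G f, f (rep y) = y & f z = x].

Local Open Scope ereal_scope.

(** Automorphisms carry [phi x y] to values [phi z (rep y)], and at least [so y x] vertices z occur.
    With the weight [K / so x y] they bring in at least [phi x y], by unimodularity. Conversely, for
    fixed z and o the vertices y that use [phi z o] lie in one orbit of the stabilizer of [x], so
    their equal weights add up to at most [K]. *)
Theorem mass_transport (phi : V -> V -> \bar R) (x : V) :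
  (forall a b, 0 <= phi a b) ->
  (forall f a b, Aut G f -> phi (f a) (f b) = phi a b) ->
  \esum_(y in [set: V]) phi x y <=
  K%:E * \esum_(z in [set: V]) \sum_(o <- reps) phi z o.
Proof.
move=> phi0 inv.
pose F y z := if `[< moves x y z >] then (wt x y)%:E * phi z (rep y) else 0.
have F0 y z : 0 <= F y z.
  by rewrite /F; case: ifP => // _; apply: mule_ge0; rewrite ?lee_fin.
apply: (@le_trans _ _ (\esum_(y in [set: V]) \esum_(z in [set: V]) F y z)).
  apply: le_esum => y _; have [_ [g Ag gy]] := repP y.
  have [h [Ah gK hK]] := Aut_inv Ag.
  rewrite (eq_esum (b := fun z => if z \in [set z | moves x y z] then
    (wt x y)%:E * phi x y else 0)); last first.
    move=> z _; rewrite /F; case: asboolP => m; last by rewrite memNset.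
    rewrite mem_set //; case: m => f [Af fy fz].
    by rewrite -(inv _ _ (rep y) Af) fy fz.
  rewrite -esum_mkcond.
  pose s := [seq h a | a <- fset_set (stab_orbit G y x)].
  apply: (le_trans _ (esum_const_ge (s := s) _ _ _)).
  - rewrite size_map -/(so y x) muleA -EFinM -[leLHS]mul1e.
    by apply: lee_wpmul2r => //; rewrite lee_fin.
  - rewrite map_inj_uniq ?fset_uniq //; exact: can_inj hK.
  - move=> _ /mapP[a + ->]; rewrite in_fset_set ?inE; last exact: stab_orbit_finite.
    move=> [f [Af fy] fx]; have [k [Ak fK kK]] := Aut_inv Af.
    exists (k \o g); split; first exact: Aut_comp.
      by rewrite /= gy -{1}fy fK.
    by rewrite /= hK -fx fK.
rewrite esum_swap //; apply: (le_trans _ (esumZl_le (ltW K0) _)); last first.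
  by move=> z; apply: sume_ge0.
apply: le_esum => z _.
rewrite (eq_esum (b := fun y => \sum_(o <- reps) if rep y == o then F y z else 0)); last first.
  move=> y _; have [ry _] := repP y.
  rewrite (bigD1_seq (rep y)) //= eqxx big1 ?adde0 // => o.
  by rewrite eq_sym => /negbTE ->.
rewrite esum_sum; last by move=> y o _ _; case: ifP.
rewrite ge0_sume_distrr // ; apply: lee_sum => o _.
pose Y := [set y | rep y = o /\ moves x y z].
have [[y0 [ry0 m0]]|no] := pselect (exists y, Y y); last first.
  rewrite esum1 ?mule_ge0 ?lee_fin ?(ltW K0) // => y _; case: eqP => // ry.
  by rewrite /F; case: asboolP => // m; case: no; exists y.
have Yso y : Y y -> stab_orbit G x y0 y.
  move=> [ry [f [Af fy fz]]]; have [g [Ag gy gz]] := m0.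
  have [k [Ak gK kK]] := Aut_inv Ag.
  exists (f \o k); last by rewrite /= -gy gK ry0 -ry.
  by split; [exact: Aut_comp|rewrite /= -{1}gz gK].
rewrite (eq_esum (b := fun y => if y \in Y then (wt x y0)%:E * phi z o else 0)); last first.
  move=> y _; case: eqP => [ry|nry]; last by rewrite memNset // => -[].
  rewrite /F; case: asboolP => m; last by rewrite memNset // => -[].
  have Yy : Y y by split.
  by rewrite mem_set // ry /wt /so (stab_orbit_eq (Yso _ Yy)).
rewrite -esum_mkcond.
apply: (le_trans (esum_const_le (s := fset_set (stab_orbit G x y0)) _ _)).
- by apply: mule_ge0; rewrite ?lee_fin.
- by move=> y /Yso; rewrite in_fset_set ?inE //; exact: stab_orbit_finite.
rewrite -/(so x y0) muleA -EFinM /wt mulrC divfK // lt0r_neq0 //.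
Qed.

End MassTransport.

Lemma countable_ord n (T : Type) : countable [set: T] -> countable [set: 'I_n -> T].
Proof.
move=> /countable_inj[f fi].
apply: (@inj_countable _ (seq nat) (fun h => codom (f \o h))) => g h.
move=> /eq_in_map E; apply/funext => i; apply: fi; apply: E.
by rewrite mem_enum.
Qed.

Ltac countable_tac := first [assumption | apply: countable_pair; countable_tac
  | apply: countable_seq; countable_tac | apply: countable_ord; countable_tac | exact: countableP].

Create HintDb event_tac.

Ltac event_tac := lazymatch goal with
| |- event _ (fun _ => ?Q) => exact: event_const
| |- event _ (fun e => @?A e /\ @?B e) => apply: (@event_and _ _ A B); event_tac
| |- event _ (fun e => [/\ @?A e, @?B e & @?C e]) => apply: (@event_and3 _ _ A B C); event_tac
| |- event _ (fun e => @?A e \/ @?B e) => apply: (@event_or _ _ A B); event_tac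
| |- event _ (fun e => exists i : ?I, @?A e i) =>
    refine (@event_ex _ _ I (fun i e => A e i) _ _); [countable_tac|intro; cbn beta; event_tac]
| |- event _ (fun e => @?A e -> @?B e) => apply: (@event_imp _ _ A B); event_tac
| |- event _ (fun e => forall i : ?I, @?A e i) =>
    refine (@event_all _ _ I (fun i e => A e i) _ _); [countable_tac|intro; cbn beta; event_tac]
| |- event _ (fun e => ~ finite_set [set i : ?I | @?A e i]) =>
    refine (@event_inf _ _ I (fun i e => A e i) _ _); [countable_tac|intro; cbn beta; event_tac]
| |- event _ (fun e => ~ @?A e) => apply: (@event_not _ _ A); event_tac
| |- _ => eauto 2 with events
end.

Section MbMore.
Variables (V : choiceType) (G : graph V).
Hypothesis Vc : countable [set: V].
Implicit Types (e : rel V) (x y a b u v : V).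

Lemma event_natom x y : event G (fun e => ~~ e x y).
Proof.
apply: event_ext (event_not (event_atom G x y)) => e _.
by split=> /negP.
Qed.

Hint Resolve event_linked event_atom event_walk event_touch_inf event_bridge event_far event_Bd event_lev_lt
  event_lev_eq : events.

Lemma event_mark x y : event G (fun e => mark G e x y).
Proof. by rewrite /mark; event_tac. Qed.

Lemma event_touch_inf_cut a b x y : event G (fun e => touch_inf G (cut e a b) x y).
Proof. by apply: (@event_cut _ _ _ a b (fun e => touch_inf G e x y)) => //; event_tac. Qed.

Lemma event_touch_inf_delv y u v : event G (fun e => touch_inf G (delv e y) u v).
Proof. by apply: (@event_delv _ _ _ y (fun e => touch_inf G e u v)) => //; event_tac. Qed.

Lemma event_linked_delv y u v : event G (fun e => linked (delv e y) u v).
Proof. by apply: (@event_delv _ _ _ y (fun e => linked e u v)) => //; event_tac. Qed.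

Hint Resolve event_natom event_mark event_touch_inf_cut event_touch_inf_delv event_linked_delv : events.

Lemma event_out x y a b : event G (fun e => out G e x y a b).
Proof. by rewrite /out; event_tac. Qed.

Lemma event_trivertex y u : event G (fun e => trivertex G e y u).
Proof. by rewrite /trivertex; event_tac. Qed.

End MbMore.

#[global] Hint Resolve event_linked event_atom event_walk event_touch_inf event_bridge event_far event_Bd event_lev_lt
  event_lev_eq event_natom event_mark event_touch_inf_cut event_touch_inf_delv event_linked_delv event_out event_trivertex : events.

(** The extreme values of [p] are excluded because edges are to be both opened and closed at a
    bounded cost in probability. *)
Record setting (R : realType) (V : choiceType) (G : graph V)
    (d : measure_display) (T : measurableType d) (P : probability T R)
    (p : R) (w : T -> set {fset V}) : Prop := Setting {
  st_conn : connected_graph G;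
  st_fin : locally_finite G;
  st_trans : quasi_transitive G;
  st_unim : unimodular G R;
  st_perc : bernoulli_bond_percolation G P p w;
  st_p : 0 < p < 1 }.

Section Setting.
Variables (R : realType) (V : choiceType) (G : graph V).
Variables (d : measure_display) (T : measurableType d) (P : probability T R).
Variables (p : R) (w : T -> set {fset V}).
Hypothesis st : setting G P p w.
Implicit Types (e : rel V) (A B : rel V -> Prop) (x y z a b u v o : V).
Notation Prb := (Prb G P w).
Notation almost_surely := (almost_surely G P w).

Let perc := st_perc st.

Lemma st_count : countable [set: V].
Proof. exact: countable_vertices (st_conn st) (st_fin st). Qed.

Let Vc := st_count.

Local Open Scope ereal_scope.

Lemma esum_unit (a : \bar R) : 0 <= a -> \esum_(j in [set: unit]) a = a.
Proof.
move=> a0; rewrite (_ : [set: unit] = [set tt]) ?esum_set1 //.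
by apply/seteqP; split=> // -[].
Qed.

Lemma cnt_esum_le (I : choiceType) (A : I -> rel V -> Prop) B (n : nat) :
  countable [set: I] -> (forall i, event G (A i)) -> event G B ->
  almost_surely (fun e => (forall i, A i e -> B e) /\ (cnt R [set i | A i e] <= n%:R%:E)%E) ->
  \esum_(i in [set: I]) Prb (A i) <= n%:R%:E * Prb B.
Proof.
move=> cI MA MB H; have U : countable [set: unit] by exact: countableP.
have := @esum_Prb_le _ _ _ _ _ _ _ _ perc I unit A (fun=> B) 1 n%:R 0 cI U MA (fun=> MB)
  ler01 (ler0n _ _) (lexx _).
rewrite esum_unit ?mul1e ?adde0; last exact: Prb_ge0.
apply; apply: as_imp H => e _ [AB le]; rewrite mul1e adde0.
have [Be|nB] := pselect (B e); last first.
  rewrite /cnt esum1; first by rewrite mule_ge0 ?lee_fin // cnt_ge0.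
  by move=> i /AB.
rewrite (le_trans le) // -[leLHS]mule1; apply: lee_wpmul2l; first by rewrite lee_fin.
by apply: (@cnt_ge_seq R _ _ [:: tt]).
Qed.

Lemma cnt_esum_ge (I : choiceType) (A : I -> rel V -> Prop) B (n : nat) :
  countable [set: I] -> (forall i, event G (A i)) -> event G B ->
  almost_surely (fun e => B e -> (n%:R%:E <= cnt R [set i | A i e])%E) ->
  n%:R%:E * Prb B <= \esum_(i in [set: I]) Prb (A i).
Proof.
move=> cI MA MB H; have U : countable [set: unit] by exact: countableP.
have := @esum_Prb_le _ _ _ _ _ _ _ _ perc unit I (fun=> B) A n%:R 1 0 U cI (fun=> MB) MA
  (ler0n _ _) ler01 (lexx _).
rewrite esum_unit ?mul1e ?adde0; last exact: Prb_ge0.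
apply; apply: as_imp H => e _ BA; rewrite mul1e adde0.
have [Be|nB] := pselect (B e); last first.
  by rewrite [X in _ * X]/cnt esum1 ?mule0 ?cnt_ge0 // => i /nB.
rewrite (le_trans _ (BA Be)) // -[leRHS]mule1; apply: lee_wpmul2l; first by rewrite lee_fin.
by apply: (@cnt_le_seq R _ _ [:: tt]) => -[].
Qed.

(** By Markov's inequality the probability of [B] is at most the expected number divided by n, for
    every n. *)
Lemma inf_null (I : choiceType) (A : I -> rel V -> Prop) B :
  countable [set: I] -> (forall i, event G (A i)) -> event G B ->
  \esum_(i in [set: I]) Prb (A i) < +oo ->
  almost_surely (fun e => B e -> infinite_set [set i | A i e]) -> almost_surely (fun e => ~ B e).
Proof.
move=> cI MA MB fin inf; apply: (as_null perc MB); change (Prb B = 0).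
set S := \esum_(i in _) _ in fin *.
have S0 : 0 <= S by apply: esum_ge0 => i _; exact: Prb_ge0.
have [r Sr] : exists r, S = r%:E by exists (fine S); rewrite fineK // ge0_fin_numE.
have PB1 := Prb_le1 perc MB.
have [q Pq] : exists q, Prb B = q%:E.
  exists (fine (Prb B)); rewrite fineK // ge0_fin_numE ?Prb_ge0 //.
  by rewrite (le_lt_trans PB1) // ltry.
have q0 : (0 <= q)%R by rewrite -lee_fin -Pq; exact: Prb_ge0.
rewrite Pq; congr (_%:E); apply/eqP; rewrite eq_le q0 andbT leNgt; apply/negP => qgt0.
pose n := (Num.truncn (r / q)).+1.
have := @cnt_esum_ge I A B n cI MA MB _.
rewrite -/S Sr Pq -EFinM lee_fin => H.
have : (r < n%:R * q)%R by rewrite -ltr_pdivrMr //; exact: truncnS_gt.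
rewrite ltNge H //; apply: as_imp inf => e _ h /h inf.
by rewrite cnt_inf // leey.
Qed.

Lemma fin_as (I : choiceType) (A : I -> rel V -> Prop) :
  countable [set: I] -> (forall i, event G (A i)) ->
  \esum_(i in [set: I]) Prb (A i) < +oo ->
  almost_surely (fun e => finite_set [set i | A i e]).
Proof.
move=> cI MA fin.
have := @inf_null I A (fun e => infinite_set [set i | A i e]) cI MA.
move=> H; apply: as_imp (H _ fin _); first by move=> e _ /contrapT.
- exact: event_inf.
- exact: as_adm.
Qed.

Lemma Prb_fin A : event G A -> exists2 q : R, (0 <= q <= 1)%R & Prb A = q%:E.
Proof.
move=> MA; have P1 := Prb_le1 perc MA; have P0 := Prb_ge0 G P w A.
have E : Prb A = (fine (Prb A))%:E.
  by rewrite fineK // ge0_fin_numE // (le_lt_trans P1) // ltry.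
by exists (fine (Prb A)) => //; rewrite -!lee_fin -E P0.
Qed.

(** The index type [J], on which automorphisms act through [g], lets the transported mass be an
    expected number of auxiliary objects, such as the other ends of edges. *)
Lemma transport : exists (K : R) (reps : seq V), (0 <= K)%R /\
  forall (J : choiceType) (g : (V -> V) -> J -> J) (A : V -> V -> J -> rel V -> Prop),
  (forall f, Aut G f -> bijective (g f)) ->
  (forall x y j, event G (A x y j)) ->
  (forall f x y j e, Aut G f -> adm G e ->
     A x y j (pull f e) = A (f x) (f y) (g f j) e) ->
  forall x, \esum_(k in [set: V * J]) Prb (A x k.1 k.2) <=
    K%:E * \sum_(o <- reps) \esum_(k in [set: V * J]) Prb (A k.1 o k.2).
Proof.
have [K K0 Gu] := st_unim st.
have [rep [reps [ureps repP]]] := orbit_reps (st_trans st).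
exists K, reps; split; first exact: ltW.
move=> J g A gb MA eqA x.
have := mass_transport (st_conn st) (st_fin st) K0 Gu ureps repP
  (phi := fun x y => \esum_(j in [set: J]) Prb (A x y j)) x.
rewrite esum_pair; last by move=> *; exact: Prb_ge0.
rewrite esum_sum; last by move=> *; apply: esum_ge0 => *; exact: Prb_ge0.
rewrite (eq_bigr (fun o => \esum_(k in [set: V * J]) Prb (A k.1 o k.2))); last first.
  by move=> o _; rewrite esum_pair // => *; exact: Prb_ge0.
apply; first by move=> *; apply: esum_ge0 => *; exact: Prb_ge0.
move=> f a b Af; rewrite (esum_reindex _ (gb f Af)); apply: eq_esum => j _.
rewrite -[RHS](Prb_aut perc Af (MA _ _ _)).
by apply: Prb_ext => e ea; rewrite eqA.
Qed.

End Setting.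

(** * Finite energy *)

Section FiniteEnergy.
Variables (R : realType) (V : choiceType) (G : graph V).
Variables (d : measure_display) (T : measurableType d) (P : probability T R).
Variables (p : R) (w : T -> set {fset V}).
Hypothesis st : setting G P p w.
Implicit Types (e f : rel V) (A B : rel V -> Prop) (x y z a b u v o : V).
Notation Prb := (Prb G P w).
Notation almost_surely := (almost_surely G P w).

Let perc := st_perc st.
Let Vc := st_count st.

Let p01 : 0 <= p <= 1.
Proof. by case/andP: (st_p st) => ? ?; rewrite !ltW. Qed.

(** Opening is restricted to edges of [G], which keeps configurations admissible. Finite changes
    become lists of toggles, of which there are countably many. *)
Definition toggle (c : bool * (V * V)) e : rel V :=
  if c.1 then (if G c.2.1 c.2.2 then ins e c.2.1 c.2.2 else e)
  else cut e c.2.1 c.2.2.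

Lemma ins_id e x y : symmetric e -> e x y -> ins e x y = e.
Proof.
move=> es exy; apply/funext => s; apply/funext => t; rewrite /ins /=.
have [/orP[/andP[/eqP -> /eqP ->]|/andP[/eqP -> /eqP ->]]|_] :=
  boolP (same_edge x y s t); by rewrite ?orbF // ?(es y) exy.
Qed.

Lemma cut_id e x y : symmetric e -> ~~ e x y -> cut e x y = e.
Proof.
move=> es exy; apply/funext => s; apply/funext => t; rewrite /cut /=.
have [/orP[/andP[/eqP -> /eqP ->]|/andP[/eqP -> /eqP ->]]|_] :=
  boolP (same_edge x y s t); by rewrite ?andbT // ?(es y) (negbTE exy).
Qed.

Lemma event_toggle c A : event G A -> event G (fun e => A (toggle c e)).
Proof.
move=> MA; rewrite /toggle; case: c.1; last exact: event_cut.
by case E: (G c.2.1 c.2.2) => //; exact: event_ins.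
Qed.

Lemma Prb_AS A : event G A -> Prb A = 0%E <-> almost_surely (fun e => ~ A e).
Proof. by move=> MA; split; [exact: (as_null perc MA)|exact: (Prb_as0 perc MA)]. Qed.

Lemma mulE_eq0 (r : R) (a : \bar R) : 0 < r -> (r%:E * a = 0 -> a = 0)%E.
Proof. by move=> r0 /eqP; rewrite mule_eq0 eqe gt_eqF //= => /eqP. Qed.

(** One side of [Prb_ins] vanishes, hence so does the other. To open an edge it is applied to [A],
    to close one it is applied to the preimage of [A] under cutting; the factors p and 1 - p are
    both positive. *)
Lemma as_toggle c A : event G A -> almost_surely (fun e => ~ A e) -> almost_surely (fun e => ~ A (toggle c e)).
Proof.
move=> MA nA; have [p0 p1] := andP (st_p st).
case: c => -[] [x y]; rewrite /toggle /=.
  have [Gxy|//] := boolP (G x y).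
  have := Prb_ins perc Gxy p01 MA.
  have -> : Prb (fun e => e x y /\ A e) = 0%E.
    apply: (Prb_as0 perc); first by event_tac.
    by apply: as_imp nA => e _ nAe [].
  rewrite mule0 => /(mulE_eq0 p0) PI.
  have MI : event G (fun e => ~~ e x y /\ A (ins e x y)).
    by apply: event_and; [event_tac|exact: event_ins].
  apply: as_imp (as_and nA (proj1 (Prb_AS MI) PI)) => e [es _] [nAe nAi] Ai.
  have [exy|nxy] := boolP (e x y); last exact: nAi.
  by apply: nAe; rewrite -(ins_id es exy).
have MC : event G (fun e => A (cut e x y)) by exact: event_cut.
have [Gxy|nG] := boolP (G x y); last first.
  apply: as_imp nA => e [es eG] nAe; rewrite cut_id //.
  by apply: contra nG; exact: eG.
have := Prb_ins perc Gxy p01 MC.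
have -> : Prb (fun e => ~~ e x y /\ A (cut (ins e x y) x y)) = 0%E.
  apply: (Prb_as0 perc); first by apply: event_and; [event_tac|exact: (event_ins _ Gxy MC)].
  by apply: as_imp nA => e [es _] nAe [nxy]; rewrite cut_ins.
rewrite mule0 => /esym /mulE_eq0; rewrite subr_gt0 => /(_ p1) PC.
apply: as_imp (as_and nA (proj1 (Prb_AS (event_and (event_atom G x y) MC)) PC)) => e [es _] [nAe nAi] Ac.
have [exy|nxy] := boolP (e x y); first exact: nAi.
by apply: nAe; rewrite -(cut_id es nxy).
Qed.

(** Every pair at which [e] and [f] differ is set to its state in [f]. *)
Lemma fmod_toggle e f : adm G e -> fmod G e f -> exists l, f = foldr toggle e l.
Proof.
move=> ea [[fs fG] fin]; set D := [set c | _] in fin.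
pose l := [seq (f c.1 c.2, c) | c <- fset_set D]; exists l.
suff H s t : foldr toggle e l s t <> f s t ->
    e s t <> f s t /\ (s, t) \notin (fset_set D : seq _).
  apply/funext => s; apply/funext => t; apply: contrapT => ne.
  have [|ne' /negP[]] := H s t; first by move=> E; apply: ne.
  by rewrite in_fset_set ?inE.
rewrite /l; elim: (fset_set D : seq _) => [|[a b] r IH] //=.
rewrite inE negb_or {1}/toggle /=; set h := foldr toggle e _ in IH *.
case fab : (f a b).
  rewrite (fG _ _ fab) /ins /=.
  have [/orP[/andP[/eqP -> /eqP ->]|/andP[/eqP -> /eqP ->]]|nse] :=
    boolP (same_edge a b s t); rewrite ?orbT ?orbF.
  - by rewrite fab.
  - by rewrite fs fab.
  move=> /IH[? ->]; split=> //; rewrite andbT; apply: contra nse => /eqP[-> ->].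
  by rewrite /same_edge /= !eqxx.
rewrite /cut /=.
have [/orP[/andP[/eqP -> /eqP ->]|/andP[/eqP -> /eqP ->]]|nse] :=
  boolP (same_edge a b s t); rewrite ?andbT ?andbF.
- by rewrite fab.
- by rewrite fs fab.
move=> /IH[? ->]; split=> //; rewrite andbT; apply: contra nse => /eqP[-> ->].
by rewrite /same_edge /= !eqxx.
Qed.

Lemma finite_energy A : event G A -> almost_surely (fun e => ~ A e) ->
  almost_surely (fun e => forall f, fmod G e f -> ~ A f).
Proof.
move=> MA nA; have cl : countable [set: seq (bool * (V * V))].
  by apply: countable_seq; apply: countable_pair; [exact: countableP|countable_tac].
have H l : almost_surely (fun e => ~ A (foldr toggle e l)).
  elim: l A MA nA => //= c l IH A MA nA.
  by apply: (IH (fun e => A (toggle c e))); [exact: event_toggle|exact: as_toggle].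
apply: as_imp (as_all cl H) => e ea nAl f /(fmod_toggle ea)[l ->]; exact: nAl.
Qed.

End FiniteEnergy.

(** * Edges between clusters at a given level *)

Section Vanishing.
Variable R : realType.
Implicit Types f g : nat -> R.

(** For nonnegative sequences this is convergence to 0. *)
Definition vanishing f := forall eps : R, 0 < eps -> exists N, forall n, (N <= n)%N -> f n <= eps.

Lemma vanishing_sum (I : Type) (r : seq I) (F : I -> nat -> R) :
  (forall i, vanishing (F i)) -> vanishing (fun n => \sum_(i <- r) F i n).
Proof.
move=> HF; elim: r => [|i r IH] eps e0.
  by exists 0%N => n _; rewrite big_nil ltW.
have e2 : 0 < eps / 2 by rewrite divr_gt0.
have [N1 H1] := HF i _ e2; have [N2 H2] := IH _ e2.
exists (maxn N1 N2) => n; rewrite geq_max => /andP[n1 n2].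
by rewrite big_cons [leRHS]splitr lerD ?H1 ?H2.
Qed.

Lemma vanishing_scale f (c : R) : 0 <= c -> vanishing f -> vanishing (fun n => c * f n).
Proof.
move=> c0 vf eps e0; have c1 : 0 < c + 1 by rewrite ltr_wpDl.
have [N HN] := vf (eps / (c + 1)) (divr_gt0 e0 c1).
exists N => n /HN le; apply: (@le_trans _ _ (c * (eps / (c + 1)))).
  exact: ler_wpM2l.
rewrite mulrCA ger_pMr // ler_pdivrMr // mul1r.
by rewrite lerDl.
Qed.

(** The first M terms have a fixed sum, which eps n / 2 exceeds for large n; every later term is at
    most eps / 2. *)
Lemma vanishing_cesaro f : (forall n, 0 <= f n) -> vanishing f ->
  forall eps : R, 0 < eps -> exists N, forall n, (N <= n)%N ->
    \sum_(0 <= i < n) f i <= eps * n%:R.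
Proof.
move=> f0 vf eps e0; have e2 : 0 < eps / 2 by rewrite divr_gt0.
have [M HM] := vf _ e2; set C := \sum_(0 <= i < M) f i.
exists (maxn M (Num.truncn (C / (eps / 2))).+1) => n; rewrite geq_max => /andP[Mn nC].
rewrite (big_cat_nat (n := M)) //= -/C [X in X * _]splitr mulrDl; apply: lerD.
  rewrite -ler_pdivrMl // mulrC; apply: ltW; apply: lt_le_trans (truncnS_gt _) _.
  by rewrite ler_nat.
apply: (@le_trans _ _ (\sum_(M <= i < n) (eps / 2))).
  by rewrite big_nat [leRHS]big_nat; apply: ler_sum => i /andP[Mi _]; exact: HM.
rewrite sumr_const_nat -[leLHS]mulr_natr; apply: ler_wpM2l; first exact: ltW.
by rewrite ler_nat leq_subr.
Qed.

End Vanishing.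

Section Sigma.
Variables (R : realType) (V : choiceType) (G : graph V).
Variables (d : measure_display) (T : measurableType d) (P : probability T R).
Variables (p : R) (w : T -> set {fset V}).
Hypothesis st : setting G P p w.
Implicit Types (e : rel V) (A B : rel V -> Prop) (x y z a b u v o : V).
Notation Prb := (Prb G P w).
Notation almost_surely := (almost_surely G P w).

Let perc := st_perc st.
Let Vc := st_count st.

Definition rprob A : R := fine (Prb A).

Lemma rprobE A : event G A -> Prb A = (rprob A)%:E.
Proof. by move=> MA; have [q _ E] := Prb_fin st MA; rewrite /rprob E. Qed.

Lemma rprob_ge0 A : 0 <= rprob A.
Proof. by apply: fine_ge0; exact: Prb_ge0. Qed.

Lemma rprob_vanishing (A : nat -> rel V -> Prop) : (forall n, event G (A n)) ->
  (forall m n e, (m <= n)%N -> A n e -> A m e) ->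
  almost_surely (fun e => exists n, ~ A n e) -> vanishing (fun n => rprob (A n)).
Proof.
move=> MA dec H eps e0; pose F n := [set t | A n (opn G w t)].
have mF n : measurable (F n) := measurable_event perc (MA n).
have MC : event G (fun e => forall n, A n e) by event_tac.
have E : \bigcap_n F n = [set t | forall n, A n (opn G w t)].
  by apply/seteqP; split=> t h n; [exact: h|move=> _; exact: h].
have mC : measurable (\bigcap_n F n) by rewrite E; exact: (measurable_event perc MC).
have cvg : (P \o F) @ \oo --> P (\bigcap_n F n).
  apply: nonincreasing_cvg_mu => //.
    by rewrite (le_lt_trans (probability_le1 _ _)) ?ltry.
  by move=> m n mn; apply/subsetPset => t; exact: dec.
have P0 : P (\bigcap_n F n) = 0%E.
  rewrite E; apply: (Prb_as0 perc MC).
  by apply: as_imp H => e _ [n nA] h; exact: nA.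
rewrite P0 in cvg; have /fine_cvgP[_ /cvgrPdist_le/(_ eps e0)[N _ HN]] := cvg.
exists N => n Nn; have := HN n Nn.
by rewrite sub0r normrN ger0_norm //; exact: rprob_ge0.
Qed.

Definition Psi n e x y u v := G x y /\ G u v /\ ~ linked e x y /\ linked e x u /\
  linked e y v /\ (u, v) <> (x, y) /\ lev e x u = n.

Definition Phi n e x y u v := G x y /\ G u v /\ (u, v) <> (x, y) /\
  Bd e u v (x, y) /\ lev e u x = n.

(* Opening the closed edge x y makes it the unique bridge between u and v at
   level n from u. *)
Lemma Psi_Phi n e x y u v : adm G e -> Psi n e x y u v ->
  ~~ e x y /\ Phi n (ins e x y) x y u v.
Proof.
move=> [es eG] [Gxy [Guv [nxy [xu [yv [ne lxu]]]]]].
have nexy : ~~ e x y by apply/negP => /linked_step.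
have es' : symmetric (ins e x y) by exact: sym_ins.
have E : cut (ins e x y) x y = e by exact: cut_ins.
have br : bridge (ins e x y) x y.
  split; first by rewrite /ins /= /same_edge /= !eqxx orbT.
  by rewrite /far E => /(linked_sym es).
have fu : far (ins e x y) y x u by rewrite /far cutC E.
split=> //; split=> //; split=> //; split=> //; split.
  by split=> //=; rewrite /far E.
by rewrite levC // -(lev_cut es' br fu) E.
Qed.

Lemma event_Psi n x y u v : event G (fun e => Psi n e x y u v).
Proof. by rewrite /Psi; event_tac. Qed.

Lemma event_Phi n x y u v : event G (fun e => Phi n e x y u v).
Proof. by rewrite /Phi; event_tac. Qed.

Lemma Phi_pull n f e x y u v : Aut G f -> adm G e ->
  Phi n (pull f e) x y u v = Phi n e (f x) (f y) (f u) (f v).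
Proof.
move=> Af [es _]; rewrite /Phi (Bd_pull Af) (lev_pull Af) // -!(adj_pull Af).
congr (_ /\ _); congr (_ /\ _); congr (_ /\ _); congr not.
by rewrite propeqE; have [fi _ _] := AutP Af; split=> [[-> ->]//|[/fi -> /fi ->]].
Qed.

Definition nbr x : {fset V} := fset_set [set y | G x y].

Lemma nbrP x y : (y \in nbr x) = G x y.
Proof.
by rewrite in_fset_set; [apply/idP/idP; rewrite inE|exact: (st_fin st)].
Qed.

Local Open Scope ereal_scope.

Lemma esum_fset_supp (I : choiceType) (F : I -> \bar R) (D : {fset I}) : (forall i, 0 <= F i) ->
  (forall i, i \notin D -> F i = 0) ->
  \esum_(i in [set: I]) F i = \sum_(i <- D) F i.
Proof.
move=> F0 Fn; rewrite (eq_esum (b := fun i => if i \in [set` D] then F i else 0)).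
  rewrite -esum_mkcond esum_fset //.
  by rewrite fsbig_finite // set_fsetK.
move=> i _; case: ifPn => //; rewrite notin_setE /= => /negP; exact: Fn.
Qed.

Lemma sigma : exists s : nat -> R, [/\ forall n, (0 <= s n)%R, vanishing s &
  forall n x, \esum_(k in [set: V * (V * V)])
    Prb (fun e => Psi n e x k.2.1 k.1 k.2.2) <= (s n)%:E].
Proof.
have [K [reps [K0 tr]]] := transport st.
have [p0 p1] := andP (st_p st).
have p01 : (0 <= p <= 1)%R by rewrite !ltW.
have c0 : (0 <= (1 - p) / p)%R by rewrite divr_ge0 ?subr_ge0 // ltW.
(* Only under this event does the edge [o v] receive mass for level n; as n grows, it decreases to
   the empty event. *)
pose L n o v e := (n < lev e o v)%N.
have ML n o v : event G (fun e => L n o v e).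
  apply: (@event_ext _ _ (fun e => ~ (lev e o v < n.+1)%N)); last by event_tac.
  by move=> e _; rewrite /L (ltnNge n) -(ltnS _ n); exact: (rwP negP).
have vL o v : vanishing (fun n => rprob (fun e => L n o v e)).
  apply: rprob_vanishing => //; first by move=> m n e mn; exact: leq_ltn_trans.
  by apply: as_adm => e _; exists (lev e o v); rewrite /L ltnn.
pose s n := ((1 - p) / p * (K * \sum_(o <- reps) \sum_(v <- nbr o) rprob (fun e => L n o v e)))%R.
exists s; split.
- move=> n; rewrite mulr_ge0 // mulr_ge0 //; apply: sumr_ge0 => o _.
  by apply: sumr_ge0 => v _; exact: rprob_ge0.
- apply: vanishing_scale => //; apply: vanishing_scale => //.
  by apply: vanishing_sum => o; exact: vanishing_sum.
move=> n x.
apply: (@le_trans _ _ (\esum_(k in [set: V * (V * V)])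
    (((1 - p) / p)%:E * Prb (fun e => Phi n e x k.2.1 k.1 k.2.2)))).
  apply: le_esum => -[u [y v]] _ /=.
  have [Gxy|nG] := boolP (G x y); last first.
    rewrite (_ : Prb _ = 0); first by rewrite mule_ge0 ?lee_fin // Prb_ge0.
    apply: (Prb_as0 perc); first exact: event_Psi.
    by apply: as_adm => e _ [Gxy]; rewrite Gxy in nG.
  have MP := event_Phi n x y u v.
  have E := Prb_ins perc Gxy p01 MP.
  have MI : event G (fun e => ~~ e x y /\ Phi n (ins e x y) x y u v).
    by apply: event_and; [event_tac|exact: (event_ins _ Gxy MP)].
  have MA : event G (fun e => e x y /\ Phi n e x y u v).
    by apply: event_and; [event_tac|].
  apply: (@le_trans _ _ (Prb (fun e => ~~ e x y /\ Phi n (ins e x y) x y u v))).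
    apply: (le_Prb perc) => //; first exact: event_Psi.
    by apply: as_adm => e ea; exact: Psi_Phi.
  apply: (@le_trans _ _ (((1 - p) / p)%:E * Prb (fun e => e x y /\ Phi n e x y u v))).
    move: E; rewrite (rprobE MI) (rprobE MA) -!EFinM => -[E]; rewrite lee_fin.
    by rewrite mulrAC ler_pdivlMr // mulrC E.
  apply: lee_wpmul2l; first by rewrite lee_fin.
  by apply: (le_Prb perc) => //; apply: as_adm => e _ [].
apply: (le_trans (esumZl_le c0 _)); first by move=> k; exact: Prb_ge0.
rewrite /s [leRHS]EFinM; apply: lee_wpmul2l; first by rewrite lee_fin.
have := tr (V * V)%type (fun f => pair_map f)
  (fun x u c e => Phi n e x c.1 u c.2) _ _ _ x.
move=> H; apply: le_trans (H _ _ _) _.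
- by move=> f Af; exact: (pair_map_bij Af).
- by move=> *; exact: event_Phi.
- by move=> f a b c e Af ea; rewrite Phi_pull.
rewrite [leRHS]EFinM; apply: lee_wpmul2l; first by rewrite lee_fin.
rewrite -sumEFin; apply: lee_sum => o _.
have MB v : event G (fun e => G o v /\ L n o v e) by apply: event_and; [event_tac|exact: ML].
have cJ : countable [set: V * (V * V)] by countable_tac.
have := @esum_Prb_le _ _ _ _ _ _ _ _ perc (V * (V * V))%type V
  (fun k e => Phi n e k.1 k.2.1 o k.2.2) (fun v e => G o v /\ L n o v e)
  1 1 0 cJ Vc (fun k => event_Phi _ _ _ _ _) MB ler01 ler01 (lexx _).
rewrite !mul1e adde0 => H'; apply: le_trans (H' _) _.
  apply: as_adm => e [es eG]; rewrite !mul1e adde0.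
  (* For given [o] and [v] the separating bridge of level n is unique by [lev_inj], so [v] alone
     determines who sends the mass. *)
  apply: (@cnt_inj R _ _ (fun k : V * (V * V) => k.2.2)).
    move=> [a [b v]] [a' [b' v']]; rewrite !inE /= => -[_ [_ [_ [B1 l1]]]] [_ [_ [_ [B2 l2]]]] E.
    rewrite -E in B2 *; have := lev_inj es B1 B2.
    by rewrite /= l1 l2 => /(_ erefl)[-> ->].
  move=> [a [b v]] /= [_ [Gov [_ [B1 l1]]]]; split=> //.
  by rewrite /L -l1; have := lev_lt es B1.
rewrite (esum_fset_supp (D := nbr o)).
- rewrite -sumEFin; apply: lee_sum => v _; rewrite -(rprobE (ML _ _ _)).
  by apply: (le_Prb perc) => //; apply: as_adm => e _ [].
- by move=> v; exact: Prb_ge0.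
- move=> v; rewrite nbrP => nG; apply: (Prb_as0 perc) => //.
  by apply: as_adm => e _ [Gov]; rewrite Gov in nG.
Qed.

End Sigma.

Section Fiber.
Variable R : realType.
Local Open Scope ereal_scope.

Lemma cnt_split (I J : choiceType) (f : I -> J) (S : set I) :
  cnt R S = \esum_(j in [set: J]) cnt R [set i | S i /\ f i = j].
Proof.
transitivity (\esum_(i in [set: I]) \esum_(j in [set: J])
   (if i \in [set i | S i /\ f i = j] then 1 else 0 : \bar R)).
  rewrite /cnt esum_mkcond; apply: eq_esum => i _; case: ifPn.
    rewrite inE => Si; rewrite -[LHS](@esum_set1 R J (f i) (fun=> 1)) // esum_mkcond.
    apply: eq_esum => j _; congr (if _ then _ else _).
    by apply/idP/idP; rewrite !inE /=; [move=> ->|move=> [_ ->]].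
  rewrite notin_setE => nS; rewrite esum1 // => j _; case: ifPn => //.
  by rewrite inE => -[].
rewrite esum_swap; last by move=> i j; case: ifP.
by apply: eq_esum => j _; rewrite -esum_mkcond.
Qed.

Lemma cnt_fiber (I J : choiceType) (f : I -> J) (S : set I) (S' : set J) (n : nat) :
  (forall i, S i -> S' (f i)) ->
  (forall j, S' j -> cnt R [set i | S i /\ f i = j] <= n%:R%:E) ->
  cnt R S <= n%:R%:E * cnt R S'.
Proof.
move=> SS' H; rewrite (cnt_split f) [X in _ * X]/cnt [X in _ * X]esum_mkcond.
apply: (le_trans _ (esumZl_le (ler0n R n) _)); last by move=> j; case: ifP.
apply: le_esum => j _.
case: ifPn => [|]; first by rewrite inE mule1 => /H.
rewrite notin_setE mule0 => nj; rewrite (_ : [set i | _] = set0) /cnt ?esum_set0 //.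
by apply/seteqP; split=> // i [/SS' ? E]; apply: nj; rewrite -E.
Qed.

End Fiber.

(** * The edges between two clusters, sorted by level *)

Section Nearby.
Variables (R : realType) (V : choiceType) (G : graph V).
Variables (d : measure_display) (T : measurableType d) (P : probability T R).
Variables (p : R) (w : T -> set {fset V}).
Hypothesis st : setting G P p w.
Implicit Types (e : rel V) (A B : rel V -> Prop) (x y z a b u v o : V).
Notation Prb := (Prb G P w).
Notation almost_surely := (almost_surely G P w).

Let perc := st_perc st.
Let Vc := st_count st.

Definition pairs e x y : set (V * V) :=
  [set c | [/\ G c.1 c.2, linked e x c.1 & linked e y c.2]].

(** By [sigma] the expected number of these edges at each level is finite. The pair [(x, y)] is
    added by hand because [Psi] omits it. *)
Lemma near_finite : almost_surely (fun e => forall x y, G x y -> ~ linked e x y ->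
  forall N, finite_set [set c | pairs e x y c /\ (lev e x c.1 < N)%N]).
Proof.
have [s [s0 vs Hs]] := sigma st.
have cI : countable [set: V * (V * V)] by countable_tac.
have cJ : countable [set: nat * V] by countable_tac.
have H (c : nat * V) : almost_surely (fun e => finite_set
    [set k : V * (V * V) | Psi G c.1 e c.2 k.2.1 k.1 k.2.2]).
  apply: (fin_as st) => //; first by move=> k; exact: (event_Psi st).
  exact: le_lt_trans (Hs c.1 c.2) (ltry _).
apply: as_imp (as_all cJ H) => e _ fin x y Gxy nxy N.
apply: (@sub_finite_set _ _ ([set (x, y)] `|` \bigcup_(n in `I_N)
  ((fun k : V * (V * V) => (k.1, k.2.2)) @` [set k | Psi G n e x k.2.1 k.1 k.2.2]))).
  move=> [u v] /= [[/= Guv xu yv] lt].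
  have [->|ne] := pselect ((u, v) = (x, y)); [by left|right].
  by exists (lev e x u) => //; exists (u, (y, v)).
rewrite finite_setU; split=> //; apply: bigcup_finite => // n _.
by apply: finite_image; exact: (fin (n, x)).
Qed.

(** The expected number of edges in a block of L consecutive levels is a sum of L values of [s],
    which is small for high blocks. So almost surely some block is empty. *)
Lemma level_gap : almost_surely (fun e => forall x y L, G x y -> ~ linked e x y ->
  exists n, forall c, pairs e x y c -> (lev e x c.1 <= n)%N \/ (n + L < lev e x c.1)%N).
Proof.
have [s [s0 vs Hs]] := sigma st.
pose B (k : V * V * nat) e := forall n, exists (i : 'I_k.2) (u v : V),
  Psi G (n.+1 + i) e k.1.1 k.1.2 u v.
have MB k : event G (B k).
  rewrite /B; event_tac; exact: (event_Psi st).
have cI : countable [set: V * V * nat] by countable_tac.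
have H k : almost_surely (fun e => ~ B k e).
  apply: (as_null perc (MB k)); change (Prb (B k) = 0%E).
  move: k (MB k) => [[x y] L] MBk.
  have [q /andP[q0 _] Eq] := Prb_fin st MBk; rewrite Eq; congr (_%:E).
  apply/eqP; rewrite eq_le q0 andbT; apply/ler_addgt0Pl => eps e0; rewrite addr0.
  (* The divisor is [L.+1] because L may be 0. *)
  have [N HN] := vs (eps / L.+1%:R) (divr_gt0 e0 (ltr0Sn _ _)).
  have cJ : countable [set: 'I_L * (V * (V * V))] by apply: countable_pair; countable_tac.
  have := @cnt_esum_ge _ _ _ _ _ _ _ _ st ('I_L * (V * (V * V)))%type
    (fun i e => Psi G (N.+1 + i.1) e x i.2.2.1 i.2.1 i.2.2.2) (B (x, y, L)) 1 cJ
    (fun i => event_Psi st _ _ _ _ _) MBk.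
  rewrite mul1e Eq => H; rewrite -lee_fin; apply: le_trans (H _) _.
    apply: as_adm => e _ Be; have [i [u [v Pi]]] := Be N.
    by apply: (@cnt_ge_seq R _ _ [:: (i, (u, (y, v)))]) => // j; rewrite inE => /eqP ->.
  rewrite -(esum_pair (a := fun (i : 'I_L) j => Prb (fun e => Psi G (N.+1 + i) e x j.2.1 j.1 j.2.2)));
    last by move=> *; exact: Prb_ge0.
  apply: (@le_trans _ _ (\esum_(i in [set: 'I_L]) (eps / L.+1%:R)%:E)%E).
    apply: le_esum => i _; apply: le_trans (Hs _ _) _; rewrite lee_fin; apply: HN.
    by rewrite addSn ltnW // ltnS leq_addr.
  apply: le_trans (esum_const_le (s := enum 'I_L) _ _) _.
  - by rewrite lee_fin divr_ge0 // ltW.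
  - by move=> i _; rewrite mem_enum.
  rewrite size_enum_ord -EFinM lee_fin mulrCA ger_pMr // ler_pdivrMr // mul1r.
  by rewrite ler_nat.
apply: as_imp (as_all cI H) => e ea nB x y L Gxy nxy.
have /existsNP[n Hn] := nB (x, y, L).
exists n => -[u v] [/= Guv xu yv].
have [|lt] := leqP (lev e x u) n; [by left|right].
rewrite ltnNge; apply/negP => le; apply: Hn.
have iL : (lev e x u - n.+1 < L)%N.
  by rewrite ltn_subLR // addSn ltnS.
exists (Ordinal iL), u, v; rewrite /= subnKC //; split=> //; split=> //; split=> //.
split=> //; split=> //; split=> // -[E _].
by move: lt; rewrite E levxx //; exact: (proj1 ea).
Qed.

Lemma esum_fset_le (I : choiceType) (A : I -> rel V -> Prop) (f : I -> V)
    (B : V -> rel V -> Prop) (D : {fset V}) (n : nat) :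
  countable [set: I] -> (forall i, event G (A i)) -> (forall v, event G (B v)) ->
  almost_surely (fun e => (forall i, A i e -> f i \in D /\ B (f i) e) /\
    forall v, v \in D -> B v e -> (cnt R [set i | A i e /\ f i = v] <= n%:R%:E)%E) ->
  (\esum_(i in [set: I]) Prb (A i) <= n%:R%:E * \sum_(v <- D) Prb (B v))%E.
Proof.
move=> cI MA MB H.
have MC v : event G (fun e => v \in D /\ B v e) by apply: event_and; [event_tac|].
have := @esum_Prb_le _ _ _ _ _ _ _ _ perc I V A (fun v e => v \in D /\ B v e)
  1 n%:R 0 cI Vc MA MC ler01 (ler0n _ _) (lexx _).
rewrite mul1e adde0 => H'; apply: le_trans (H' _) _.
  apply: as_imp H => e _ [AB bd]; rewrite mul1e adde0.
  by apply: (cnt_fiber (f := f)) => // v [/bd].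
rewrite (esum_fset_supp (D := D)).
- apply: lee_wpmul2l; first by rewrite lee_fin.
  apply: lee_sum => v _; apply: (le_Prb perc) => //.
  by apply: as_adm => e _ [].
- by move=> v; exact: Prb_ge0.
- move=> v nG; apply: (Prb_as0 perc) => //.
  by apply: as_adm => e _ [Dv]; rewrite Dv in nG.
Qed.

Lemma fset_sum_lty (F : V -> rel V -> Prop) (n : nat) (D : {fset V}) : (forall v, event G (F v)) ->
  (n%:R%:E * \sum_(v <- D) Prb (F v) < +oo)%E.
Proof.
move=> MF; rewrite (eq_bigr (fun v => (rprob G P w (F v))%:E)).
  by rewrite sumEFin -EFinM ltry.
by move=> v _; rewrite -(rprobE st).
Qed.

(* Each chosen edge sends unit mass to every edge joining the same two clusters:
   finitely many chosen edges would send infinite mass, although no edge receives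
   more than their number. *)
Lemma no_finite_class (M : V -> V -> rel V -> Prop) :
  (forall x y, event G (M x y)) ->
  (forall f e x y, Aut G f -> adm G e -> M x y (pull f e) = M (f x) (f y) e) ->
  (forall x y e, M x y e -> mark G e x y) ->
  almost_surely (fun e => forall x y, M x y e ->
    infinite_set [set c | pairs e x y c /\ M c.1 c.2 e]).
Proof.
move=> MM eqM markM.
have [K [reps [K0 tr]]] := transport st.
(* Fixing a bound j on the random size of the class makes the bound on the received mass
   deterministic. *)
pose few j x y e := exists s : seq (V * V), (size s <= j)%N /\
  forall c, [/\ G c.1 c.2, linked e x c.1 & linked e y c.2] /\ M c.1 c.2 e -> c \in s.
have Mfew j x y : event G (few j x y).
  by rewrite /few; event_tac.
have few_pull j f x y e : Aut G f -> adm G e -> few j x y (pull f e) = few j (f x) (f y) e.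
  move=> Af ea; have [g Ag [fK gK]] : exists2 g, Aut G g & cancel f g /\ cancel g f.
    by have [g []] := Aut_inv Af; exists g.
  rewrite propeqE; split=> -[s [ss Hs]].
    exists (map (pair_map f) s); rewrite size_map; split=> // -[a b] /= [[Gab xa yb] Mab].
    apply/mapP; exists (g a, g b); last by rewrite /pair_map /= !gK.
    apply: Hs; rewrite /= eqM // !(linked_pull Af) !gK; split=> //; split=> //.
    by rewrite (adj_pull Af) !gK.
  exists (map (pair_map g) s); rewrite size_map; split=> // -[a b] /=.
  rewrite eqM // !(linked_pull Af) (adj_pull Af) => h.
  by apply/mapP; exists (f a, f b); [exact: (Hs (f a, f b))|rewrite /pair_map /= !fK].
have null (k : nat * (V * V)) : almost_surely (fun e => ~ (M k.2.1 k.2.2 e /\ few k.1 k.2.1 k.2.2 e)).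
  move: k => [j [x y]] /=.
  pose A x u (c : V * V) e := M x c.1 e /\ few j x c.1 e /\
    [/\ G u c.2, linked e x u & linked e c.1 c.2].
  have MA a b c : event G (A a b c) by rewrite /A; apply: event_and => //; event_tac.
  have cI : countable [set: V * (V * V)] by countable_tac.
  apply: (@inf_null _ _ _ _ _ _ _ _ st (V * (V * V))%type (fun k => A x k.1 k.2)) => //.
  - exact: (event_and (MM x y) (Mfew j x y)).
  - apply: le_lt_trans (tr (V * V)%type (fun f => pair_map f) A _ MA _ x) _.
    + by move=> f Af; exact: (pair_map_bij Af).
    + move=> f a b c e Af ea; rewrite /A eqM // few_pull // !(linked_pull Af).
      by rewrite -(adj_pull Af).
    have lt o : (\esum_(k in [set: V * (V * V)]) Prb (A k.1 o k.2) < +oo)%E.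
      have MT (v : V) : event G (fun=> True) by event_tac.
      apply: le_lt_trans (fset_sum_lty j (nbr G o) MT).
      apply: (@esum_fset_le _ _ (fun k => k.2.2)) => //.
      apply: as_adm => e [es eG]; split.
        by move=> [a [b v]] [_ [_ [/= Gov _ _]]]; rewrite (nbrP st).
      move=> v; rewrite (nbrP st) => Gov _.
      have [[a0 [b0 A0]]|no] := pselect (exists a b, A a o (b, v) e); last first.
        rewrite /cnt esum1 ?lee_fin // => -[a [b v']] [/= Ak vv].
        by case: no; exists a, b; rewrite -vv.
      have [Mab [[s [sj Hs]] [/= _ ao bv]]] := A0.
      apply: (@le_trans _ _ (size [seq (c.1, (c.2, v)) | c <- s])%:R%:E); last first.
        by rewrite size_map lee_fin ler_nat.
      apply: cnt_le_seq => -[a [b v']] [/= Ak vv]; rewrite vv in Ak *.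
      apply/mapP; exists (a, b) => //; apply: Hs => /=.
      move: Ak => [Mk [_ [/= _ ao' bv']]]; split=> //; split.
      - by have [] := markM _ _ _ Mk.
      - by apply: linked_trans ao _; exact: linked_sym.
      - by apply: linked_trans bv _; exact: linked_sym.
    apply: (@le_lt_trans _ _ (K%:E * \sum_(o <- reps)
       (fine (\esum_(k in [set: V * (V * V)]) Prb (A k.1 o k.2)))%:E)%E).
      apply: lee_wpmul2l; first by rewrite lee_fin.
      apply: lee_sum => o _; rewrite fineK // ge0_fin_numE //.
      by apply: esum_ge0 => k _; exact: Prb_ge0.
    by rewrite sumEFin -EFinM ltry.
  - apply: as_adm => e [es eG] [Mxy fxy] fin.
    have [_ _ []] := markM _ _ _ Mxy.
    apply: (sub_finite_set _ (finite_image (fun k : V * (V * V) => (k.1, k.2.2)) fin)).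
    by move=> [u v] /= h; exists (u, (y, v)).
have cI : countable [set: nat * (V * V)] by countable_tac.
apply: as_imp (as_all cI null) => e _ no x y Mxy fin.
apply: (no (#|` fset_set [set c | pairs e x y c /\ M c.1 c.2 e]|, (x, y))) => /=.
split=> //; exists (fset_set [set c | pairs e x y c /\ M c.1 c.2 e]); split=> // c h.
by rewrite in_fset_set ?inE.
Qed.

Lemma event_ecc_lt x y n : event G (fun e => ecc_lt G e x y n).
Proof. by rewrite /ecc_lt; event_tac. Qed.

Lemma ecc_lt_pull f e x y n : Aut G f -> adm G e ->
  ecc_lt G (pull f e) x y n = ecc_lt G e (f x) (f y) n.
Proof.
move=> Af [es _]; apply: (all_pull Af) => a; apply: (all_pull Af) => b.
by rewrite (out_pull Af) (lev_pull Af).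
Qed.

(* Otherwise the marks of minimal eccentricity in a pair of clusters would form
   an invariant set, which is finite by [lev_le_ecc] and [near_finite]. *)
Lemma mark_far : almost_surely (fun e => forall x y, mark G e x y -> forall n,
  exists a b, out G e x y a b /\ (n <= lev e x a)%N).
Proof.
pose M x y e := mark G e x y /\ exists n, ecc_lt G e x y n /\
  forall u v, G u v -> linked e x u -> linked e y v -> forall m,
    ~ ((m < n)%N /\ ecc_lt G e u v m).
have MM x y : event G (M x y) by rewrite /M; event_tac; exact: event_ecc_lt.
have eqM f e x y : Aut G f -> adm G e -> M x y (pull f e) = M (f x) (f y) e.
  move=> Af ea; rewrite /M (mark_pull Af); congr (_ /\ _).
  have E m a b : ecc_lt G (pull f e) a b m = ecc_lt G e (f a) (f b) m by exact: ecc_lt_pull.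
  have [g [Ag fK gK]] := Aut_inv Af.
  rewrite propeqE; split=> -[n [en H]]; exists n.
    split; first by move: en; rewrite E.
    move=> u v; have := H (g u) (g v); rewrite !(linked_pull Af) (adj_pull Af) !gK.
    by move=> H' Guv xu yv m; have := H' Guv xu yv m; rewrite E !gK.
  split; first by rewrite E.
  move=> u v; have := H (f u) (f v); rewrite !(linked_pull Af) -(adj_pull Af).
  by move=> H' Guv xu yv m; rewrite E; exact: H'.
have markM x y e : M x y e -> mark G e x y by case.
apply: as_imp (as_and near_finite (no_finite_class MM eqM markM)) => e ea [nf inf].
have [es eG] := ea.
(* By minimality all members of the class share the same least n, so [lev_le_ecc] keeps them at
   level at most 2 n from [x]. *)
have noM x y : ~ M x y e.
  move=> Mxy; have := inf _ _ Mxy; apply.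
  have [[Gxy nxy ti] [n [en Hn]]] := Mxy.
  apply: (sub_finite_set _ (nf x y Gxy nxy n.*2.+1)) => -[u v] [/= h [muv [m [em Hm]]]].
  have [/= Guv xu yv] := h; split=> //=; rewrite ltnS.
  apply: (lev_le_ecc ea (And3 Gxy nxy ti) xu yv en).
  suff -> : n = m by [].
  apply/eqP; rewrite eqn_leq; apply/andP; split; rewrite leqNgt; apply/negP => lt.
    exact: (Hn u v Guv xu yv m).
  by apply: (Hm x y Gxy (linked_sym es xu) (linked_sym es yv) n).
move=> x y mxy n; apply: contrapT => no.
have [Gxy nxy ti] := mxy.
(* If the [out] bridges of [(x, y)] stay below level n, the least bound in this pair of clusters
   exists, and a mark that attains it belongs to [M]. *)
pose Q k := `[< exists u v, [/\ G u v, linked e x u & linked e y v] /\ ecc_lt G e u v k >].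
have exQ : exists k, Q k.
  exists n; apply/asboolP; exists x, y; split; first by split=> //; exact: linked_refl.
  move=> a b o; rewrite ltnNge; apply/negP => le; apply: no; by exists a, b.
case: (ex_minnP exQ) => k /asboolP[u [v [[Guv xu yv] ek]]] mink.
apply: (noM u v); split.
  split=> //.
    move=> uv; apply: nxy; apply: linked_trans xu _; apply: linked_trans uv _.
    exact: linked_sym.
  by apply: touch_inf_sub ti => s; [apply: linked_trans (linked_sym es xu)|
    apply: linked_trans (linked_sym es yv)].
exists k; split=> // u' v' Guv' uu' vv' m [mk em].
have : Q m.
  apply/asboolP; exists u', v'; split=> //; split=> //.
    exact: linked_trans uu'.
  exact: linked_trans vv'.
by move=> /mink; rewrite leqNgt mk.
Qed.

End Nearby.

(** * Trivertices *)

Section Nodes.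
Variables (R : realType) (V : choiceType) (G : graph V).
Variables (d : measure_display) (T : measurableType d) (P : probability T R).
Variables (p : R) (w : T -> set {fset V}).
Hypothesis st : setting G P p w.
Implicit Types (e : rel V) (A B : rel V -> Prop) (x y z a b u v o : V).
Notation Prb := (Prb G P w).
Notation almost_surely := (almost_surely G P w).

Let perc := st_perc st.
Let Vc := st_count st.

(** A trivertex that reaches its touched cluster after an open walk of fixed length r. Then [u] lies
    in a fixed finite ball around [y], and the levels of touching edges control the position of
    [y]. *)
Definition node (r : nat) y u e := trivertex G e y u /\ exists z, walk e r y z /\ G z u.

Definition cluster_node r y u e := exists u', linked e u u' /\ node r y u' e.

Lemma event_node r y u : event G (node r y u).
Proof. by rewrite /node; event_tac. Qed.

Lemma event_cluster_node r y u : event G (cluster_node r y u).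
Proof. by rewrite /cluster_node; event_tac; exact: event_node. Qed.

Lemma trivertex_pull f e y u : Aut G f -> trivertex G (pull f e) y u = trivertex G e (f y) (f u).
Proof.
move=> Af; rewrite /trivertex (linked_pull Af); congr (_ /\ _).
have [g [Ag fK gK]] := Aut_inv Af.
have fb : bijective (fun h : 'I_3 -> V => f \o h).
  by exists (fun h => g \o h) => h; apply/funext => i /=; rewrite ?fK ?gK.
apply: (ex_bij fb) => h; congr (_ /\ _).
  rewrite propeqE; split=> H i; have := H i.
    by rewrite (linked_pull Af) (delv_pull Af) (touch_inf_pull Af).
  by rewrite (linked_pull Af) (delv_pull Af) (touch_inf_pull Af).
rewrite propeqE; split=> H i j ij; have := H i j ij.
  by rewrite (delv_pull Af) (linked_pull Af).
by rewrite (delv_pull Af) (linked_pull Af).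
Qed.

Lemma node_pull r f e y u : Aut G f -> node r y u (pull f e) = node r (f y) (f u) e.
Proof.
move=> Af; rewrite /node trivertex_pull //; congr (_ /\ _).
by apply: (ex_pull Af) => z; rewrite (walk_pull Af) -(adj_pull Af).
Qed.

Lemma cluster_node_pull r f e y u : Aut G f -> cluster_node r y u (pull f e) = cluster_node r (f y) (f u) e.
Proof.
move=> Af; apply: (ex_pull Af) => u'.
by rewrite (linked_pull Af) node_pull.
Qed.

Lemma delv_neq e y x s : x <> y -> linked (delv e y) x s -> s <> y.
Proof.
move=> xy; move: s; apply: (@linked_ind _ _ (fun s => s <> y)) => // s t _.
by move=> /and3P[_ _ /eqP].
Qed.

Definition lonely r y x v e := G x v /\ (exists u, node r y u e /\ linked e u v) /\
  linked e y x /\ x <> y /\ touch_inf G (delv e y) x v /\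
  forall y' u', node r y' u' e -> linked e u' v -> ~ linked (delv e y) x y'.

Lemma event_lonely r y x v : event G (lonely r y x v).
Proof. by rewrite /lonely; event_tac; exact: event_node. Qed.

Lemma lonely_pull r f e y x v : Aut G f ->
  lonely r y x v (pull f e) = lonely r (f y) (f x) (f v) e.
Proof.
move=> Af; rewrite /lonely -(adj_pull Af); congr (_ /\ _).
congr (_ /\ _); first by apply: (ex_pull Af) => u; rewrite node_pull // (linked_pull Af).
rewrite (linked_pull Af) (eq_pull Af) (delv_pull Af) (touch_inf_pull Af).
do 3 congr (_ /\ _).
apply: (all_pull Af) => y'; apply: (all_pull Af) => u'.
by rewrite node_pull // !(linked_pull Af).
Qed.

(* A vertex x next to v is claimed by at most one lonely y, whereas a lonely y
   claims infinitely many. *)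
Lemma no_lonely r : almost_surely (fun e => forall y x v, ~ lonely r y x v e).
Proof.
have [K [reps [K0 tr]]] := transport st.
have ML y x v := event_lonely r y x v.
have cI : countable [set: V * V] by countable_tac.
have fin y : almost_surely (fun e => finite_set [set k : V * V | lonely r y k.1 k.2 e]).
  apply: (fin_as st) => //.
  apply: le_lt_trans (tr V (fun f => f) (lonely r) _ _ _ y) _ => //.
  - by move=> f; case/AutP.
  - by move=> f a b c e Af _; exact: lonely_pull.
  have lt o : (\esum_(k in [set: V * V]) Prb (lonely r k.1 o k.2) < +oo)%E.
    have MT (v : V) : event G (fun=> True) by event_tac.
    apply: le_lt_trans (fset_sum_lty st 1 (nbr G o) MT).
    apply: (@esum_fset_le _ _ _ _ _ _ _ _ st _ _ (fun k => k.2)) => //.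
    apply: as_adm => e [es eG]; split; first by move=> [a v] [/= Gov _]; rewrite (nbrP st).
    move=> v _ _.
    have [[a0 A0]|no] := pselect (exists a, lonely r a o v e); last first.
      rewrite /cnt esum1 ?lee_fin // => -[a v'] [/= Ak vv].
      by case: no; exists a; rewrite -vv.
    apply: (@cnt_le_seq _ _ _ [:: (a0, v)]) => -[a v'] [/= Ak vv].
    rewrite vv in Ak *; rewrite inE; apply/eqP; congr (_, _).
    (* If two lonely vertices claimed [o], a path from [o] would reach one of them without passing
       the other; the one reached would be a node in a piece that should contain none. *)
    apply: contrapT => /eqP ne; move: Ak A0.
    move=> [_ [[u [nu uv]] [ao [_ [_ H]]]]] [_ [[u0 [nu0 uv0]] [ao0 [_ [_ H0]]]]].
    case: (linked_delv (linked_sym es ao) ne).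
      exact: (H0 _ _ nu uv).
    exact: (H _ _ nu0 uv0).
  apply: (@le_lt_trans _ _ (K%:E * \sum_(o <- reps)
       (fine (\esum_(k in [set: V * V]) Prb (lonely r k.1 o k.2)))%:E)%E).
    apply: lee_wpmul2l; first by rewrite lee_fin.
    apply: lee_sum => o _; rewrite fineK // ge0_fin_numE //.
    by apply: esum_ge0 => k _; exact: Prb_ge0.
  by rewrite sumEFin -EFinM ltry.
apply: as_imp (as_all Vc fin) => e [es eG] finy y x v.
move=> [Gxv [[u [nu uv]] [yx [xy [ti H]]]]].
have ti' := ti.
have ds : symmetric (delv e y) by exact: sym_delv.
have sub := linked_sub (@sub_delv _ e y).
apply: ti; apply: (sub_finite_set _ (finy y)) => -[s t] [/= Gst xs vt].
split=> //; split; first by exists u; split=> //; exact: linked_trans uv (sub _ _ vt).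
split; first exact: linked_trans yx (sub _ _ xs).
split; first exact: delv_neq xs.
split.
  by apply: touch_inf_sub ti' => z; [apply: linked_trans (linked_sym ds xs)|
    apply: linked_trans (linked_sym ds vt)].
move=> y' u' n' ut sy; apply: (H y' u' n').
  by apply: linked_trans ut _; apply: linked_sym => //; exact: sub.
exact: linked_trans sy.
Qed.

(** Applied to the three pieces of a node, this yields three further nodes, so that nodes branch
    among nodes. *)
Lemma next_node r : almost_surely (fun e => forall y u x, node r y u e -> linked e y x -> x <> y ->
  touch_inf G (delv e y) x u -> exists y', cluster_node r y' u e /\ linked (delv e y) x y').
Proof.
apply: as_imp (no_lonely r) => e [es eG] nl y u x nyu yx xy ti.
have [[s t] [/= Gst xs ut]] : exists c : V * V, [/\ G c.1 c.2,
    linked (delv e y) x c.1 & linked (delv e y) u c.2].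
  apply: contrapT => no; apply: ti; rewrite (_ : [set c | _] = set0) //.
  by apply/seteqP; split=> // c h; apply: no; exists c.
have ds : symmetric (delv e y) by exact: sym_delv.
have sub := linked_sub (@sub_delv _ e y).
apply: contrapT => no; apply: (nl y s t); split=> //.
split; first by exists u; split=> //; exact: sub.
split; first exact: linked_trans yx (sub _ _ xs).
split; first exact: delv_neq xs.
split.
  by apply: touch_inf_sub ti => z; [apply: linked_trans (linked_sym ds xs)|
    apply: linked_trans (linked_sym ds ut)].
move=> y' u' n' u't sy; apply: no; exists y'; split; last exact: linked_trans sy.
exists u'; split=> //; apply: linked_trans (sub _ _ ut) _; exact: linked_sym.
Qed.

End Nodes.

(** * Cells of nodes and the branching inside them *)

Section Cells.
Variables (R : realType) (V : choiceType) (G : graph V).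
Variables (d : measure_display) (T : measurableType d) (P : probability T R).
Variables (p : R) (w : T -> set {fset V}).
Hypothesis st : setting G P p w.
Implicit Types (e : rel V) (A B : rel V -> Prop) (x y z a b u v o : V).
Implicit Types (r L : nat).
Notation Prb := (Prb G P w).
Notation almost_surely := (almost_surely G P w).

Let perc := st_perc st.
Let Vc := st_count st.

Definition chain r L u e : rel V := fun a b =>
  `[< cluster_node G r a u e /\ cluster_node G r b u e /\ exists l, (l <= L)%N /\ walk e l a b >].

(** The bound [L] on the walks puts the three nodes [h i] into the same cell as [y]. *)
Definition inner r L u y e := cluster_node G r y u e /\ exists h : 'I_3 -> V,
  (forall i, h i <> y /\ cluster_node G r (h i) u e /\ exists l, (l <= L)%N /\ walk e l y (h i)) /\
  forall i j, i != j -> ~ linked (delv e y) (h i) (h j).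

Definition cell r L u y e y' := linked (chain r L u e) y y'.

Definition outer r L u y e y' := cell r L u y e y' /\ ~ inner r L u y' e.

(** The number of outer nodes is expressed through a list to keep the quantifiers countable; no n
    satisfies it when there are infinitely many. *)
Definition outers r L u y e n := exists s : seq V, uniq s /\ size s = n /\
  forall y', (y' \in s -> outer r L u y e y') /\ (outer r L u y e y' -> y' \in s).

Lemma event_linked_rel (g : rel V -> rel V) x y :
  (forall a b, event G (fun e => g e a b)) -> event G (fun e => linked (g e) x y).
Proof.
move=> Mg; apply: event_exn => n; elim: n x => [|n IH] x.
  by apply: event_ext (event_const G (x = y)) => e _; split=> /walk0.
apply: (@event_ext _ _ (fun e => exists z, g e x z /\ walk (g e) n z y)).
  by move=> e _; split=> [[z [? ?]]|/walkS[z ? ?]]; [apply/walkS|]; exists z.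
by event_tac.
Qed.

Lemma event_asbool A : event G A -> event G (fun e => `[< A e >]).
Proof. by apply: event_ext => e _; split=> /asboolP. Qed.

Lemma event_inner r L u y : event G (inner r L u y).
Proof. by rewrite /inner; event_tac; exact: (event_cluster_node st). Qed.

Lemma event_cell r L u y y' : event G (fun e => cell r L u y e y').
Proof.
apply: event_linked_rel => a b; apply: event_asbool; event_tac; exact: (event_cluster_node st).
Qed.

Lemma event_outers r L u y n : event G (fun e => outers r L u y e n).
Proof.
by rewrite /outers /outer; event_tac; first [exact: event_cell|exact: event_inner].
Qed.

Lemma inner_pull r L u y f e : Aut G f ->
  inner r L u y (pull f e) = inner r L (f u) (f y) e.
Proof.
move=> Af; rewrite /inner cluster_node_pull //; congr (_ /\ _).
have [g [Ag fK gK]] := Aut_inv Af.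
have fb : bijective (fun h : 'I_3 -> V => f \o h).
  by exists (fun h => g \o h) => h; apply/funext => i /=; rewrite ?fK ?gK.
apply: (ex_bij fb) => h; congr (_ /\ _).
  have W l i : walk (pull f e) l y (h i) = walk e l (f y) (f (h i)) by exact: (walk_pull Af).
  have N i : cluster_node G r (h i) u (pull f e) = cluster_node G r (f (h i)) (f u) e by exact: cluster_node_pull.
  have Q i : (h i = y) = (f (h i) = f y) by exact: (eq_pull Af).
  rewrite propeqE; split=> H i; have [] := H i.
    rewrite Q N => hy [n [l [lL]]]; rewrite W => wl; exact: (conj hy (conj n (ex_intro _ l (conj lL wl)))).
  rewrite -Q -N => hy [n [l [lL]]]; rewrite -W => wl; exact: (conj hy (conj n (ex_intro _ l (conj lL wl)))).
rewrite propeqE; split=> H i j ij; have := H i j ij;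
  by rewrite (delv_pull Af) (linked_pull Af).
Qed.

Lemma cell_pull r L u y f e y' : Aut G f ->
  cell r L u y (pull f e) y' = cell r L (f u) (f y) e (f y').
Proof.
move=> Af; rewrite /cell -(linked_pull Af); congr (linked _ _ _).
apply/funext => a; apply/funext => b; rewrite /pull /chain /=.
apply: asbool_equiv_eq; rewrite !(cluster_node_pull _ _ _ _ Af).
by split=> -[? [? [l [? h]]]]; do 2 split=> //; exists l; move: h; rewrite (walk_pull Af).
Qed.

Lemma outers_pull r L u y f e n : Aut G f ->
  outers r L u y (pull f e) n = outers r L (f u) (f y) e n.
Proof.
move=> Af; have [g [Ag fK gK]] := Aut_inv Af.
have E y' : outer r L u y (pull f e) y' = outer r L (f u) (f y) e (f y').
  by rewrite /outer cell_pull // inner_pull.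
rewrite propeqE; split=> -[s [us [ss H]]].
  exists (map f s); rewrite map_inj_uniq ?size_map; last exact: can_inj fK.
  split=> //; split=> // y'; have := H (g y'); rewrite E gK => -[H1 H2].
  by rewrite -[in y' \in _](gK y') mem_map //; exact: can_inj fK.
exists (map g s); rewrite map_inj_uniq ?size_map; last exact: can_inj gK.
split=> //; split=> // y'; have := H (f y'); rewrite -E => -[H1 H2].
by rewrite -[in y' \in _](fK y') mem_map //; exact: can_inj gK.
Qed.

Section Fixed.
Variable e : rel V.
Hypothesis ea : adm G e.

Let es : symmetric e := proj1 ea.

Lemma chain_sym r L u : symmetric (chain r L u e).
Proof.
move=> a b; apply: asbool_equiv_eq.
by split=> -[? [? [l [? h]]]]; do 2 split=> //; exists l; split=> //; exact: walk_sym.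
Qed.

Lemma cell_linked r L u y y' : cell r L u y e y' -> linked e y y'.
Proof.
by apply: (@linked_map _ _ e id) => a b /asboolP[_ [_ [l [_ h]]]]; exists l.
Qed.

Lemma cell_cluster_node r L u y y' : cluster_node G r y u e -> cell r L u y e y' -> cluster_node G r y' u e.
Proof.
move=> ny; move: y'; apply: (@linked_ind _ _ (fun y' => cluster_node G r y' u e)) => //.
by move=> a b _ /asboolP[_ []].
Qed.

Lemma cluster_node_link r y u v : linked e u v -> cluster_node G r y u e = cluster_node G r y v e.
Proof.
move=> uv; rewrite propeqE; split=> -[u' [uu' n]]; exists u'; split=> //.
  by apply: linked_trans uu'; exact: linked_sym.
exact: linked_trans uu'.
Qed.

Lemma chain_link r L u v : linked e u v -> chain r L u e = chain r L v e.
Proof.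
move=> uv; apply/funext => a; apply/funext => b; rewrite /chain.
by rewrite !(cluster_node_link _ _ uv).
Qed.

Lemma inner_link r L u v y : linked e u v -> inner r L u y e = inner r L v y e.
Proof.
move=> uv; rewrite /inner (cluster_node_link _ _ uv); congr (_ /\ _).
rewrite propeqE; split=> -[h [H1 H2]]; exists h; split=> // i; have := H1 i;
  by rewrite (cluster_node_link _ _ uv).
Qed.

Lemma outers_link r L u v y n : linked e u v -> outers r L u y e n = outers r L v y e n.
Proof.
move=> uv; have E y' : outer r L u y e y' = outer r L v y e y'.
  by rewrite /outer /cell (chain_link _ _ uv) (inner_link _ _ _ uv).
by rewrite propeqE; split=> -[s [us [ss H]]]; exists s; split=> //; split=> // y';
  have := H y'; rewrite E.
Qed.

Lemma outers_cell r L u y y' n : cell r L u y e y' ->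
  outers r L u y e n -> outers r L u y' e n.
Proof.
move=> yy' [s [us [ss H]]]; exists s; split=> //; split=> // z.
have [H1 H2] := H z; split=> [/H1[yz ?]|[y'z ?]].
  split=> //; apply: linked_trans yz; apply: linked_sym => //; exact: chain_sym.
by apply: H2; split=> //; exact: linked_trans y'z.
Qed.

Lemma outers_inj r L u y m n : outers r L u y e m -> outers r L u y e n -> m = n.
Proof.
move=> [s [us [<- Hs]]] [t [ut [<- Ht]]]; apply/perm_size/uniq_perm => // z.
by apply/idP/idP => [/(proj1 (Hs z)) /(proj2 (Ht z))|/(proj1 (Ht z)) /(proj2 (Hs z))].
Qed.

(** Inner nodes branch within the cell, so by [branching_half] they form at most half of it and are
    no more numerous than the outer ones. *)
Lemma cell_balance r L u y n (S : seq V) : cluster_node G r y u e -> uniq S ->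
  (forall y', y' \in S -> cell r L u y e y' /\ inner r L u y' e) ->
  finite_set [set y' | cell r L u y e y'] ->
  outers r L u y e n -> (size S <= n)%N.
Proof.
move=> ny uS HS fin [s [us [<- Hs]]].
pose F := fset_set [set y' | cell r L u y e y'].
have mF z : z \in (F : seq V) = `[< cell r L u y e z >].
  rewrite in_fset_set //; apply/idP/asboolP; rewrite ?inE //.
pose q z a b := `[< linked (delv e z) a b >].
have ds z : symmetric (delv e z) by exact: sym_delv.
have := @branching_half V q _ _ _ F (fset_uniq _) _.
move=> H; have {H}E2 : (2 * count (branching q F) F <= size F)%N.
  apply: H.
  - by move=> z a; apply/asboolP; exact: linked_refl.
  - by move=> z a b; apply: asbool_equiv_eq; split; exact: linked_sym.
  - move=> z b a c /asboolP ab /asboolP bc; apply/asboolP; exact: linked_trans bc.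
  - move=> a b c; rewrite !mF => /asboolP ya /asboolP yb /asboolP yc ab /asboolP nca.
    have ca : linked e c a.
      by apply: linked_trans (linked_sym es (cell_linked yc)) (cell_linked ya).
    by apply/asboolP; case: (linked_delv ca ab).
pose I := [seq z <- F | `[< inner r L u z e >]].
have sub : {subset I <= [seq z <- F | branching q F z]}.
  move=> z; rewrite [z \in I]mem_filter mF => /andP[] /asboolP iz /asboolP yz.
  have [nz [h [Hh nh]]] := iz.
  rewrite mem_filter mF asboolT // andbT.
  have hF i : h i \in (F : seq V).
    have [_ [nhi hl]] := Hh i; rewrite mF; apply/asboolP.
    apply: linked_trans yz _; apply: linked_step; apply/asboolP; split=> //.
  have hz i : h i != z by have [/eqP] := Hh i.
  have nq i j : i != j -> ~~ q z (h i) (h j) by move=> ij; apply/asboolP; exact: nh.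
  pose i0 : 'I_3 := @Ordinal 3 0 isT; pose i1 : 'I_3 := @Ordinal 3 1 isT.
  pose i2 : 'I_3 := @Ordinal 3 2 isT.
  apply/hasP; exists (h i0) => //; apply/hasP; exists (h i1) => //.
  apply/hasP; exists (h i2) => //.
  by rewrite !hz !nq.
have le1 : (size I <= count (branching q F) F)%N.
  rewrite -size_filter; apply: uniq_leq_size sub.
  by rewrite filter_uniq // fset_uniq.
have le2 : (size S <= size I)%N.
  apply: uniq_leq_size => // z /HS[yz iz].
  by rewrite mem_filter mF !asboolT.
have le3 : (size [seq z <- F | ~~ `[< inner r L u z e >]] <= size s)%N.
  apply: uniq_leq_size; first by rewrite filter_uniq // fset_uniq.
  move=> z; rewrite mem_filter mF => /andP[] /asboolP nz /asboolP yz.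
  by apply: (proj2 (Hs z)).
have := count_predC (fun z => `[< inner r L u z e >]) F.
rewrite -[count _ _]size_filter -[count (predC _) _]size_filter -/I => E.
apply: (leq_trans le2).
rewrite -(leq_add2l (size I)) addnn -mul2n.
apply: leq_trans (leq_trans _ E2) _; first by rewrite leq_mul2l.
by rewrite -E leq_add2l.
Qed.

End Fixed.
End Cells.

(** * Absence of trivertices *)

Section TriVertices.
Variables (R : realType) (V : choiceType) (G : graph V).
Variables (d : measure_display) (T : measurableType d) (P : probability T R).
Variables (p : R) (w : T -> set {fset V}).
Hypothesis st : setting G P p w.
Implicit Types (e : rel V) (A B : rel V -> Prop) (x y z a b u v o : V).
Implicit Types (r L : nat).
Notation Prb := (Prb G P w).
Notation rprob := (rprob G P w).
Notation almost_surely := (almost_surely G P w).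

Let perc := st_perc st.
Let Vc := st_count st.

(* A chain of short steps cannot jump over a gap in the levels. *)
Lemma cell_finite r L : almost_surely (fun e => forall u y, cluster_node G r y u e ->
  finite_set [set y' | cell G r L u y e y']).
Proof.
apply: as_imp (as_and (near_finite st) (level_gap st)) => e ea [nf gap] u y ny.
have [es eG] := ea; have [u1 [uu1 [[nyu1 _] [z [wz Gzu]]]]] := ny.
have yz : linked e y z by exists r.
have nzu : ~ linked e z u1 by move=> zu; apply: nyu1; exact: linked_trans zu.
(* From one touching edge to the next an open walk leads back to its node (r), on to the next node
   (at most L), and out to the next touching edge (r). *)
have [n Hn] := gap z u1 (r + L + r)%N Gzu nzu.
pose near z' u' := G z' u' /\ linked e u u' /\ linked e z z' /\ (lev e z z' <= n)%N.
have cellnear y' : cell G r L u y e y' -> exists z' u', walk e r y' z' /\ near z' u'.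
  move: y'; apply: (@linked_ind _ _ (fun y' => exists z' u', walk e r y' z' /\ near z' u')).
    by exists z, u1; split=> //; split=> //; split=> //; split; [exact: linked_refl|rewrite levxx].
  move=> a b [z' [u' [wa [Gz' [uu' [zz' lz']]]]]] /asboolP[_ [[u2 [uu2 [_ [z2 [w2 G2]]]]] [l [lL wab]]]].
  have w22 : walk e (r + l + r) z' z2.
    by apply: walk_cat w2; apply: walk_cat wab; exact: walk_sym.
  have zz2 : linked e z z2 by apply: linked_trans zz' _; exists (r + l + r)%N.
  exists z2, u2; split=> //; split=> //; split=> //; split=> //.
  have uu : linked e u1 u2 by apply: linked_trans uu2; exact: linked_sym.
  have [//|] := Hn (z2, u2) (And3 G2 zz2 uu); rewrite ltnNge => /negP[].
  apply: leq_trans (lev_triangle es z2 zz') _; apply: leq_add => //.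
  apply: leq_trans (lev_walk es w22) _; by rewrite leq_add2r leq_add2l.
apply: (@sub_finite_set _ _ (\bigcup_(c in [set c | pairs G e z u1 c /\ (lev e z c.1 < n.+1)%N])
   [set y' | walk G r c.1 y'])).
  move=> y' /cellnear[z' [u' [wy' [Gz' [uu' [zz' lz']]]]]].
  exists (z', u') => /=.
    by split=> //; split=> //=; apply: linked_trans uu'; exact: linked_sym.
  have : walk e r z' y' by exact: walk_sym.
  by move=> [s [ss ps ls]]; exists s; split=> //; apply: sub_path ps.
apply: bigcup_finite; first exact: nf.
by move=> c _; exact: (ball_finite (st_fin st)).
Qed.

Definition ballp r o : {fset V} := fset_set [set v | walk G r.+1 o v].

Lemma ballpP r o v : (v \in ballp r o) = `[< walk G r.+1 o v >].
Proof.
rewrite in_fset_set; last exact: (ball_finite (st_fin st)).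
by apply/idP/asboolP; rewrite inE.
Qed.

Lemma node_ball r o v e : adm G e -> node G r o v e -> v \in ballp r o.
Proof.
move=> [es eG] [_ [z [[s [ss ps ls]] Gzv]]]; rewrite ballpP; apply/asboolP.
rewrite -addn1; apply: (@walk_cat _ _ _ _ _ z); last by apply/walkS; exists v => //; apply/walk0.
by exists s; split=> //; apply: sub_path ps.
Qed.

Lemma mule_cancel (n : nat) (a b : \bar R) : (0 < n)%N ->
  (n%:R%:E * a <= n%:R%:E * b -> a <= b)%E.
Proof. by move=> n0; rewrite lee_pmul2l // lte_fin ltr0n. Qed.

(* In a cell with n non-branching nodes, each branching node sends unit mass to
   each of them; they receive at most n. *)
Lemma inner_bound : exists (K : R) (reps : seq V), 0 <= K /\ forall r L y,
  (Prb (fun e => exists u, inner G r L u y e) <= K%:E * \sum_(o <- reps)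
    \sum_(v <- ballp r o) Prb (fun e => node G r o v e /\ ~ inner G r L v o e))%E.
Proof.
have [K [reps [K0 tr]]] := transport st.
exists K, reps; split=> // r L y.
have Mi u z := event_inner st r L u z.
have Mo u z n := event_outers st r L u z n.
have Mc u z z' := event_cell st r L u z z'.
have Mn z u := event_node st r z u.
pose Q n o v e := (node G r o v e /\ ~ inner G r L v o e) /\ outers G r L v o e n.
have MQ n o v : event G (Q n o v) by rewrite /Q; apply: event_and => //; apply: event_and => //; exact: event_not.
pose B n e := exists u, inner G r L u y e /\ outers G r L u y e n.
have MB n : event G (B n) by rewrite /B; event_tac.
(* Sorting cells by the number n of outer nodes makes the mass sent equal to n, which then cancels
   against the bound n on the mass received. *)
have step n : (0 < n)%N -> (Prb (B n) <= K%:E * \sum_(o <- reps)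
    \sum_(v <- ballp r o) Prb (Q n o v))%E.
  move=> n0; pose A y y' u' e := inner G r L u' y e /\ node G r y' u' e /\
    ~ inner G r L u' y' e /\ cell G r L u' y e y' /\ outers G r L u' y e n.
  have MA a b c : event G (A a b c) by rewrite /A; event_tac.
  have cI : countable [set: V * V] by countable_tac.
  apply: (mule_cancel n0).
  apply: le_trans (@cnt_esum_ge _ _ _ _ _ _ _ _ st _ (fun k : V * V => A y k.1 k.2) (B n) n cI (fun k => MA _ _ _) (MB n) _) _.
    apply: as_adm => e ea [u [iu [s [us [ss Hs]]]]].
    have ex y' : exists u', y' \in s -> linked e u u' /\ node G r y' u' e.
      have [ys|//] := boolP (y' \in s); last by exists y'.
      have [cy _] := proj1 (Hs y') ys.
      by have [u' [? ?]] := cell_cluster_node (proj1 iu) cy; exists u'.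
    have [g Hg] := boolp.choice ex.
    rewrite -ss -(size_map (fun y' => (y', g y'))); apply: cnt_ge_seq.
      by rewrite map_inj_uniq // => a b [].
    move=> _ /mapP[y' ys ->] /=; have [uu' n'] := Hg y' ys.
    have [cy niy] := proj1 (Hs y') ys.
    have o : outers G r L u y e n by exists s.
    split; first by rewrite -(inner_link ea _ _ _ uu').
    split=> //; split; first by rewrite -(inner_link ea _ _ _ uu').
    split; first by rewrite /cell -(chain_link ea _ _ uu').
    by rewrite -(outers_link ea _ _ _ _ uu').
  apply: le_trans (tr V (fun f => f) A _ MA _ y) _.
  - by move=> f; case/AutP.
  - move=> f a b c e Af ea.
    by rewrite /A !(inner_pull _ _ _ _ _ Af) (node_pull _ _ _ _ Af)
      (cell_pull _ _ _ _ _ _ Af) (outers_pull _ _ _ _ _ _ Af).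
  rewrite muleCA; apply: lee_wpmul2l; first by rewrite lee_fin.
  rewrite ge0_sume_distrr; last by move=> o _; apply: sume_ge0 => v _; exact: Prb_ge0.
  apply: lee_sum => o _.
  apply: (esum_fset_le st (f := fun k : V * V => k.2) (B := fun v => Q n o v)) => //.
  apply: as_imp (cell_finite r L) => e ea fin; have [es eG] := ea; split.
    move=> [a v] [/= ia [no [nio [cao oa]]]].
    split; first exact: node_ball no.
    by split=> //; exact: outers_cell oa.
  move=> v _ [[nov niov] oov].
  apply: (@le_trans _ _ (cnt R [set a | cell G r L v o e a /\ inner G r L v a e])).
    apply: (@cnt_inj R _ _ (fun k : V * V => k.1)).
      by move=> [a b] [a' b']; rewrite !inE => -[_ /= <-] [_ /= <-] /= ->.
    move=> [a v'] [/= [ia [no [nio [cao oa]]]] <-]; split=> //.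
    by apply: linked_sym => //; exact: chain_sym.
  have ndo : cluster_node G r o v e by exists v; split=> //; exact: linked_refl.
  have fS : finite_set [set a | cell G r L v o e a /\ inner G r L v a e].
    by apply: (sub_finite_set _ (fin v o ndo)) => a [].
  rewrite cnt_fin // lee_fin ler_nat.
  apply: (cell_balance ea ndo (fset_uniq _) _ (fin v o ndo) oov).
  by move=> a; rewrite in_fset_set // inE.
have cN : countable [set: nat] by exact: countableP.
have MBi : event G (fun e => exists u, inner G r L u y e) by event_tac.
have /= le1 := @cnt_esum_ge _ _ _ _ _ _ _ _ st nat (fun n => B n.+1)
  (fun e => exists u, inner G r L u y e) 1 cN (fun n => MB _) MBi.
rewrite mul1e in le1; apply: le_trans (le1 _) _.
  apply: as_imp (cell_finite r L) => e ea fin [u iu].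
  pose S := [set y' | outer G r L u y e y'].
  have fS : finite_set S by apply: (sub_finite_set _ (fin u y (proj1 iu))) => a [].
  have ou : outers G r L u y e (size (fset_set S)).
    exists (fset_set S); split; first exact: fset_uniq.
    by split=> // y'; rewrite in_fset_set // inE.
  (* The inner node [y] alone forces an outer node in its cell, so n is at least 1. *)
  have : (size [:: y] <= size (fset_set S))%N.
    apply: (cell_balance ea (proj1 iu) _ _ (fin u y (proj1 iu)) ou) => // y'.
    by rewrite inE => /eqP ->; split=> //; exact: linked_refl.
  case E : (size (fset_set S)) => [//|n] _.
  apply: (@cnt_ge_seq R _ _ [:: n]) => // n'; rewrite inE => /eqP ->.
  by exists u; split=> //; rewrite -E.
apply: (@le_trans _ _ (\esum_(n in [set: nat]) (K%:E * \sum_(o <- reps)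
    \sum_(v <- ballp r o) Prb (Q n.+1 o v)))%E).
  by apply: le_esum => n _; exact: step.
apply: le_trans (esumZl_le K0 _) _.
  by move=> n; apply: sume_ge0 => o _; apply: sume_ge0 => v _; exact: Prb_ge0.
apply: lee_wpmul2l; first by rewrite lee_fin.
rewrite esum_sum; last by move=> n o _ _; apply: sume_ge0 => v _; exact: Prb_ge0.
apply: lee_sum => o _.
rewrite esum_sum; last by move=> n v _ _; exact: Prb_ge0.
apply: lee_sum => v _.
have MC : event G (fun e => node G r o v e /\ ~ inner G r L v o e).
  by apply: event_and => //; exact: event_not.
have := @cnt_esum_le _ _ _ _ _ _ _ _ st nat (fun n => Q n.+1 o v)
  (fun e => node G r o v e /\ ~ inner G r L v o e) 1 cN (fun n => MQ _ _ _) MC.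
rewrite mul1e; apply; apply: as_adm => e ea; split; first by move=> n [].
have [[n0 Q0]|no] := pselect (exists n, Q n.+1 o v e); last first.
  by rewrite /cnt esum1 ?lee_fin // => n Qn; case: no; exists n.
apply: (@cnt_le_seq _ _ _ [:: n0]) => n [_ on]; rewrite inE.
by rewrite -eqSS (outers_inj on (proj2 Q0)).
Qed.

(** Each of the three pieces of a node contains another node by [next_node]; L is the largest of the
    lengths of walks to them. *)
Lemma inner_all r o v : almost_surely (fun e => exists L, ~ (node G r o v e /\ ~ inner G r L v o e)).
Proof.
apply: as_imp (next_node st r) => e [es eG] nn.
have [no|nno] := pselect (node G r o v e); last by exists 0%N => -[].
have [[nov [h [Hh nh]]] _] := no.
(* Off [o], the vertex [o] is isolated, so a piece named by [o] itself could touch only along the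
   finitely many edges at [o]. *)
have ho i : h i <> o.
  move=> hio; have [_ ti] := Hh i; apply: ti; rewrite hio.
  have : finite_set [set c : V * V | c.1 = o /\ G o c.2].
    apply: (sub_finite_set _ (finite_image (fun s => (o, s)) (st_fin st o))).
    by move=> [a b] [/= -> Gob]; exists b.
  apply: sub_finite_set => -[a b] [/= Gab oa _].
  suff E : a = o by rewrite -E.
  move: oa; rewrite /delv; move: a {Gab}; apply: (@linked_ind _ _ (fun a => a = o)) => // s t ->.
  by rewrite /= eqxx andbF.
have ex i : exists k, cluster_node G r k v e /\ linked (delv e o) (h i) k.
  by have [l t] := Hh i; have [k] := nn o v (h i) no l (ho i) t; exists k.
have [k Hk] := boolp.choice ex.
have ex2 i : exists l, walk e l o (k i).
  have [l _] := Hh i; have [_ l'] := Hk i.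
  by have [m wm] := linked_trans l (linked_sub (@sub_delv _ e o) l'); exists m.
have [l Hl] := boolp.choice ex2.
exists (\max_i l i)%N => -[_]; apply; split.
  by exists v; split=> //; exact: linked_refl.
exists k; split=> [i|i j ij kk].
  have [nk lk] := Hk i; split; first exact: delv_neq lk.
  by split=> //; exists (l i); split=> //; exact: leq_bigmax.
have ds : symmetric (delv e o) by exact: sym_delv.
apply: (nh i j ij); apply: linked_trans (proj2 (Hk i)) _.
by apply: linked_trans kk _; apply: linked_sym => //; exact: (proj2 (Hk j)).
Qed.

Lemma inner_mono r L L' v o e : (L <= L')%N -> inner G r L v o e -> inner G r L' v o e.
Proof.
move=> le [n [h [H1 H2]]]; split=> //; exists h; split=> // i.
have [hi [ni [l [lL wl]]]] := H1 i; split=> //; split=> //.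
by exists l; split=> //; exact: leq_trans le.
Qed.

(** A node is inner for L or not. The second case becomes improbable as L grows, by [inner_all], and
    then so does the first, by [inner_bound]; the node event itself does not depend on L. *)
Lemma no_node r y u : almost_surely (fun e => ~ node G r y u e).
Proof.
have [K [reps [K0 bd]]] := inner_bound.
have Mi L z v := event_inner st r L z v.
have Mn z v := event_node st r z v.
pose A o v L e := node G r o v e /\ ~ inner G r L v o e.
have MA o v L : event G (A o v L) by apply: event_and => //; exact: event_not.
have vA o v : vanishing (fun L => rprob (A o v L)).
  apply: (rprob_vanishing st) => // [m n e mn [? ni]|].
    by split=> // im; apply: ni; exact: inner_mono im.
  exact: inner_all.
apply: (as_null perc (Mn y u)); change (Prb (node G r y u) = 0%E).
have [q /andP[q0 _] Eq] := Prb_fin st (Mn y u); rewrite Eq; congr (_%:E).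
apply/eqP; rewrite eq_le q0 andbT; apply/ler_addgt0Pl => eps e0; rewrite addr0.
have vS : vanishing (fun L => K * \sum_(o <- reps) \sum_(v <- ballp r o) rprob (A o v L)).
  by apply: vanishing_scale => //; apply: vanishing_sum => o; exact: vanishing_sum.
have e2 : 0 < eps / 2 by rewrite divr_gt0.
have [N1 H1] := vS _ e2; have [N2 H2] := vA y u _ e2.
pose L := maxn N1 N2.
have MBi : event G (fun e => exists u, inner G r L u y e) by event_tac.
have le : (Prb (node G r y u) <= Prb (fun e => exists u, inner G r L u y e) + Prb (A y u L))%E.
  apply: (@le_trans _ _ (Prb (fun e => (exists u, inner G r L u y e) \/ A y u L e))).
    apply: (le_Prb perc) => //; first exact: event_or.
    apply: as_adm => e _ ny; have [i|ni] := pselect (inner G r L u y e); last by right.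
    by left; exists u.
  exact: (measureU2 _ (measurable_event perc MBi) (measurable_event perc (MA y u L))).
rewrite -lee_fin -Eq; apply: (le_trans le); rewrite [eps]splitr EFinD; apply: leeD.
  apply: (le_trans (bd r L y)).
  rewrite (eq_bigr (fun o => (\sum_(v <- ballp r o) rprob (A o v L))%:E)); last first.
    move=> o _; rewrite -sumEFin; apply: eq_bigr => v _.
    by rewrite -(rprobE st).
  by rewrite sumEFin -EFinM lee_fin; apply: H1; exact: leq_maxl.
by rewrite (rprobE st) // lee_fin; apply: H2; exact: leq_maxr.
Qed.

(** After moving [u] within its cluster, every trivertex is a node for some r, so countably many
    null events suffice. *)
Lemma no_trivertex : almost_surely (fun e => ~ exists y u, trivertex G e y u).
Proof.
have cI : countable [set: nat * (V * V)] by countable_tac.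
have H k : almost_surely (fun e => ~ node G k.1 k.2.1 k.2.2 e) by exact: no_node.
apply: as_imp (as_all cI H) => e [es eG] nn [y [u [nyu [h [Hh nh]]]]].
have [l ti] := Hh ord0.
have [[s t] [/= Gst hs ut]] : exists c : V * V, [/\ G c.1 c.2,
    linked (delv e y) (h ord0) c.1 & linked (delv e y) u c.2].
  apply: contrapT => no; apply: ti; rewrite (_ : [set c | _] = set0) //.
  by apply/seteqP; split=> // c hc; apply: no; exists c.
have ds : symmetric (delv e y) by exact: sym_delv.
have sub := linked_sub (@sub_delv _ e y).
have [n wn] := linked_trans l (sub _ _ hs).
apply: (nn (n, (y, t))); split; last by exists s.
split; first by move=> yt; apply: nyu; apply: linked_trans yt (linked_sym es (sub _ _ ut)).
exists h; split=> // i; have [li ti'] := Hh i; split=> //.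
by apply: touch_inf_sub ti' => z //; apply: linked_trans; exact: linked_sym.
Qed.

Lemma no_star : almost_surely (fun e => forall f, fmod G e f -> ~ star G f).
Proof.
have MT : event G (fun e => exists y u, trivertex G e y u) by event_tac.
apply: as_imp (finite_energy st MT no_trivertex) => e ea H f ef sf.
have [g fg ytv] := star_trivertex (st_fin st) (proj1 ef) sf.
exact: (H g (fmod_trans ef fg)).
Qed.

End TriVertices.

(** * The second moment bound *)

Section Counting.
Variable R : realType.
Local Open Scope ereal_scope.

Lemma cntU (I : choiceType) (S S' : set I) : cnt R (S `|` S') <= cnt R S + cnt R S'.
Proof.
rewrite /cnt esum_mkcond [\esum_(i in S) _]esum_mkcond [\esum_(i in S') _]esum_mkcond.
rewrite -esumD; try by move=> i _; case: ifP.
apply: le_esum => i _; rewrite in_setU.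
by case: (i \in S); case: (i \in S'); rewrite /= ?adde0 ?add0e // leeDl.
Qed.

Lemma cnt_le2 (I : choiceType) (S : set I) :
  (forall c : 'I_3 -> I, injective c -> ~ forall i, S (c i)) -> cnt R S <= 2%:R%:E.
Proof.
move=> H.
have [[a Sa]|no] := pselect (exists a, S a); last first.
  rewrite /cnt esum1 ?lee_fin // => i Si; case: no; by exists i.
have [[b [Sb ba]]|no] := pselect (exists b, S b /\ b != a); last first.
  apply: (le_trans (@cnt_le_seq _ _ _ [:: a] _)); last by rewrite lee_fin ler_nat.
  move=> i Si; rewrite inE; apply: contrapT => /negP ia; apply: no; by exists i.
have [[c [Sc [ca cb]]]|no] := pselect (exists c, S c /\ c != a /\ c != b); last first.
  apply: (@cnt_le_seq _ _ _ [:: a; b]) => i Si; rewrite !inE.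
  apply: contrapT => /negP; rewrite negb_or => /andP[ia ib]; apply: no; by exists i.
have u : uniq [:: a; b; c] by rewrite /= !inE negb_or eq_sym ba eq_sym ca eq_sym cb.
case: (H (fun i => nth a [:: a; b; c] i)).
  move=> i j /eqP; rewrite nth_uniq // => /eqP; exact: val_inj.
by move=> [[|[|[|]]]].
Qed.

(** At most two classes, of sizes n1 and n2, give n1^2 + n2^2 related pairs, at least half of n^2.
    And m n is at most m^2 if n <= m, and at most n^2 otherwise. This is Cauchy-Schwarz in linear
    form. *)
Lemma two_classes (I : choiceType) (A : set I) (q : I -> I -> Prop) (m : nat) :
  (forall a, A a -> q a a) -> (forall a b, q a b -> q b a) ->
  (forall a b c, q a b -> q b c -> q a c) ->
  (forall c : 'I_3 -> I, (forall i, A (c i)) -> ~ forall i j, i != j -> ~ q (c i) (c j)) ->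
  m%:R%:E * cnt R A <=
  2%:R%:E * cnt R [set c : I * I | A c.1 /\ A c.2 /\ q c.1 c.2] + (m ^ 2)%:R%:E.
Proof.
move=> qr qs qt H; set Q := [set c : I * I | _].
have [fA|iA] := pselect (finite_set A); last first.
  rewrite (@cnt_inf R _ Q).
    by rewrite gt0_muley ?lte_fin // addye // leey.
  move=> fQ; apply: iA; apply: (sub_finite_set _ (finite_image fst fQ)).
  by move=> a Aa; exists (a, a) => //; split=> //; split=> //; exact: qr.
pose s := fset_set A; pose n := size s.
have sA a : a \in s -> A a by rewrite in_fset_set ?inE.
rewrite cnt_fin //.
have [nm|mn] := leqP n m.
  rewrite -[leLHS]add0e; apply: leeD; first by rewrite mule_ge0 ?lee_fin // cnt_ge0.
  by rewrite -EFinM lee_fin -natrM ler_nat -mulnn leq_mul2l nm orbT.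
suff : (n ^ 2)%:R%:E <= 2%:R%:E * cnt R Q.
  move=> le; apply: (@le_trans _ _ (n ^ 2)%:R%:E).
    by rewrite -EFinM lee_fin -natrM ler_nat -mulnn leq_mul2r (ltnW mn) orbT.
  by apply: (le_trans le); rewrite leeDl // lee_fin.
have [a0 a0s] : exists a, a \in s.
  have : (0 < #|` s|)%N by exact: leq_ltn_trans mn.
  by rewrite cardfs_gt0 => /fset0Pn.
pose s1 := [seq b <- s | `[< q a0 b >]]; pose s2 := [seq b <- s | ~~ `[< q a0 b >]].
have us1 : uniq s1 by rewrite filter_uniq // fset_uniq.
have us2 : uniq s2 by rewrite filter_uniq // fset_uniq.
have q1 b c : b \in s1 -> c \in s1 -> q b c.
  rewrite !mem_filter => /andP[/asboolP ab _] /andP[/asboolP ac _].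
  exact: qt (qs _ _ ab) ac.
have q2 b c : b \in s2 -> c \in s2 -> q b c.
  rewrite !mem_filter => /andP[/asboolP ab bs] /andP[/asboolP ac cs].
  apply: contrapT => nbc.
  apply: (H (fun i => nth a0 [:: a0; b; c] i)).
    by move=> [[|[|[|]]]] //= _; exact: sA.
  have nba : ~ q b a0 by move/qs.
  have nca : ~ q c a0 by move/qs.
  have ncb : ~ q c b by move/qs.
  by move=> [[|[|[|i]]]] // hi [[|[|[|j]]]].
pose l := allpairs pair s1 s1 ++ allpairs pair s2 s2.
have ul : uniq l.
  rewrite cat_uniq !allpairs_uniq ?andbT //=; try by move=> [? ?] [? ?].
  apply/hasPn => _ /allpairsP[[b c] [/= bs2 _ ->]]; apply/negP.
  move=> /allpairsP[[b' c'] [/= bs1 _ [E _]]]; move: bs2 bs1.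
  by rewrite -E !mem_filter => /andP[/negP h _] /andP[/h].
have := @cnt_ge_seq R _ Q l ul _.
have -> : (size l = size s1 * size s1 + size s2 * size s2)%N.
  by rewrite size_cat !size_allpairs.
move=> /(_ _) le; apply: (@le_trans _ _ (2%:R%:E * (size s1 * size s1 + size s2 * size s2)%:R%:E)).
  rewrite -EFinM lee_fin -natrM ler_nat.
  have -> : (n = size s1 + size s2)%N.
    by rewrite /s1 /s2 !size_filter count_predC.
  move: (size s1) (size s2) => a b; have [+ _] := nat_Cauchy a b.
  by rewrite -!mulnn; nia.
apply: lee_wpmul2l; first by rewrite lee_fin.
apply: le => -[b c]; rewrite mem_cat => /orP[] /allpairsP[[b' c'] [/= bs cs [-> ->]]].
  split; first by apply: sA; move: bs; rewrite mem_filter => /andP[].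
  split; first by apply: sA; move: cs; rewrite mem_filter => /andP[].
  exact: q1.
split; first by apply: sA; move: bs; rewrite mem_filter => /andP[].
split; first by apply: sA; move: cs; rewrite mem_filter => /andP[].
exact: q2.
Qed.

End Counting.

(** * Pairs of marks that see a common bridge *)

Section SecondMoment.
Variables (R : realType) (V : choiceType) (G : graph V).
Variables (d : measure_display) (T : measurableType d) (P : probability T R).
Variables (p : R) (w : T -> set {fset V}).
Hypothesis st : setting G P p w.
Implicit Types (e : rel V) (A B : rel V -> Prop) (x y z a b u v o : V).
Notation Prb := (Prb G P w).
Notation rprob := (rprob G P w).
Notation almost_surely := (almost_surely G P w).

Let perc := st_perc st.
Let Vc := st_count st.

Definition outlow N x y a b e :=
  mark G e x y /\ out G e x y a b /\ (lev e x a < N)%N.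

(** Two marks that see the same bridge and touch the same cluster: the pairs of the second
    moment. *)
Definition twin N x y x' y' a b e :=
  outlow N x y a b e /\ outlow N x' y' a b e /\ linked e y y'.

Lemma event_outlow N x y a b : event G (outlow N x y a b).
Proof. by rewrite /outlow; event_tac. Qed.

Lemma event_twin N x y x' y' a b : event G (twin N x y x' y' a b).
Proof. by rewrite /twin; event_tac; exact: event_outlow. Qed.

Lemma outlow_pull N x y a b f e : Aut G f -> adm G e ->
  outlow N x y a b (pull f e) = outlow N (f x) (f y) (f a) (f b) e.
Proof.
by move=> Af [es _]; rewrite /outlow (mark_pull Af) (out_pull Af) (lev_pull Af).
Qed.

Lemma twin_pull N x y x' y' a b f e : Aut G f -> adm G e ->
  twin N x y x' y' a b (pull f e) = twin N (f x) (f y) (f x') (f y') (f a) (f b) e.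
Proof.
move=> Af ea.
by rewrite /twin !(outlow_pull _ _ _ _ _ Af ea) (linked_pull Af).
Qed.

(** Three bridges of equal level would give a star by [outs_star], so each of the N levels has at
    most two. *)
Lemma outlow_count : almost_surely (fun e => forall x y, mark G e x y -> forall N,
  (cnt R [set c : V * V | outlow N x y c.1 c.2 e] <= (2 * N)%:R%:E)%E).
Proof.
apply: as_imp (no_star st) => e ea ns x y mxy N.
apply: (@le_trans _ _ (2%:R%:E * cnt R [set n | (n < N)%N])%E).
  apply: (cnt_fiber (f := fun c : V * V => lev e x c.1)) => [c [_ [_ lt]] //|n _].
  apply: cnt_le2 => c ci H; apply: (ns _ (fmod_cuts (codom c) ea)).
  apply: (outs_star ea mxy _ ci) => [i|i j]; first by have [[_ []]] := H i.
  by have [_ ->] := H i; have [_ ->] := H j.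
rewrite natrM EFinM; apply: lee_wpmul2l; first by rewrite lee_fin.
rewrite -{2}(size_iota 0 N); apply: cnt_le_seq => n /=.
by rewrite mem_iota.
Qed.

(** For each neighbour b of [o], [two_classes] is applied to the marks that see the bridge [o b],
    related when they touch the same cluster; three unrelated ones would give a star by [out_star].
    The error [m ^ 2] arises once for each b. *)
Lemma twin_count m N o : almost_surely (fun e =>
  (m%:R%:E * cnt R [set k : V * (V * V) | outlow N k.1 k.2.1 o k.2.2 e] <=
   2%:R%:E * cnt R [set k : V * ((V * V) * (V * V)) |
     twin N k.1 k.2.1.2 k.2.2.1 k.2.2.2 o k.2.1.1 e] +
   (m ^ 2 * #|` nbr G o|)%:R%:E)%E).
Proof.
apply: as_imp (no_star st) => e ea ns; have [es eG] := ea.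
set S := [set k | _]; set S' := [set k | _].
rewrite (cnt_split _ (fun k : V * (V * V) => k.2.2) S).
rewrite (cnt_split _ (fun k : V * ((V * V) * (V * V)) => k.2.1.1) S').
rewrite (esum_fset_supp (D := nbr G o)); last 2 first.
- by move=> b; exact: cnt_ge0.
- move=> b; rewrite (nbrP st) => /negP nG; rewrite /cnt esum1 // => k [/= [_ [[[ob _] _ _] _]] kb].
  by case: nG; apply: eG; rewrite -kb.
set tb := fun b => cnt R [set i | S' i /\ i.2.1.1 = b].
have le1 : (\sum_(b <- nbr G o) tb b <= \esum_(b in [set: V]) tb b)%E.
  apply: (@le_trans _ _ (\esum_(b in [set` nbr G o]) tb b)%E).
    rewrite esum_fset //; last by move=> b _; exact: cnt_ge0.
    by rewrite fsbig_finite // set_fsetK.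
  rewrite esum_mkcond; apply: le_esum => b _; case: ifPn => // _; exact: cnt_ge0.
apply: (@le_trans _ _ (2%:R%:E * \sum_(b <- nbr G o) tb b + (m ^ 2 * #|` nbr G o|)%:R%:E)%E); last first.
  by apply: leeD => //; apply: lee_wpmul2l => //; rewrite lee_fin.
have -> : ((m ^ 2 * #|` nbr G o|)%:R%:E = \sum_(b <- nbr G o) (m ^ 2)%:R%:E :> \bar R)%E.
  by rewrite sumEFin big_const_seq count_predT iter_addr addr0 natrM mulr_natr.
rewrite !ge0_sume_distrr; try by move=> b _; exact: cnt_ge0.
rewrite -big_split /=; apply: lee_sum => b _.
pose Sb := [set k | S k /\ k.2.2 = b].
pose q (k k' : V * (V * V)) := linked e k.2.1 k'.2.1.
have := @two_classes R _ Sb q m _ _ _ _.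
move=> H; apply: le_trans (H _ _ _ _) _.
- by move=> k _; exact: linked_refl.
- by move=> k k'; exact: linked_sym.
- by move=> k1 k2 k3; exact: linked_trans.
- move=> c Hc nc; apply: (ns (cut e o b)); first exact: (@fmod_cuts _ G e [:: (o, b)] ea).
  apply: (out_star (x := fun i => (c i).1) (y := fun i => (c i).2.1) es) => [i|].
    by have [[mi [oi _]] <-] := Hc i.
  exact: nc.
apply: leeD => //; apply: lee_wpmul2l; first by rewrite lee_fin.
apply: (@cnt_inj R _ _ (fun k : (V * (V * V)) * (V * (V * V)) =>
  (k.1.1, ((b, k.1.2.1), (k.2.1, k.2.2.1))))).
  move=> [[x1 [y1 b1]] [x2 [y2 b2]]] [[x1' [y1' b1']] [x2' [y2' b2']]].
  rewrite !inE /= => -[[_ /= ->] [[_ /= ->] _]] [[_ /= ->] [[_ /= ->] _]].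
  by move=> [-> -> -> ->].
move=> [[x1 [y1 b1]] [x2 [y2 b2]]] [[/= o1 E1] [[/= o2 E2] q12]].
by split=> //; rewrite /S' /twin /= -{1}E1 -E2.
Qed.

(** Both marks are at level below N from [a], hence below 2 N from each other; apart from equality,
    this is what [sigma] counts. *)
Lemma twin_near N x y x' y' a b e : adm G e -> twin N x y x' y' a b e ->
  (x', y') = (x, y) \/ exists n, (n < 2 * N)%N /\ Psi G n e x y x' y'.
Proof.
move=> [es eG] [[[Gxy nxy _] [[_ fx _] lx]] [[[Gxy' _ _] [[_ fx' _] lx']] yy']].
have xa : linked e x a by apply: linked_sym => //; exact: far_linked fx.
have ax' : linked e a x' := far_linked fx'.
have [E|ne] := pselect ((x', y') = (x, y)); [by left|right].
exists (lev e x x'); split.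
  apply: (leq_ltn_trans (lev_triangle es x' xa)).
  by rewrite mul2n -addnn -addSn leq_add // levC // ltnW.
do 3 split=> //; split; first exact: linked_trans ax'.
by split.
Qed.

Lemma growth_ineq (K r D N b : R) : 0 <= K -> 0 <= r -> 0 <= D -> 0 <= N -> 0 <= b ->
  K * (2%:R * (K * (2%:R * N * (r * b + D))) * r) <=
  K * (2%:R * (K * (2%:R * (r + D))) * r) * N * (b + 1).
Proof.
move=> K0 r0 D0 N0 b0.
have h : r * b + D <= (r + D) * (b + 1) by have := mulr_ge0 D0 b0; lra.
have c0 : 0 <= K * (2%:R * (K * (2%:R * N))) * r by rewrite !mulr_ge0.
have := ler_wpM2l c0 h; lra.
Qed.

(** Mass is transported twice: from the marks to the bridges they see and, for twins, from the
    bridge back to the first mark. A twin of a mark is then determined by its second mark, counted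
    by [s] on the levels below 2 N, and by one of at most 2 N bridges. *)
Lemma mark_bound : exists C1 C2 : R, exists s : nat -> R,
  [/\ 0 <= C1, 0 <= C2, forall n, 0 <= s n, vanishing s & forall m N x y,
    m%:R * N%:R * rprob (fun e => mark G e x y) <=
    C1 * N%:R * (\sum_(0 <= i < 2 * N) s i + 1) + C2 * m%:R ^+ 2].
Proof.
have [K [reps [K0 tr]]] := transport st.
have [s [s0 vs Hs]] := sigma st.
pose D := (\sum_(o <- reps) #|` nbr G o|)%N.
exists (K * (2%:R * (K * (2%:R * (size reps + D)%:R)) * (size reps)%:R)), (K * D%:R), s.
have CC1 : 0 <= K * (2%:R * (K * (2%:R * (size reps + D)%:R)) * (size reps)%:R).
  by rewrite !mulr_ge0.
split=> // [|m N x y]; first by rewrite mulr_ge0.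
have Ml x0 y0 a b := event_outlow N x0 y0 a b.
have Mt x0 y0 x1 y1 a b := event_twin N x0 y0 x1 y1 a b.
have c3 : countable [set: V * (V * V)] by countable_tac.
have c5 : countable [set: V * ((V * V) * (V * V))] by countable_tac.
have cp : countable [set: nat * (V * (V * V))] by countable_tac.
pose b := \sum_(0 <= i < 2 * N) s i.
have b0 : 0 <= b by apply: sumr_ge0.
have M1 : event G (fun e => mark G e x y) by event_tac.

(* For each pair of marks there are at most 2 N common bridges, by [outlow_count]. The second mark
   equals the first ([W1]) or is counted by [Psi] ([W2]). *)
have step4 o : (\esum_(k in [set: V * ((V * V) * (V * V))])
    Prb (twin N o k.2.1.2 k.2.2.1 k.2.2.2 k.1 k.2.1.1) <=
    ((2 * N)%:R * (b + (#|` nbr G o|)%:R))%:E)%E.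
  pose Q (j : nat * (V * (V * V))) e := (j.1 < 2 * N)%N /\ Psi G j.1 e o j.2.2.1 j.2.1 j.2.2.2.
  have MQ j : event G (Q j) by apply: event_and; [event_tac|exact: (event_Psi st)].
  have := @esum_Prb_le _ _ _ _ _ _ _ _ perc _ _
    (fun (k : V * ((V * V) * (V * V))) e => twin N o k.2.1.2 k.2.2.1 k.2.2.2 k.1 k.2.1.1 e)
    Q 1 (2 * N)%:R ((2 * N)%:R * (#|` nbr G o|)%:R) c5 cp (fun k => Mt _ _ _ _ _ _) MQ
    ler01 (ler0n _ _) (mulr_ge0 (ler0n _ _) (ler0n _ _)).
  rewrite mul1e => H; apply: le_trans (H _) _.
    apply: as_imp outlow_count => e ea oc; have [es eG] := ea; rewrite mul1e.
    pose W1 := [set k : V * (V * V) | k.1 = o /\ k.2.2 = k.2.1 /\ G o k.2.1].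
    pose W2 := [set k : V * (V * V) | exists n, (n < 2 * N)%N /\ Psi G n e o k.2.1 k.1 k.2.2].
    apply: (@le_trans _ _ ((2 * N)%:R%:E * cnt R (W1 `|` W2))%E).
      apply: (cnt_fiber (f := fun k : V * ((V * V) * (V * V)) => (k.2.2.1, (k.2.1.2, k.2.2.2)))).
        move=> [a [[b' y0] [x' y']]] /= tw; have [[Gxy _ _] _] := proj1 tw.
        by case: (twin_near ea tw) => [[-> ->]|h]; [left|right].
      move=> [x' [y0 y']] _.
      have [[k [Hk _]]|no] := pselect (exists k : V * ((V * V) * (V * V)),
        twin N o y0 x' y' k.1 k.2.1.1 e /\ True); last first.
        rewrite /cnt esum1 ?lee_fin // => -[a [[b' y1] [x1 y1']]] /= [tw [E1 E2 E3]].
        by case: no; exists (a, ((b', y1), (x1, y1'))); rewrite /= -E1 -E2 -E3.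
      apply: (le_trans _ (oc o y0 (proj1 (proj1 Hk)) N)).
      apply: (@cnt_inj R _ _ (fun k : V * ((V * V) * (V * V)) => (k.1, k.2.1.1))).
        move=> [a [[b1 y1] [x1 y1']]] [a2 [[b2 y2] [x2 y2']]]; rewrite !inE /=.
        by move=> [_ [-> -> ->]] [_ [-> -> ->]] [-> ->].
      by move=> [a [[b1 y1] [x1 y1']]] /= [[ol _] [E1 E2 E3]]; rewrite -E2.
    rewrite EFinM -ge0_muleDr ?cnt_ge0 ?lee_fin //.
    apply: lee_wpmul2l; first by rewrite lee_fin.
    rewrite [leRHS]addeC; apply: le_trans (cntU _ _ _) _; apply: leeD.
      rewrite -(size_map (fun v => (o, (v, v)))); apply: cnt_le_seq.
      move=> [x' [y0 y']] [/= -> [-> Goy]].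
      by apply/mapP; exists y0; rewrite // (nbrP st).
    apply: (@cnt_inj R _ _ (fun k : V * (V * V) => (lev e o k.1, k))).
      by move=> k k' _ _ [].
    move=> k [n [nN Pn]]; have E : lev e o k.1 = n.
      by have [_ [_ [_ [_ [_ [_ ->]]]]]] := Pn.
    by rewrite /Q /= E.
  rewrite mulrDr EFinD; apply: leeD => //; rewrite EFinM.
  apply: lee_wpmul2l; first by rewrite lee_fin.
  rewrite -(esum_pair (a := fun n k => Prb (Q (n, k)))); last by move=> *; exact: Prb_ge0.
  pose F : {fset nat} := [fset i in iota 0 (2 * N)]%fset.
  have mF i : (i \in F) = (i < 2 * N)%N by rewrite !inE mem_iota.
  rewrite (esum_fset_supp (D := F)).
  - rewrite /b -sumEFin /index_iota subn0.
    rewrite (perm_big (iota 0 (2 * N))) /=; last first.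
      apply: uniq_perm; [exact: fset_uniq|exact: iota_uniq|].
      by move=> i; rewrite -[LHS]/(i \in F) mF mem_iota.
    apply: lee_sum => i _; apply: le_trans (Hs i o); apply: le_esum => k _.
    by apply: (le_Prb perc) => //; [exact: (event_Psi st)|apply: as_adm => e _ []].
  - by move=> i; apply: esum_ge0 => k _; exact: Prb_ge0.
  - move=> i; rewrite mF => nlt; apply: esum1 => k _; apply: (Prb_as0 perc) => //.
    by apply: as_adm => e _ [] /=; rewrite (negbTE nlt).
have step3 o : (\esum_(k in [set: V * ((V * V) * (V * V))])
    Prb (twin N k.1 k.2.1.2 k.2.2.1 k.2.2.2 o k.2.1.1) <=
    (K * ((2 * N)%:R * ((size reps)%:R * b + D%:R)))%:E)%E.
  pose g (f : V -> V) (j : (V * V) * (V * V)) := (pair_map f j.1, pair_map f j.2).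
  apply: le_trans (tr _ g (fun a x j e => twin N x j.1.2 j.2.1 j.2.2 a j.1.1 e) _ _ _ o) _ => //.
  - move=> f Af; have [h hK gK] := pair_map_bij Af.
    by exists (fun j => (h j.1, h j.2)) => -[j1 j2]; rewrite /g /= ?hK ?gK.
  - by move=> f a c j e Af ea; rewrite /g /= (twin_pull _ _ _ _ _ _ _ Af ea).
  rewrite EFinM; apply: lee_wpmul2l; first by rewrite lee_fin.
  have -> : (2 * N)%:R * ((size reps)%:R * b + D%:R) =
      \sum_(o' <- reps) ((2 * N)%:R * (b + (#|` nbr G o'|)%:R)) :> R.
    rewrite -big_distrr /= big_split /= big_const_seq count_predT iter_addr addr0.
    by rewrite /D natr_sum [(size reps)%:R * b]mulr_natl.
  rewrite -sumEFin; apply: lee_sum => o' _; exact: step4.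
have step2 o : (m%:R%:E * (\esum_(k in [set: V * (V * V)]) Prb (outlow N k.1 k.2.1 o k.2.2)) <=
    (2%:R * (K * ((2 * N)%:R * ((size reps)%:R * b + D%:R))) + m%:R ^+ 2 * (#|` nbr G o|)%:R)%:E)%E.
  have := @esum_Prb_le _ _ _ _ _ _ _ _ perc _ _
    (fun (k : V * (V * V)) e => outlow N k.1 k.2.1 o k.2.2 e)
    (fun (k : V * ((V * V) * (V * V))) e => twin N k.1 k.2.1.2 k.2.2.1 k.2.2.2 o k.2.1.1 e)
    m%:R 2%:R (m ^ 2 * #|` nbr G o|)%:R c3 c5 (fun k => Ml _ _ _ _) (fun k => Mt _ _ _ _ _ _)
    (ler0n _ _) (ler0n _ _) (ler0n _ _).
  move=> H; apply: le_trans (H (twin_count m N o)) _.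
  rewrite [leRHS]EFinD; apply: leeD; last by rewrite natrM natrX.
  by rewrite [leRHS]EFinM; apply: lee_wpmul2l => //; rewrite lee_fin.
(* By [mark_far] and [out_many] a mark sees at least N bridges at levels below N. *)
have step1 : (N%:R%:E * Prb (fun e => mark G e x y) <=
    K%:E * \sum_(o <- reps) \esum_(k in [set: V * (V * V)]) Prb (outlow N k.1 k.2.1 o k.2.2))%E.
  apply: (@le_trans _ _ (\esum_(k in [set: V * (V * V)]) Prb (outlow N x k.2.1 k.1 k.2.2))%E).
    apply: (@cnt_esum_ge _ _ _ _ _ _ _ _ st _
      (fun (k : V * (V * V)) e => outlow N x k.2.1 k.1 k.2.2 e)) => //.
    apply: as_imp (mark_far st) => e ea mf mxy.
    have [l [ul sl Hl]] := out_many ea mxy (mf x y mxy N).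
    have := @cnt_ge_seq R _ [set k : V * (V * V) | outlow N x k.2.1 k.1 k.2.2 e]
      (map (fun c : V * V => (c.1, (y, c.2))) l).
    rewrite size_map sl; apply.
      by rewrite map_inj_uniq // => -[? ?] [? ?] [-> ->].
    by move=> _ /mapP[c /Hl[oc lc] ->].
  apply: (tr _ (fun f => pair_map f) (fun x a c e => outlow N x c.1 a c.2 e)) => //.
  - by move=> f Af; exact: (pair_map_bij Af).
  - by move=> f a c j e Af ea; rewrite (outlow_pull _ _ _ _ _ Af ea).
have : (m%:R%:E * (N%:R%:E * Prb (fun e => mark G e x y)) <=
    (K * \sum_(o <- reps) (2%:R * (K * ((2 * N)%:R * ((size reps)%:R * b + D%:R))) +
       m%:R ^+ 2 * (#|` nbr G o|)%:R))%:E)%E.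
  apply: (@le_trans _ _ (m%:R%:E * (K%:E * \sum_(o <- reps) \esum_(k in [set: V * (V * V)])
     Prb (outlow N k.1 k.2.1 o k.2.2)))%E).
    by apply: lee_wpmul2l => //; rewrite lee_fin.
  rewrite muleCA EFinM; apply: lee_wpmul2l; first by rewrite lee_fin.
  rewrite ge0_sume_distrr; last by move=> o _; apply: esum_ge0 => k _; exact: Prb_ge0.
  by rewrite -sumEFin; apply: lee_sum => o _; exact: step2.
rewrite (rprobE st M1) -!EFinM lee_fin mulrA => H; apply: (le_trans H).
rewrite big_split /= big_const_seq count_predT iter_addr addr0 -big_distrr /=.
rewrite -natr_sum -/D mulrDr; apply: lerD; last first.
  by rewrite [m%:R ^+ 2 * _]mulrC mulrA.
rewrite natrM natrD -[2%:R * _ *+ _]mulr_natr -/b; exact: growth_ineq.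
Qed.

(* Take N = M m in [mark_bound], with M large and then m large. *)
Lemma no_mark x y : almost_surely (fun e => ~ mark G e x y).
Proof.
have [C1 [C2 [s [C10 C20 s0 vs bd]]]] := mark_bound.
have M1 : event G (fun e => mark G e x y) by event_tac.
apply: (as_null perc M1); change (Prb (fun e => mark G e x y) = 0%E).
rewrite (rprobE st M1); congr (_%:E); set q := rprob _ in bd *.
have q0 : 0 <= q := rprob_ge0 _ _ _ _.
apply/eqP; rewrite eq_le q0 andbT leNgt; apply/negP => qgt0.
(* Thus [M q] exceeds [C2 + 2], whereas [mark_bound] divided by m^2 will leave at most [C2 + 1]. *)
pose M := (Num.truncn ((C2 + 2) / q)).+1.
have Mq : C2 + 2 < M%:R * q by rewrite -ltr_pdivrMr //; exact: truncnS_gt.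
have d0 : 0 < C1 * M%:R + 1 by rewrite ltr_wpDl // mulr_ge0 // ltW.
(* With this value a sum [b] of at most 2 M m eps satisfies 2 b (C1 M + 1) <= m; the summand 1 keeps
   the divisor positive even if [C1] is 0. *)
pose eps := ((C1 * M%:R + 1) * (2 * (2%:R * M%:R)))^-1.
have e0 : 0 < eps by rewrite invr_gt0 !mulr_gt0.
have [N0 HN] := vanishing_cesaro s0 vs e0.
(* The first bound makes 2 M m large enough for the Cesaro estimate, the second one makes [C1 M] at
   most m / 2. *)
pose m := maxn N0.+1 (Num.truncn (2%:R * (C1 * M%:R))).+1.
have m0 : (0 < m)%N by rewrite leq_max.
have mR : 0 < m%:R :> R by rewrite ltr0n.
have mC : 2%:R * (C1 * M%:R) <= m%:R.
  by apply: ltW; apply: lt_le_trans (truncnS_gt _) _; rewrite ler_nat leq_maxr.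
have le := HN (2 * (M * m))%N _; set b := \sum_(0 <= i < _) _ in le.
have {}le : b <= eps * (2 * (M * m))%:R.
  apply: le; rewrite mulnA; apply: (@leq_trans m).
    by rewrite (leq_trans (leqnSn _)) // leq_maxl.
  by rewrite leq_pmull // muln_gt0.
have := bd m (M * m)%N x y; rewrite -/q -/b => H.
have b2 : C1 * M%:R * (2 * b) <= m%:R.
  have : (C1 * M%:R + 1) * (2 * b) <= m%:R.
    apply: (@le_trans _ _ ((C1 * M%:R + 1) * (2 * (eps * (2 * (M * m))%:R)))).
      by rewrite !ler_wpM2l // ltW.
    rewrite /eps !natrM.
    have -> : (C1 * M%:R + 1) * (2 * (((C1 * M%:R + 1) * (2 * (2 * M%:R)))^-1 * (2 * (M%:R * m%:R)))) =
        ((C1 * M%:R + 1) * (2 * (2 * M%:R))) / ((C1 * M%:R + 1) * (2 * (2 * M%:R))) * m%:R by lra.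
    by rewrite divff ?mul1r // gt_eqF // !mulr_gt0.
  have b0 : 0 <= b by apply: sumr_ge0.
  lra.
have : m%:R ^+ 2 * (M%:R * q) <= m%:R ^+ 2 * (C2 + 1).
  move: H; rewrite natrM !expr2 => H.
  have : m%:R * (C1 * M%:R * (2 * b) + 2 * (C1 * M%:R)) <= m%:R * (m%:R + m%:R).
    by apply: ler_wpM2l; [exact: ltW|exact: lerD].
  lra.
rewrite ler_pM2l ?exprn_gt0 // => h; lra.
Qed.

End SecondMoment.

(** * Absence of marks *)

Section Final.
Variables (R : realType) (V : choiceType) (G : graph V).
Variables (d : measure_display) (T : measurableType d) (P : probability T R).
Variables (p : R) (w : T -> set {fset V}).
Hypothesis perc : bernoulli_bond_percolation G P p w.
Hypothesis Vc : countable [set: V].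
Implicit Types (e : rel V) (x y : V).

(** Distinct touching vertices are ends of distinct touching edges, so the clusters are joined by
    infinitely many edges, and each of these is a mark. *)
Lemma touching_mark e x y : adm G e -> ~ linked e x y ->
  infinite_set (touching G (component e x) (component e y)) ->
  exists x' y', mark G e x' y'.
Proof.
move=> [es eG] nxy inf.
have adj x' : touching G (component e x) (component e y) x' ->
    exists y', [/\ G x' y', linked e x x' & linked e y y'].
  by move=> [xx' [[y' yy' /walkS[z Gz /walk0 E]] _]]; rewrite E in Gz; exists y'.
have ti : touch_inf G e x y.
  move=> fin; apply: inf; apply: (sub_finite_set _ (finite_image fst fin)).
  by move=> x' /adj[y' h]; exists (x', y').
have [x' [y' [Gxy xx' yy']]] : exists x' y', [/\ G x' y', linked e x x' & linked e y y'].
  apply: contrapT => no; apply: inf; rewrite (_ : touching _ _ _ = set0) //.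
  by apply/seteqP; split=> // x' /adj[y' h]; apply: no; exists x', y'.
exists x', y'; split=> //.
  move=> l; apply: nxy; apply: linked_trans xx' _; apply: linked_trans l _.
  exact: linked_sym.
by apply: touch_inf_sub ti => s; apply: linked_trans; exact: linked_sym.
Qed.

Lemma Prb_edge x y : G x y -> Prb G P w (fun e => e x y) = p%:E.
Proof.
move=> Gxy; have Gl : inG G [:: (x, y)] by rewrite /inG /= Gxy.
have := prob_cyl perc Gl; rewrite (_ : #|` _| = 1%N) ?expr1.
  move=> <-; congr (P _); apply/seteqP.
  by split=> t; rewrite /cyl /preimage /= andbT.
rewrite (_ : edgeset _ = [fset edge (x, y)]%fset) ?cardfs1 //.
apply/fsetP => i; rewrite inE; apply/in_edgeset/eqP => [[c]|->].
  by rewrite inE => /eqP ->.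
by exists (x, y) => //; rewrite inE.
Qed.

Lemma all_closed : p = 0 -> almost_surely G P w (fun e => forall x y, ~ e x y).
Proof.
move=> p0; have cI : countable [set: V * V] by countable_tac.
have H (c : V * V) : almost_surely G P w (fun e => ~ e c.1 c.2).
  have [Gc|nG] := boolP (G c.1 c.2); last first.
    by apply: as_adm => e [_ eG] /eG Gc; rewrite Gc in nG.
  by apply: (as_null perc); [event_tac|exact: etrans (Prb_edge Gc) (congr1 _ p0)].
by apply: as_imp (as_all cI H) => e _ h x y; exact: (h (x, y)).
Qed.

Lemma all_open : p = 1 -> almost_surely G P w (fun e => forall x y, G x y -> e x y).
Proof.
move=> p1; have cI : countable [set: V * V] by countable_tac.
have H (c : V * V) : almost_surely G P w (fun e => G c.1 c.2 -> e c.1 c.2).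
  have [Gc|nG] := boolP (G c.1 c.2); last by apply: as_adm => e _.
  apply: (@as_imp _ _ _ _ _ _ _ (fun e => ~ ~ e c.1 c.2)); first by move=> e _ /contrapT.
  have ME : event G (fun e => e c.1 c.2) by event_tac.
  apply: (as_null perc (event_not ME)).
  rewrite /Prb; change (P (~` [set t | opn G w t c.1 c.2]) = 0%E).
  rewrite probability_setC; last exact: (measurable_event perc ME).
  have := Prb_edge Gc; rewrite /Prb p1 => ->.
  by rewrite subee.
by apply: as_imp (as_all cI H) => e _ h x y; exact: (h (x, y)).
Qed.

End Final.

Theorem theorem1p1 (R : realType) (V : choiceType) (G : graph V)
  (Gconnected : connected_graph G)
  (Glocally_finite : locally_finite G)
  (Gquasi_transitive : quasi_transitive G)
  (Gunimodular : unimodular G R)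
  (d : measure_display) (T : measurableType d) (P : probability T R)
  (p : R) (p01 : 0 <= p <= 1)
  (w : T -> set {fset V})
  (w_percolation : bernoulli_bond_percolation G P p w)
  (infinitely_many :
     {ae P, forall t, infinite_set (infinite_clusters G (w t))}) :
  {ae P, forall t, forall C C' : set V,
     infinite_clusters G (w t) C -> infinite_clusters G (w t) C' -> C <> C' ->
     finite_set (touching G C C')}.
Proof.
have Vc : countable [set: V] := countable_vertices Gconnected Glocally_finite.
(* Clusters are represented by vertices, so that countably many null events suffice. *)
suff : almost_surely G P w (fun e => forall x y, ~ linked e x y -> infinite_set (component e x) ->
    finite_set (touching G (component e x) (component e y))).
  rewrite /almost_surely; apply: filterS => t H _ _ [[x _ <-] infx] [[y _ <-] _] ne.
  have [es _] := adm_opn G w t; apply: H => // xy; apply: ne.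
  apply/seteqP; split=> z /=; apply: linked_trans => //.
  exact: linked_sym.
(* For p = 0 all clusters are single vertices, and for p = 1 there is only one cluster, by
   connectedness. *)
have [p0|/eqP p0] := eqVneq p 0.
  apply: as_imp (all_closed w_percolation Vc p0) => e _ ne x y _ [].
  apply: (sub_finite_set _ (finite_set1 x)) => z [[|n]]; first by move/walk0.
  by case/walkS => z' /ne.
have [p1|/eqP p1] := eqVneq p 1.
  apply: as_imp (all_open w_percolation Vc p1) => e _ ae x y []; rewrite -/(linked e x y).
  have [n [s [ss ps ls]]] := Gconnected x y.
  by exists n, s; split=> //; apply: sub_path ps.
have st : setting G P p w.
  split=> //; case/andP: p01 => ge0 le1.
  by rewrite !lt_neqAle ge0 le1 !andbT eq_sym; apply/andP; split; apply/eqP.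
have cI : countable [set: V * V] by countable_tac.
have H (c : V * V) : almost_surely G P w (fun e => ~ mark G e c.1 c.2) by exact: no_mark st _ _.
apply: as_imp (as_all cI H) => e ea nm x y nxy _; apply: contrapT => inf.
by have [x' [y' m]] := touching_mark ea nxy inf; exact: (nm (x', y')).
Qed.
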